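(* Let $\beta\ge 1$, let $\varphi_1,\ldots,\varphi_n$ be analytic self-maps of $D$, and let $C_{\varphi_1},\ldots,C_{\varphi_n}$ act on $\mathcal{D}_\beta$. Let $F=F(\varphi_1)\cup\cdots\cup F(\varphi_n)$. Then for any complex numbers $c_1,\ldots,c_n$ and any $\zeta$ in $F$, $$\|c_1C_{\varphi_1}+\cdots+c_nC_{\varphi_n}\|_e^2\ \ge\ \sum_{\mathbf{d}\in\mathcal{D}_1(\zeta)}\ \Bigg|\sum_{\substack{j:\ \zeta\in F(\varphi_j)\\ D_1(\varphi_j,\zeta)=\mathbf{d}}}c_j\Bigg|^2\frac{1}{|d_1|^\beta},$$ where $\mathbf{d}=(d_0,d_1)$.
   Context: $D$ is the open unit disk. For $\beta\ge1$, $\mathcal{D}_\beta$ is the reproducing kernel Hilbert space of analytic functions on $D$ with kernel functions $k_w(z)=(1-\overline{w}z)^{-\beta}$ ($\mathcal{D}_1=H^2$; for $\beta>1$ it is the weighted Bergman space $A^2_{\beta-2}$). $C_\varphi f=f\circ\varphi$ is bounded on $\mathcal{D}_\beta$. $\|T\|_e$ is the operator-norm distance from $T$ to the compact operators. An analytic self-map $\varphi$ of $D$ has a finite angular derivative at $\zeta\in\partial D$ if the non-tangential limit $\varphi(\zeta)$ exists with $|\varphi(\zeta)|=1$ and $\varphi'(\zeta)=\lim_{\angle z\to\zeta}\frac{\varphi(z)-\varphi(\zeta)}{z-\zeta}$ (non-tangential limit) exists as a finite complex number. $F(\varphi)$ is the set of all such $\zeta$. For $\zeta\in F(\varphi)$,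 $D_1(\varphi,\zeta)=(\varphi(\zeta),\varphi'(\zeta))$. The set $\mathcal{D}_1(\zeta)=\{D_1(\varphi_j,\zeta):1\le j\le n,\ \zeta\in F(\varphi_j)\}$ (a set, without repetition). *)

(* Defs.v *)
From Stdlib Require Export Reals List Permutation ClassicalEpsilon.
From Coquelicot Require Export Coquelicot.
Open Scope R_scope.

Definition list_sum {A : Type} {G : AbelianMonoid} (l : list A) (f : A -> G) : G :=
  fold_right (fun x s => plus (f x) s) zero l.

Definition enumerates {A : Type} (P : A -> Prop) (l : list A) : Prop :=
  NoDup l /\ forall x, In x l <-> P x.

(* The sum of f over the set P. It is meaningful when P is finite: the value
   then does not depend on the repetition-free enumeration that is chosen.
   Otherwise it is a junk value. *)
Definition set_sum {A : Type} {G : AbelianMonoid} (P : A -> Prop) (f : A -> G) : G :=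
  list_sum (epsilon (inhabits nil) (enumerates P)) f.

Lemma set_sum_enumerates {A : Type} {G : AbelianMonoid} (P : A -> Prop)
    (l : list A) (f : A -> G) :
  enumerates P l -> set_sum P f = list_sum l f.
Proof.
intros Hl; unfold set_sum.
assert (He : enumerates P (epsilon (inhabits nil) (enumerates P)))
  by (apply epsilon_spec; exists l; exact Hl).
revert He; generalize (epsilon (inhabits nil) (enumerates P)); intros l' He.
destruct He as [Nl' Hl'], Hl as [Nl Hl].
assert (Hp : Permutation l' l).
{ apply NoDup_Permutation; auto.
  intros x; rewrite Hl', Hl; tauto. }
clear Nl Nl' Hl Hl'; unfold list_sum.
induction Hp as [|x l1 l2 _ IH|x y l1|l1 l2 l3 _ IH1 _ IH2]; simpl.
- reflexivity.
- now rewrite IH.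
- now rewrite !plus_assoc, (plus_comm (f y) (f x)).
- now rewrite IH1.
Qed.

Definition Disk : Type := {z : C | Cmod z < 1}.

Definition disk_val (z : Disk) : C := proj1_sig z.
Coercion disk_val : Disk >-> C.

Definition analytic (f : Disk -> C) : Prop :=
  forall z0 : Disk, exists (r : R) (a : nat -> C), 0 < r /\
    forall z : Disk, Cmod (z - z0)%C < r ->
      @is_pseries C_AbsRing C_NormedModule a (z - z0)%C (f z).

(* The principal branch of u ^ s for Re u > 0, where arg u = atan (Im u / Re u).
   For z and w in the disk, 1 - conj(w) z lies in this half-plane. *)
Definition Cpower (u : C) (s : R) : C :=
  let theta := atan (Im u / Re u) in
  (RtoC (Rpower (Cmod u) s) * (cos (s * theta), sin (s * theta)))%C.

Definition kernel (beta : R) (w z : Disk) : C :=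
  Cpower (1 - Cconj w * z)%C (- beta).

Definition fadd (f g : Disk -> C) : Disk -> C := fun z => (f z + g z)%C.
Definition fsub (f g : Disk -> C) : Disk -> C := fun z => (f z - g z)%C.
Definition fscal (a : C) (f : Disk -> C) : Disk -> C := fun z => (a * f z)%C.

(* The space D_beta: a Hilbert space of analytic functions on the disk whose
   reproducing kernel is [kernel beta]. A reproducing kernel determines the
   carrier and, on the carrier, the inner product (Moore-Aronszajn). The values
   of [inner] off the carrier are irrelevant. *)
Record Dspace (beta : R) : Type := {
  carrier : (Disk -> C) -> Prop;
  inner : (Disk -> C) -> (Disk -> C) -> C;
  carrier_analytic : forall f, carrier f -> analytic f;
  carrier_zero : carrier (fun _ => RtoC 0);
  carrier_add : forall f g, carrier f -> carrier g -> carrier (fadd f g);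
  carrier_scal : forall a f, carrier f -> carrier (fscal a f);
  inner_add_l : forall f g h, carrier f -> carrier g -> carrier h ->
    inner (fadd f g) h = (inner f h + inner g h)%C;
  inner_scal_l : forall a f h, carrier f -> carrier h ->
    inner (fscal a f) h = (a * inner f h)%C;
  inner_conj : forall f g, carrier f -> carrier g ->
    inner g f = Cconj (inner f g);
  inner_pos : forall f, carrier f -> 0 <= Re (inner f f);
  inner_def : forall f, carrier f -> inner f f = RtoC 0 -> forall z, f z = RtoC 0;
  inner_complete : forall u : nat -> Disk -> C,
    (forall n, carrier (u n)) ->
    (forall eps, 0 < eps -> exists N, forall m n, (N <= m)%nat -> (N <= n)%nat ->
      sqrt (Re (inner (fsub (u m) (u n)) (fsub (u m) (u n)))) < eps) ->
    exists g, carrier g /\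
      is_lim_seq (fun n => sqrt (Re (inner (fsub (u n) g) (fsub (u n) g)))) 0;
  kernel_carrier : forall w, carrier (kernel beta w);
  reproducing : forall f w, carrier f -> inner f (kernel beta w) = f w
}.

Arguments carrier {beta} _ _.
Arguments inner {beta} _ _ _.

Definition hnorm {beta : R} (H : Dspace beta) (f : Disk -> C) : R :=
  sqrt (Re (inner H f f)).

Definition operator : Type := (Disk -> C) -> (Disk -> C).

Definition compact_operator {beta : R} (H : Dspace beta) (K : operator) : Prop :=
  (forall f, carrier H f -> carrier H (K f)) /\
  (forall f g, carrier H f -> carrier H g ->
     forall z, K (fadd f g) z = fadd (K f) (K g) z) /\
  (forall a f, carrier H f -> forall z, K (fscal a f) z = fscal a (K f) z) /\
  (forall (u : nat -> Disk -> C) (B : R),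
     (forall m, carrier H (u m) /\ hnorm H (u m) <= B) ->
     exists (s : nat -> nat) (g : Disk -> C),
       (forall m, (s m < s (S m))%nat) /\ carrier H g /\
       is_lim_seq (fun m => hnorm H (fsub (K (u (s m))) g)) 0).

(* The operator norm as the least bound; it is p_infty when S does not map the
   space boundedly into itself. *)
Definition op_norm {beta : R} (H : Dspace beta) (S : operator) : Rbar :=
  Glb_Rbar (fun M => 0 <= M /\ forall f, carrier H f ->
    carrier H (S f) /\ hnorm H (S f) <= M * hnorm H f).

Definition ess_norm {beta : R} (H : Dspace beta) (T : operator) : Rbar :=
  Rbar_glb (fun x => exists K : operator, compact_operator H K /\
    x = op_norm H (fun f => fsub (T f) (K f))).

Definition comp_op (phi : Disk -> Disk) : operator := fun f z => f (phi z).

Definition lin_comb (n : nat) (c : nat -> C) (T : nat -> operator) : operator :=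
  fun f z => list_sum (seq 0 n) (fun j => (c j * T j f z)%C).

(* Limit at zeta inside every Stolz region |z - zeta| < M (1 - |z|). *)
Definition nontangential_lim (g : Disk -> C) (zeta l : C) : Prop :=
  forall M eps : R, 0 < eps -> exists delta : R, 0 < delta /\
    forall z : Disk, Cmod (z - zeta)%C < M * (1 - Cmod z) ->
      Cmod (z - zeta)%C < delta -> Cmod (g z - l)%C < eps.

(* [has_D1 phi zeta d] says that zeta is in F(phi) and D_1(phi, zeta) = d;
   d is unique because non-tangential limits are. *)
Definition has_D1 (phi : Disk -> Disk) (zeta : C) (d : C * C) : Prop :=
  Cmod zeta = 1 /\
  nontangential_lim (fun z => disk_val (phi z)) zeta (fst d) /\
  Cmod (fst d) = 1 /\
  nontangential_lim (fun z => ((phi z - fst d) / (z - zeta))%C) zeta (snd d).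

Definition in_F (phi : Disk -> Disk) (zeta : C) : Prop :=
  exists d, has_D1 phi zeta d.

Definition D1_set (n : nat) (phi : nat -> Disk -> Disk) (zeta : C) (d : C * C) : Prop :=
  exists j, (j < n)%nat /\ has_D1 (phi j) zeta d.

(* Main.v *)
From Stdlib Require Import Lra Lia Classical FunctionalExtensionality ProofIrrelevance.
Require Import Defs.

(* Write T for the combination, g_w = T* k_w = sum conj(c_j) k_(phi_j(w)).  If K is compact and
   |T - K| <= M, testing T - K on g_w / |g_w| against k_w gives |g_w| <= (M + o(1)) |k_w| as w tends
   to zeta, because K maps the unit ball into a relatively compact set and the normalized kernels
   tend weakly to 0.  Now |g_w|^2 / |k_w|^2 is the quadratic form in c with entries
   ((1 - |w|^2) / (1 - conj(phi_i(w)) phi_j(w)))^beta.  Along w = zeta (1 - t (1 + i s)), letting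
   first t -> 0 and then s -> infinity, such an entry tends to |d_1|^(-beta) if phi_i and phi_j
   share the data d at zeta, and to 0 otherwise: for equal boundary values and angular derivatives
   of moduli a <> b the limit in t is (2 / ((a + b) + i s (b - a)))^beta, and if zeta is not in
   F(phi_i) the entry vanishes by the Julia-Caratheodory theorem.  The latter is derived from
   Pick's inequality for functions with nonnegative real part, itself a consequence of the
   maximum principle. *)

(** Radial approach would not suffice: for equal boundary values and derivatives of moduli a <> b it
    leaves the nonzero cross entry (2 / (a + b))^beta. Tilting the segment removes this entry and
    leaves those with a = b untouched, since there the parameter s cancels. For a common d_0 only
    the moduli have to be compared, because conj(d_0) zeta d_1 is positive, so that d_0 and |d_1|
    determine the datum. As F is defined by non-tangential limits, the hard part of
    Julia-Caratheodory is the one needed: boundedness of (1 - |phi(w)|^2) / (1 - |w|^2) on some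
    approach to zeta must produce these limits. Functions with nonnegative real part enter there
    because a suitable multiple of the Poisson kernel can be subtracted without leaving the class,
    an operation that has no direct counterpart for self-maps of the disk. *)

Ltac Cunfold :=
  rewrite ?Cmod2_alt;
  unfold Cminus, Cplus, Cmult, Copp, Cconj, Re, Im, RtoC in *; simpl.

(** * Elementary estimates for complex moduli *)

Lemma Cmod_sub_sym (a b : C) : Cmod (a - b)%C = Cmod (b - a)%C.
Proof. rewrite <- Cmod_opp; f_equal; ring. Qed.

Lemma Cmod_triangle_sub (a b : C) : Cmod (a - b)%C <= Cmod a + Cmod b.
Proof. unfold Cminus; rewrite <- (Cmod_opp b); apply Cmod_triangle. Qed.

Lemma Cmod_sub_ge (a b : C) : Cmod a - Cmod b <= Cmod (a - b)%C.
Proof.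
generalize (Cmod_triangle (a - b)%C b); replace (a - b + b)%C with a by ring; lra.
Qed.

Lemma pow2_le_reg (a b : R) : 0 <= b -> a ^ 2 <= b ^ 2 -> a <= b.
Proof. intros; nra. Qed.

Lemma Re_le_Cmod (z : C) : Re z <= Cmod z.
Proof. generalize (re_le_Cmod z); unfold Rabs; destruct Rcase_abs; lra. Qed.

Lemma Im_le_Cmod (z : C) : Rabs (Im z) <= Cmod z.
Proof.
apply Rle_trans with (2 := Rmax_Cmod z); apply Rmax_r.
Qed.

Lemma Cmod_le_Re_Im (z : C) : Cmod z <= Rabs (Re z) + Rabs (Im z).
Proof.
apply pow2_le_reg.
- generalize (Rabs_pos (Re z)) (Rabs_pos (Im z)); lra.
- rewrite Cmod2_alt, <- (pow2_abs (Re z)), <- (pow2_abs (Im z)).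
  generalize (Rabs_pos (Re z)) (Rabs_pos (Im z)); nra.
Qed.

(** * Compactness of closed disks *)

Lemma real_cluster_point (u : nat -> R) (B : R) :
  (forall n, Rabs (u n) <= B) ->
  exists l, forall eps N, 0 < eps -> exists p, (N <= p)%nat /\ Rabs (u p - l) < eps.
Proof.
intros Hu.
destruct (Bolzano_Weierstrass u (fun c => - B <= c <= B) (compact_P3 _ _)) as [l Hl].
{ intros n; apply Rabs_le_between, Hu. }
exists l; intros eps N He.
destruct (Hl (disc l (mkposreal eps He)) N) as [p [Hp Hd]].
- exists (mkposreal eps He); intros x Hx; exact Hx.
- exists p; split; [exact Hp | exact Hd].
Qed.

(** The real parts are made convergent along [s], at rate 1 / (k + 1), and the imaginary parts are
    then clustered along [s]. The cluster form avoids extracting a second subsequence. *)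
Lemma complex_cluster_point (u : nat -> C) (B : R) :
  (forall n, Cmod (u n) <= B) ->
  exists l, forall eps N, 0 < eps -> exists p, (N <= p)%nat /\ Cmod (u p - l)%C < eps.
Proof.
intros Hu.
destruct (real_cluster_point (fun n => Re (u n)) B) as [x Hx].
{ intros n; eapply Rle_trans; [apply re_le_Cmod | apply Hu]. }
destruct (choice (fun k p => (k <= p)%nat /\ Rabs (Re (u p) - x) < / (INR k + 1)))
  as [s Hs].
{ intros k; apply Hx, Rinv_0_lt_compat; generalize (pos_INR k); lra. }
destruct (real_cluster_point (fun k => Im (u (s k))) B) as [y Hy].
{ intros n; eapply Rle_trans; [apply Im_le_Cmod | apply Hu]. }
exists (x, y); intros eps N He.
destruct (archimed_cor1 (eps / 2)) as [M [HM HM0]]; [lra|].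
destruct (Hy (eps / 2) (Nat.max N M)) as [k [Hk Hky]]; [lra|].
destruct (Hs k) as [Hk1 Hk2].
exists (s k); split; [lia|].
apply Rle_lt_trans with (1 := Cmod_le_Re_Im _).
replace (Re (u (s k) - (x, y))%C) with (Re (u (s k)) - x)
  by (destruct (u (s k)); reflexivity).
replace (Im (u (s k) - (x, y))%C) with (Im (u (s k)) - y)
  by (destruct (u (s k)); reflexivity).
assert (/ (INR k + 1) <= / INR M).
{ apply Rinv_le_contravar; [apply lt_0_INR, HM0|].
  assert (INR M <= INR k) by (apply le_INR; lia); lra. }
lra.
Qed.

(** The same sequential argument runs twice: points with values above n, and then points with values
    above the supremum minus 1 / (n + 1), have a cluster point at which continuity decides. *)
Lemma disk_attains_max (u : C -> R) (r : R) :
  0 <= r ->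
  (forall z, Cmod z <= r -> forall eps, 0 < eps -> exists delta, 0 < delta /\
     forall y, Cmod (y - z)%C < delta -> Rabs (u y - u z) < eps) ->
  exists z, Cmod z <= r /\ forall y, Cmod y <= r -> u y <= u z.
Proof.
intros Hr Hc.
assert (Hbd : bound (fun v => exists z, Cmod z <= r /\ v = u z)).
{ apply NNPP; intros Hn.
  destruct (choice (fun (n : nat) z => Cmod z <= r /\ INR n < u z)) as [s Hs].
  { intros n; apply NNPP; intros Hz; apply Hn; exists (INR n).
    intros v [z [Hz1 ->]]; apply Rnot_lt_le; intros Hlt; apply Hz; exists z; auto. }
  destruct (complex_cluster_point s r) as [l Hl]; [intros n; apply Hs|].
  assert (Hlr : Cmod l <= r).
  { apply Rnot_lt_le; intros Hlt.
    destruct (Hl (Cmod l - r) 0%nat) as [p [_ Hp]]; [lra|].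
    generalize (Cmod_sub_ge l (s p)) (proj1 (Hs p)).
    rewrite Cmod_sub_sym; lra. }
  destruct (Hc l Hlr 1 ltac:(lra)) as [d [Hd Hd']].
  destruct (INR_unbounded (u l + 1)) as [N HN].
  destruct (Hl d N Hd) as [p [HpN Hp]].
  generalize (Hd' _ Hp); intros Ha; apply Rabs_lt_between in Ha.
  assert (INR N <= INR p) by (apply le_INR; lia).
  generalize (proj2 (Hs p)); lra. }
destruct (completeness _ Hbd) as [m [Hub Hlub]].
{ exists (u 0%C), 0%C; split; [rewrite Cmod_0; exact Hr | reflexivity]. }
destruct (choice (fun (n : nat) z => Cmod z <= r /\ m - / (INR n + 1) < u z)) as [s Hs].
{ intros n; apply NNPP; intros Hz.
  assert (Hp : 0 < / (INR n + 1))
    by (apply Rinv_0_lt_compat; generalize (pos_INR n); lra).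
  assert (m <= m - / (INR n + 1)); [|lra].
  apply Hlub; intros v [z [Hz1 ->]]; apply Rnot_lt_le; intros Hlt.
  apply Hz; exists z; auto. }
destruct (complex_cluster_point s r) as [l Hl]; [intros n; apply Hs|].
assert (Hlr : Cmod l <= r).
{ apply Rnot_lt_le; intros Hlt.
  destruct (Hl (Cmod l - r) 0%nat) as [p [_ Hp]]; [lra|].
  generalize (Cmod_sub_ge l (s p)) (proj1 (Hs p)).
  rewrite Cmod_sub_sym; lra. }
exists l; split; [exact Hlr|].
intros y Hy; apply Rle_trans with m; [apply Hub; exists y; auto|].
apply Rnot_lt_le; intros Hlt.
destruct (Hc l Hlr ((m - u l) / 2) ltac:(lra)) as [d [Hd Hd']].
destruct (archimed_cor1 ((m - u l) / 2)) as [M [HM HM0]]; [lra|].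
destruct (Hl d M Hd) as [p [HpM Hp]].
generalize (Hd' _ Hp); intros Ha; apply Rabs_lt_between in Ha.
assert (/ (INR p + 1) <= / INR M).
{ apply Rinv_le_contravar; [apply lt_0_INR, HM0|].
  assert (INR M <= INR p) by (apply le_INR; lia); lra. }
generalize (proj2 (Hs p)); lra.
Qed.

(** * Iterated difference quotients *)

(* [taylor N z0 f] is a Taylor expansion of order [N] at [z0] with a bounded
   remainder.  Unlike local power series it is trivially stable under products
   and inverses, and order 3 suffices for the maximum principle. *)
Fixpoint taylor (N : nat) (z0 : C) (f : C -> C) : Prop :=
  match N with
  | O => exists delta B, 0 < delta /\
      forall z, Cmod (z - z0)%C < delta -> Cmod (f z) <= B
  | S N => exists delta g, 0 < delta /\ taylor N z0 g /\
      forall z, Cmod (z - z0)%C < delta -> f z = (f z0 + (z - z0) * g z)%C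
  end.

(** Inversion and division by z - z0 each lose one order; asking for all orders absorbs this. *)
Definition holo (z0 : C) (f : C -> C) : Prop := forall N, taylor N z0 f.

Lemma Cmod_self (z : C) : Cmod (z - z)%C = 0.
Proof. replace (z - z)%C with (RtoC 0) by ring; apply Cmod_0. Qed.

Lemma taylor_ext (N : nat) (z0 : C) (f g : C -> C) (delta : R) :
  0 < delta -> (forall z, Cmod (z - z0)%C < delta -> f z = g z) ->
  taylor N z0 f -> taylor N z0 g.
Proof.
intros Hd He; destruct N as [|N]; simpl.
- intros [d [B [Hd1 HB]]]; exists (Rmin d delta), B; split.
  { apply Rmin_glb_lt; assumption. }
  intros z Hz; rewrite <- He; [apply HB|];
    eapply Rlt_le_trans; try exact Hz; [apply Rmin_l | apply Rmin_r].
- intros [d [h [Hd1 [Hh Hf]]]]; exists (Rmin d delta), h; split.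
  { apply Rmin_glb_lt; assumption. }
  split; [exact Hh|].
  intros z Hz; rewrite <- !He; [apply Hf| |].
  + eapply Rlt_le_trans; [exact Hz | apply Rmin_l].
  + rewrite Cmod_self; exact Hd.
  + eapply Rlt_le_trans; [exact Hz | apply Rmin_r].
Qed.

Lemma taylor_pred (N : nat) (z0 : C) (f : C -> C) : taylor (S N) z0 f -> taylor N z0 f.
Proof.
revert f; induction N as [|N IH]; intros f.
- intros [d [g [Hd [[d' [B [Hd' HB]]] Hf]]]].
  exists (Rmin (Rmin d d') 1), (Cmod (f z0) + B); split.
  { repeat apply Rmin_glb_lt; lra. }
  intros z Hz.
  generalize (Rmin_l (Rmin d d') 1) (Rmin_r (Rmin d d') 1) (Rmin_l d d') (Rmin_r d d').
  intros; rewrite Hf by lra.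
  eapply Rle_trans; [apply Cmod_triangle|]; rewrite Cmod_mult.
  assert (Cmod (g z) <= B) by (apply HB; lra).
  generalize (Cmod_ge_0 (z - z0)%C) (Cmod_ge_0 (g z)); nra.
- intros [d [g [Hd [Hg Hf]]]]; exists d, g; auto.
Qed.

Lemma taylor_const (N : nat) (z0 a : C) : taylor N z0 (fun _ => a).
Proof.
revert a; induction N as [|N IH]; intros a; simpl.
- exists 1, (Cmod a); split; [lra|]; intros; lra.
- exists 1, (fun _ => 0%C); split; [lra|]; split; [apply IH|]; intros; ring.
Qed.

Lemma taylor_id (N : nat) (z0 : C) : taylor N z0 (fun z => z).
Proof.
destruct N as [|N]; simpl.
- exists 1, (1 + Cmod z0); split; [lra|]; intros z Hz.
  generalize (Cmod_sub_ge z z0); lra.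
- exists 1, (fun _ => 1%C); split; [lra|]; split; [apply taylor_const|]; intros; ring.
Qed.

Lemma taylor_add (N : nat) (z0 : C) (f g : C -> C) :
  taylor N z0 f -> taylor N z0 g -> taylor N z0 (fun z => f z + g z)%C.
Proof.
revert f g; induction N as [|N IH]; intros f g.
- intros [d [B [Hd HB]]] [d' [B' [Hd' HB']]]; exists (Rmin d d'), (B + B'); split.
  { apply Rmin_glb_lt; assumption. }
  intros z Hz; generalize (Rmin_l d d') (Rmin_r d d'); intros.
  eapply Rle_trans; [apply Cmod_triangle|].
  apply Rplus_le_compat; [apply HB | apply HB']; lra.
- intros [d [f1 [Hd [Hf1 Hf]]]] [d' [g1 [Hd' [Hg1 Hg]]]].
  exists (Rmin d d'), (fun z => f1 z + g1 z)%C; split.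
  { apply Rmin_glb_lt; assumption. }
  split; [apply IH; assumption|].
  intros z Hz; generalize (Rmin_l d d') (Rmin_r d d'); intros.
  rewrite Hf, Hg by lra; ring.
Qed.

Lemma taylor_mul (N : nat) (z0 : C) (f g : C -> C) :
  taylor N z0 f -> taylor N z0 g -> taylor N z0 (fun z => f z * g z)%C.
Proof.
revert f g; induction N as [|N IH]; intros f g.
- intros [d [B [Hd HB]]] [d' [B' [Hd' HB']]]; exists (Rmin d d'), (B * B'); split.
  { apply Rmin_glb_lt; assumption. }
  intros z Hz; generalize (Rmin_l d d') (Rmin_r d d'); intros.
  rewrite Cmod_mult; apply Rmult_le_compat; try apply Cmod_ge_0; [apply HB | apply HB']; lra.
- intros [d [f1 [Hd [Hf1 Hf]]]] Hg0; generalize (taylor_pred _ _ _ Hg0); intros HgN.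
  destruct Hg0 as [d' [g1 [Hd' [Hg1 Hg]]]].
  exists (Rmin d d'), (fun z => f z0 * g1 z + f1 z * g z)%C; split.
  { apply Rmin_glb_lt; assumption. }
  split.
  { apply taylor_add; [apply (IH (fun _ => f z0)); [apply taylor_const | assumption]|].
    apply IH; assumption. }
  intros z Hz; generalize (Rmin_l d d') (Rmin_r d d'); intros.
  rewrite Hf, Hg by lra; ring.
Qed.

(** From 1/f - 1/f(z0) = - (z - z0) g / (f(z0) f), the difference quotient of 1/f again contains 1/f
    at the previous order. One order is lost at the start: bounding 1/f near z0 takes continuity of
    f, that is, order 1. *)
Lemma taylor_inv (N : nat) (z0 : C) (f : C -> C) :
  f z0 <> 0%C -> taylor (S N) z0 f -> taylor N z0 (fun z => / f z)%C.
Proof.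
intros Hz0.
assert (Hlow : taylor 1 z0 f -> exists d, 0 < d /\
    forall z, Cmod (z - z0)%C < d -> Cmod (f z0) / 2 <= Cmod (f z)).
{ apply Cmod_gt_0 in Hz0.
  intros [d [g [Hd [[d' [B [Hd' HB]]] Hf]]]].
  assert (HB0 : 0 <= B).
  { apply Rle_trans with (1 := Cmod_ge_0 (g z0)), HB; rewrite Cmod_self; exact Hd'. }
  exists (Rmin (Rmin d d') (Cmod (f z0) / (2 * (B + 1)))); split.
  { repeat apply Rmin_glb_lt; try lra; apply Rdiv_lt_0_compat; lra. }
  intros z Hz.
  generalize (Rmin_l (Rmin d d') (Cmod (f z0) / (2 * (B + 1))))
    (Rmin_r (Rmin d d') (Cmod (f z0) / (2 * (B + 1)))) (Rmin_l d d') (Rmin_r d d').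
  intros; rewrite (Hf z) by lra.
  assert (Hg : Cmod (g z) <= B) by (apply HB; lra).
  generalize (Cmod_sub_ge (f z0) (- ((z - z0) * g z))%C).
  replace (f z0 - - ((z - z0) * g z))%C with (f z0 + (z - z0) * g z)%C by ring.
  rewrite Cmod_opp, Cmod_mult; intros Hge.
  assert (Cmod (z - z0)%C * Cmod (g z) <= Cmod (f z0) / 2); [|lra].
  apply Rle_trans with (Cmod (f z0) / (2 * (B + 1)) * (B + 1)).
  - apply Rmult_le_compat; try apply Cmod_ge_0; lra.
  - right; field; lra. }
revert f Hz0 Hlow; induction N as [|N IH]; intros f Hz0 Hlow Hf.
- destruct (Hlow Hf) as [d [Hd Hd']].
  apply Cmod_gt_0 in Hz0.
  exists d, (/ (Cmod (f z0) / 2)); split; [exact Hd|].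
  intros z Hz; specialize (Hd' z Hz).
  rewrite Cmod_inv by (apply Cmod_gt_0; lra).
  apply Rinv_le_contravar; lra.
- assert (Hf1 : taylor 1 z0 f).
  { clear -Hf; revert Hf; generalize (S N); intros k; induction k as [|k IHk]; auto.
    intros H; apply IHk, taylor_pred, H. }
  destruct (Hlow Hf1) as [d [Hd Hd']].
  assert (Hi := IH f Hz0 Hlow (taylor_pred _ _ _ Hf)).
  destruct Hf as [d' [g [Hd0 [Hg Hf]]]].
  exists (Rmin d d'), (fun z => (- / f z0) * (g z * / f z))%C; split.
  { apply Rmin_glb_lt; assumption. }
  split.
  { apply taylor_mul; [apply taylor_const|].
    apply taylor_mul; [apply taylor_pred, Hg | exact Hi]. }
  intros z Hz; generalize (Rmin_l d d') (Rmin_r d d'); intros.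
  assert (Hfz : f z <> 0%C).
  { apply Cmod_gt_0; apply Cmod_gt_0 in Hz0; specialize (Hd' z ltac:(lra)); lra. }
  replace (g z * / f z)%C with ((g z) / f z)%C by reflexivity.
  assert (E : ((z - z0) * g z = f z - f z0)%C) by (rewrite (Hf z) by lra; ring).
  transitivity (/ f z0 - / f z0 * ((z - z0) * g z) / f z)%C.
  { rewrite E; field; split; assumption. }
  field; split; assumption.
Qed.

Lemma holo_const (z0 a : C) : holo z0 (fun _ => a).
Proof. intros N; apply taylor_const. Qed.

Lemma holo_id (z0 : C) : holo z0 (fun z => z).
Proof. intros N; apply taylor_id. Qed.

Lemma holo_add (z0 : C) (f g : C -> C) :
  holo z0 f -> holo z0 g -> holo z0 (fun z => f z + g z)%C.
Proof. intros Hf Hg N; apply taylor_add; auto. Qed.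

Lemma holo_mul (z0 : C) (f g : C -> C) :
  holo z0 f -> holo z0 g -> holo z0 (fun z => f z * g z)%C.
Proof. intros Hf Hg N; apply taylor_mul; auto. Qed.

Lemma holo_opp (z0 : C) (f : C -> C) : holo z0 f -> holo z0 (fun z => - f z)%C.
Proof.
intros Hf N; apply (taylor_ext N z0 (fun z => RtoC (-1) * f z)%C _ 1); [lra| |].
- intros; ring.
- apply taylor_mul; [apply taylor_const | apply Hf].
Qed.

Lemma holo_sub (z0 : C) (f g : C -> C) :
  holo z0 f -> holo z0 g -> holo z0 (fun z => f z - g z)%C.
Proof. intros Hf Hg; apply (holo_add z0 f (fun z => - g z)%C); [|apply holo_opp]; auto. Qed.

Lemma holo_inv (z0 : C) (f : C -> C) :
  f z0 <> 0%C -> holo z0 f -> holo z0 (fun z => / f z)%C.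
Proof. intros H0 Hf N; apply taylor_inv; auto. Qed.

Lemma taylor_continuous (z0 : C) (f : C -> C) :
  taylor 1 z0 f -> forall eps, 0 < eps -> exists delta, 0 < delta /\
    forall z, Cmod (z - z0)%C < delta -> Cmod (f z - f z0)%C < eps.
Proof.
intros [d [g [Hd [[d' [B [Hd' HB]]] Hf]]]] eps He.
assert (HB0 : 0 <= B).
{ apply Rle_trans with (1 := Cmod_ge_0 (g z0)), HB; rewrite Cmod_self; exact Hd'. }
exists (Rmin (Rmin d d') (eps / (B + 1))); split.
{ repeat apply Rmin_glb_lt; try lra; apply Rdiv_lt_0_compat; lra. }
intros z Hz.
generalize (Rmin_l (Rmin d d') (eps / (B + 1)))
  (Rmin_r (Rmin d d') (eps / (B + 1))) (Rmin_l d d') (Rmin_r d d').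
intros; rewrite (Hf z) by lra.
replace (f z0 + (z - z0) * g z - f z0)%C with ((z - z0) * g z)%C by ring.
rewrite Cmod_mult.
assert (Hg : Cmod (g z) <= B) by (apply HB; lra).
apply Rle_lt_trans with (Cmod (z - z0)%C * B).
{ apply Rmult_le_compat_l; [apply Cmod_ge_0 | exact Hg]. }
apply Rle_lt_trans with (Cmod (z - z0)%C * (B + 1)).
{ generalize (Cmod_ge_0 (z - z0)%C); nra. }
apply Rlt_le_trans with (eps / (B + 1) * (B + 1)); [|right; field; lra].
apply Rmult_lt_compat_r; lra.
Qed.

(** * Power series have iterated difference quotients of every order *)

Lemma Cmod_pow_n (h : C) (k : nat) : Cmod (@pow_n C_Ring h k) = Cmod h ^ k.
Proof.
induction k as [|k IH].
- apply Cmod_1.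
- change (@pow_n C_Ring h (S k)) with (h * @pow_n C_Ring h k)%C.
  rewrite Cmod_mult, IH; reflexivity.
Qed.

(** Convergence at distance r/2 bounds the terms there, as differences of bounded partial sums. At
    distance below r/4 the terms are then dominated by a geometric series of ratio 1/2. *)
Lemma pseries_locally_bounded (a : nat -> C) (z0 : C) (r : R) (f : C -> C) :
  0 < r ->
  (forall z, Cmod (z - z0)%C < r ->
     @is_pseries C_AbsRing C_NormedModule a (z - z0)%C (f z)) ->
  taylor 0 z0 f.
Proof.
intros Hr Hf.
set (rho := (r / 2)%R).
set (b := fun k => (@pow_n C_Ring (RtoC rho) k * a k)%C).
assert (Hb : exists M, forall k, Cmod (b k) <= M).
{ assert (Hs : @is_pseries C_AbsRing C_NormedModule a (RtoC rho) (f (z0 + RtoC rho)%C)).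
  { replace (RtoC rho) with ((z0 + RtoC rho) - z0)%C at 1 by ring.
    apply Hf; replace (z0 + RtoC rho - z0)%C with (RtoC rho) by ring.
    rewrite Cmod_R, Rabs_pos_eq; unfold rho; lra. }
  destruct (filterlim_bounded (K := C_AbsRing) (V := C_NormedModule)
    (sum_n (fun k => scal (pow_n (RtoC rho : C_AbsRing) k) (a k : C_NormedModule))))
    as [M HM]; [exists (f (z0 + RtoC rho)%C); exact Hs|].
  assert (HM' : forall n, Cmod (@sum_n C_AbelianMonoid b n) <= M).
  { intros n; exact (HM n). }
  exists (2 * M); intros [|k].
  - generalize (HM' 0%nat) (Cmod_ge_0 (b 0%nat)); rewrite sum_O; lra.
  - replace (b (S k)) with (@sum_n C_AbelianMonoid b (S k) - @sum_n C_AbelianMonoid b k)%C.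
    + eapply Rle_trans; [apply Cmod_triangle_sub|].
      generalize (HM' k) (HM' (S k)); lra.
    + rewrite sum_Sn; change plus with Cplus; simpl; ring. }
destruct Hb as [M HM].
assert (HM0 : 0 <= M) by (apply Rle_trans with (2 := HM 0%nat), Cmod_ge_0).
exists (rho / 2), (2 * M + 1); split; [unfold rho; lra|].
intros z Hz.
assert (Hzr : Cmod (z - z0)%C < r) by (unfold rho in Hz; lra).
set (s := fun k => (@pow_n C_Ring (z - z0)%C k * a k)%C).
assert (Hk : forall k, Cmod (s k) <= M * (/ 2) ^ k).
{ intros k; apply Rle_trans with (Cmod (b k) * (/ 2) ^ k).
  - unfold s, b; rewrite !Cmod_mult, !Cmod_pow_n, Cmod_R, Rabs_pos_eq by (unfold rho; lra).
    replace (rho ^ k * Cmod (a k) * (/ 2) ^ k) with ((rho / 2) ^ k * Cmod (a k)).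
    + apply Rmult_le_compat_r; [apply Cmod_ge_0|].
      apply pow_incr; split; [apply Cmod_ge_0 | lra].
    + unfold Rdiv; rewrite Rpow_mult_distr; ring.
  - apply Rmult_le_compat_r; [apply pow_le; lra | apply HM]. }
(* The exact geometric partial sum is kept, since the bound 2 M alone is not inductive. *)
assert (Hp : forall n, Cmod (@sum_n C_AbelianMonoid s n) <= M * (2 - (/ 2) ^ n)).
{ induction n as [|n IH].
  - rewrite sum_O; generalize (Hk 0%nat); simpl; lra.
  - rewrite sum_Sn; eapply Rle_trans; [apply Cmod_triangle|].
    generalize (Hk (S n)); simpl; intros; simpl in IH; nra. }
assert (Hl := Hf z Hzr).
assert (Hlim := proj1 (filterlim_locally_ball_norm (K := C_AbsRing) (U := C_NormedModule) _ _) Hl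
  (mkposreal 1 Rlt_0_1)).
destruct Hlim as [N HN]; specialize (HN N (Nat.le_refl N)).

change (Cmod (@sum_n C_AbelianMonoid s N - f z)%C < 1) in HN.
generalize (Cmod_sub_ge (f z) (@sum_n C_AbelianMonoid s N)) (Hp N).
rewrite Cmod_sub_sym.
assert (0 < (/ 2) ^ N) by (apply pow_lt; lra); nra.
Qed.

(** The difference quotient at the centre, completed there by a_1, is the sum of the shifted series
    on the same disk, so the induction never shrinks the radius. *)
Lemma pseries_holo (a : nat -> C) (z0 : C) (r : R) (f : C -> C) :
  0 < r ->
  (forall z, Cmod (z - z0)%C < r ->
     @is_pseries C_AbsRing C_NormedModule a (z - z0)%C (f z)) ->
  holo z0 f.
Proof.
intros Hr Hf N; revert a f Hf; induction N as [|N IH]; intros a f Hf.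
- apply (pseries_locally_bounded a z0 r); assumption.
- assert (H0 : f z0 = a 0%nat).
  { assert (Hs := Hf z0 ltac:(rewrite Cmod_self; exact Hr)).
    replace (z0 - z0)%C with (@zero C_AbsRing) in Hs
      by (change (RtoC 0 = (z0 - z0)%C); ring).
    exact (filterlim_locally_unique (K := C_AbsRing) (V := C_NormedModule)
      _ _ _ Hs (is_pseries_0 (K := C_AbsRing) (V := C_NormedModule) a)). }
  set (g := fun z => if excluded_middle_informative (z = z0) then a 1%nat
                     else (/ (z - z0) * (f z - a 0%nat))%C).
  exists r, g; split; [exact Hr|]; split.
  + apply (IH (PS_decr_1 a)); intros z Hz; unfold g.
    destruct (excluded_middle_informative (z = z0)) as [->|Hne].
    * replace (z0 - z0)%C with (@zero C_AbsRing)
        by (change (RtoC 0 = (z0 - z0)%C); ring).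
      apply (is_pseries_0 (K := C_AbsRing) (V := C_NormedModule) (PS_decr_1 a)).
    * apply (is_pseries_decr_1 (K := C_AbsRing) (V := C_NormedModule) a
        (z - z0)%C (/ (z - z0))%C (f z)); [|apply Hf, Hz].
      apply Cinv_l; intros E; apply Hne.
      replace z with (z - z0 + z0)%C by ring; rewrite E; ring.
  + intros z Hz; unfold g; destruct (excluded_middle_informative (z = z0)) as [->|Hne].
    * ring.
    * rewrite H0; field; intros E; apply Hne.
      replace z with (z - z0 + z0)%C by ring; rewrite E; ring.
Qed.

(** Passage from the subtype to functions on all of C, the setting of [taylor]; 0 outside the disk
    is a default value. *)
Definition disk_ext (f : Disk -> C) (z : C) : C :=
  match Rlt_dec (Cmod z) 1 with
  | left p => f (exist _ z p)
  | right _ => RtoC 0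
  end.

Lemma disk_ext_val (f : Disk -> C) (z : Disk) : disk_ext f z = f z.
Proof.
unfold disk_ext; destruct Rlt_dec as [p|p]; destruct z as [z Hz]; simpl in *.
- now rewrite (proof_irrelevance _ p Hz).
- tauto.
Qed.

Lemma analytic_holo (f : Disk -> C) (z : C) :
  analytic f -> Cmod z < 1 -> holo z (disk_ext f).
Proof.
intros Hf Hz; destruct (Hf (exist _ z Hz)) as [r [a [Hr Ha]]]; simpl in Ha.
apply (pseries_holo a z (Rmin r (1 - Cmod z))).
- apply Rmin_glb_lt; lra.
- intros y Hy.
  generalize (Rmin_l r (1 - Cmod z)) (Rmin_r r (1 - Cmod z)); intros.
  assert (Hy1 : Cmod y < 1) by (generalize (Cmod_sub_ge y z); lra).
  change (@is_pseries C_AbsRing C_NormedModule a (y - z)%C (disk_ext f y)).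
  replace (disk_ext f y) with (f (exist _ y Hy1))
    by (symmetry; apply (disk_ext_val f (exist _ y Hy1))).
  apply Ha; simpl; lra.
Qed.

(** * Maximum principle and Pick's inequality *)

(* Over the four directions h, -h, ih, -ih the mean of |q(z0 + h)|^2 is
   |a0|^2 + |a1|^2 |h|^2 up to O(|h|^3), so the mean of the whole expression
   exceeds its value at z0 by at least eps |h|^2. *)
Lemma no_local_max (q : C -> C) (z0 : C) (eps delta : R) :
  taylor 3 z0 q -> 0 < eps -> 0 < delta ->
  exists z, Cmod (z - z0)%C < delta /\
    Cmod (q z0) ^ 2 + eps * Cmod z0 ^ 2 < Cmod (q z) ^ 2 + eps * Cmod z ^ 2.
Proof.
intros [d1 [g1 [Hd1 [[d2 [g2 [Hd2 [[d3 [g3 [Hd3 [[d4 [B [Hd4 HB]]] H3]]]] H2]]]] H1]]]] He Hd.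
set (a0 := q z0) in *; set (a1 := g1 z0) in *; set (a2 := g2 z0) in *.
(* Reduction to the quadratic Taylor polynomial P. With E the remainder, |P + E|^2 >= |P|^2 - 2 |P|
   |E|; for |h| < 1, |P| <= A and |E| <= R3 |h|^3, whence K = 2 A R3. *)
assert (Hq : exists d, 0 < d /\ exists K, 0 <= K /\ forall h, Cmod h < d ->
  Cmod (a0 + a1 * h + a2 * (h * h))%C ^ 2 - K * Cmod h ^ 3 <= Cmod (q (z0 + h)%C) ^ 2).
{ exists (Rmin (Rmin (Rmin d1 d2) (Rmin d3 d4)) 1); split.
  { repeat apply Rmin_glb_lt; lra. }
  assert (HB0 : 0 <= Rabs B) by apply Rabs_pos.
  set (A := Cmod a0 + Cmod a1 + Cmod a2).
  assert (HA : 0 <= A)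
    by (unfold A; generalize (Cmod_ge_0 a0) (Cmod_ge_0 a1) (Cmod_ge_0 a2); lra).
  pose (R3 := Cmod (g3 z0) + Rabs B); assert (HR3 : 0 <= R3)
    by (unfold R3; generalize (Cmod_ge_0 (g3 z0)); lra).
  exists (2 * A * R3); split; [nra|].
  intros h Hh.
  generalize (Rmin_l (Rmin (Rmin d1 d2) (Rmin d3 d4)) 1)
    (Rmin_r (Rmin (Rmin d1 d2) (Rmin d3 d4)) 1)
    (Rmin_l (Rmin d1 d2) (Rmin d3 d4)) (Rmin_r (Rmin d1 d2) (Rmin d3 d4))
    (Rmin_l d1 d2) (Rmin_r d1 d2) (Rmin_l d3 d4) (Rmin_r d3 d4); intros.
  assert (Eh : (z0 + h - z0 = h)%C) by ring.
  assert (HgB : Cmod (g3 (z0 + h)%C) <= R3).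
  { apply Rle_trans with B; [apply HB; rewrite Eh; lra|].
    unfold R3; generalize (Cmod_ge_0 (g3 z0)) (Rle_abs B); lra. }
  rewrite (H1 (z0 + h)%C) by (rewrite Eh; lra).
  rewrite (H2 (z0 + h)%C) by (rewrite Eh; lra).
  rewrite (H3 (z0 + h)%C) by (rewrite Eh; lra).
  rewrite Eh; fold a1 a2.
  set (P := (a0 + a1 * h + a2 * (h * h))%C).
  set (E := (h * (h * (h * g3 (z0 + h))))%C).
  replace (a0 + h * (a1 + h * (a2 + h * g3 (z0 + h))))%C with (P - - E)%C
    by (unfold P, E; ring).
  assert (HE : Cmod E <= Cmod h ^ 3 * R3).
  { unfold E; rewrite !Cmod_mult.
    replace (Cmod h * (Cmod h * (Cmod h * Cmod (g3 (z0 + h)%C))))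
      with (Cmod h ^ 3 * Cmod (g3 (z0 + h)%C)) by ring.
    apply Rmult_le_compat_l; [apply pow_le, Cmod_ge_0 | exact HgB]. }
  assert (HP : Cmod P <= A).
  { unfold P, A; eapply Rle_trans; [apply Cmod_triangle|].
    rewrite !Cmod_mult.
    generalize (Cmod_triangle a0 (a1 * h)%C); rewrite Cmod_mult; intros.
    generalize (Cmod_ge_0 h) (Cmod_ge_0 a1) (Cmod_ge_0 a2); intros.
    assert (Cmod a1 * Cmod h <= Cmod a1) by nra.
    assert (Cmod h * Cmod h <= 1) by nra.
    assert (Cmod a2 * (Cmod h * Cmod h) <= Cmod a2) by nra.
    lra. }
  generalize (Cmod_sub_ge P (- E)%C); rewrite Cmod_opp; intros Hge.
  generalize (Cmod_ge_0 P) (Cmod_ge_0 E) (Cmod_ge_0 (P - - E)%C); intros.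
  assert (Cmod P ^ 2 - 2 * Cmod P * Cmod E <= Cmod (P - - E)%C ^ 2).
  { destruct (Rle_dec (Cmod E) (Cmod P)); nra. }
  assert (Cmod P * Cmod E <= A * (Cmod h ^ 3 * R3))
    by (apply Rmult_le_compat; lra).
  lra. }
destruct Hq as [d [Hd0 [K [HK Hq]]]].
(* K t < eps keeps the cubic loss K t^3 below the gain eps t^2. *)
set (t := Rmin (Rmin d delta) (eps / (K + 1)) / 2).
assert (Ht : 0 < t /\ t < d /\ t < delta /\ K * t < eps).
{ assert (H0 : 0 < eps / (K + 1)) by (apply Rdiv_lt_0_compat; lra).
  assert (H0' : 0 < Rmin (Rmin d delta) (eps / (K + 1)))
    by (repeat apply Rmin_glb_lt; lra).
  generalize (Rmin_l (Rmin d delta) (eps / (K + 1))) (Rmin_r (Rmin d delta) (eps / (K + 1)))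
    (Rmin_l d delta) (Rmin_r d delta); intros.
  repeat split; unfold t; try lra.
  fold t; assert (t < eps / (K + 1)) by (unfold t; lra).
  assert (t * (K + 1) < eps); [|unfold t in *; nra].
  apply Rlt_le_trans with (eps / (K + 1) * (K + 1)); [|right; field; lra].
  apply Rmult_lt_compat_r; lra. }
clearbody t; destruct Ht as [Ht0 [Htd [Htde HKt]]].
apply NNPP; intros Hn.
assert (Hle : forall h, Cmod h = t ->
  Cmod (a0 + a1 * h + a2 * (h * h))%C ^ 2 - K * t ^ 3 + eps * Cmod (z0 + h)%C ^ 2
  <= Cmod a0 ^ 2 + eps * Cmod z0 ^ 2).
{ intros h Hh; apply Rnot_lt_le; intros Hlt; apply Hn; exists (z0 + h)%C.
  replace (z0 + h - z0)%C with h by ring; split; [lra|].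
  generalize (Hq h ltac:(lra)); rewrite Hh; lra. }
assert (E1 : Cmod (RtoC t) = t) by (rewrite Cmod_R; apply Rabs_pos_eq; lra).
assert (E2 : Cmod (- RtoC t)%C = t) by (rewrite Cmod_opp; exact E1).
assert (E3 : Cmod (Ci * RtoC t)%C = t) by (rewrite Cmod_mult, Cmod_Ci, E1; ring).
assert (E4 : Cmod (- (Ci * RtoC t))%C = t) by (rewrite Cmod_opp; exact E3).
generalize (Hle _ E1) (Hle _ E2) (Hle _ E3) (Hle _ E4).
(* Parseval on the fourth roots of unity: the exponents 0, 1, 2 are distinct modulo 4, so all cross
   terms cancel. *)
assert (Sum : forall A0 A1 A2 : C,
  Cmod (A0 + A1 * RtoC t + A2 * (RtoC t * RtoC t))%C ^ 2
  + Cmod (A0 + A1 * (- RtoC t) + A2 * ((- RtoC t) * (- RtoC t)))%C ^ 2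
  + Cmod (A0 + A1 * (Ci * RtoC t) + A2 * ((Ci * RtoC t) * (Ci * RtoC t)))%C ^ 2
  + Cmod (A0 + A1 * (- (Ci * RtoC t)) + A2 * ((- (Ci * RtoC t)) * (- (Ci * RtoC t))))%C ^ 2
  = 4 * (Cmod A0 ^ 2 + Cmod A1 ^ 2 * t ^ 2 + Cmod A2 ^ 2 * t ^ 4)).
{ intros [x0 y0] [x1 y1] [x2 y2]; Cunfold; ring. }
generalize (Sum a0 a1 a2).
assert (Sum1 : Cmod (z0 + RtoC t)%C ^ 2 + Cmod (z0 + - RtoC t)%C ^ 2
  + Cmod (z0 + Ci * RtoC t)%C ^ 2 + Cmod (z0 + - (Ci * RtoC t))%C ^ 2
  = 4 * Cmod z0 ^ 2 + 4 * t ^ 2).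
{ destruct z0 as [x0 y0]; Cunfold; ring. }
intros S0 L1 L2 L3 L4.
assert (0 <= Cmod a1 ^ 2 * t ^ 2) by (rewrite <- Rpow_mult_distr; apply pow2_ge_0).
assert (0 <= Cmod a2 ^ 2 * t ^ 4)
  by (replace (Cmod a2 ^ 2 * t ^ 4) with ((Cmod a2 * t ^ 2) ^ 2) by ring; apply pow2_ge_0).
assert (0 < t ^ 2 * (eps - K * t)) by (apply Rmult_lt_0_compat; [apply pow_lt|]; lra).
nra.
Qed.

(** The term eps |z|^2 excludes interior maxima even for constant q. The maximum of |q|^2 + eps
    |z|^2 therefore lies on the circle, at a cost of eps r^2 <= eps0. *)
Lemma maximum_principle (q : C -> C) (r B : R) :
  0 <= r -> 0 <= B -> (forall z, Cmod z <= r -> taylor 3 z q) ->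
  (forall z, Cmod z = r -> Cmod (q z) <= B) ->
  forall z, Cmod z <= r -> Cmod (q z) <= B.
Proof.
intros Hr HB Hq Hbd z Hz; apply pow2_le_reg; [exact HB|].
apply le_epsilon; intros eps0 He0.
set (eps := eps0 / (r ^ 2 + 1)).
assert (Hr2 : 0 <= r ^ 2) by apply pow2_ge_0.
assert (He : 0 < eps) by (apply Rdiv_lt_0_compat; lra).
assert (Her : eps * r ^ 2 <= eps0).
{ apply Rle_trans with (eps * (r ^ 2 + 1)); [nra|].
  right; unfold eps; field; lra. }
destruct (disk_attains_max (fun z => Cmod (q z) ^ 2 + eps * Cmod z ^ 2) r Hr)
  as [zm [Hzm Hmax]].
{ intros y Hy e Hee.
  assert (H1 : taylor 1 y q) by (apply taylor_pred, taylor_pred, Hq, Hy).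
  set (a := Cmod (q y)); set (b := Cmod y).
  assert (Ha : 0 <= a) by apply Cmod_ge_0; assert (Hb : 0 <= b) by apply Cmod_ge_0.
  set (e1 := Rmin 1 (e / (2 * (2 * a + 1)))).
  set (e2 := Rmin 1 (e / (2 * eps * (2 * b + 1)))).
  assert (0 < e / (2 * (2 * a + 1))) by (apply Rdiv_lt_0_compat; nra).
  assert (0 < e / (2 * eps * (2 * b + 1))) by (apply Rdiv_lt_0_compat; nra).
  destruct (taylor_continuous y q H1 e1) as [d [Hd Hd']]; [apply Rmin_glb_lt; lra|].
  exists (Rmin d e2); split; [repeat apply Rmin_glb_lt; lra|].
  intros x Hx; generalize (Rmin_l d e2) (Rmin_r d e2); intros.
  specialize (Hd' x ltac:(lra)).
  (* From |u - v| <= w < 1 one gets |u^2 - v^2| <= w (2 v + 1), which explains the denominators in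
     [e1] and [e2]. *)
  assert (Hsq : forall u v s w : R, 0 <= u -> 0 <= v -> u - v <= w -> v - u <= w -> w < Rmin 1 s ->
    Rabs (u ^ 2 - v ^ 2) < s * (2 * v + 1)).
  { intros u v s w Hu Hv Huv Hvu Hw; generalize (Rmin_l 1 s) (Rmin_r 1 s); intros.
    apply Rabs_def1; nra. }
  assert (S1 : Rabs (Cmod (q x) ^ 2 - a ^ 2) < e / 2).
  { replace (e / 2) with (e / (2 * (2 * a + 1)) * (2 * a + 1)) by (field; lra).
    apply (Hsq _ _ _ (Cmod (q x - q y)%C)); try apply Cmod_ge_0.
    - apply Cmod_sub_ge.
    - rewrite Cmod_sub_sym; apply Cmod_sub_ge.
    - exact Hd'. }
  assert (S2 : Rabs (Cmod x ^ 2 - b ^ 2) < e / (2 * eps)).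
  { replace (e / (2 * eps)) with (e / (2 * eps * (2 * b + 1)) * (2 * b + 1)) by (field; lra).
    apply (Hsq _ _ _ (Cmod (x - y)%C)); try apply Cmod_ge_0.
    - apply Cmod_sub_ge.
    - rewrite Cmod_sub_sym; apply Cmod_sub_ge.
    - unfold e2 in *; lra. }
  apply Rabs_lt_between in S1; apply Rabs_lt_between in S2.
  assert (S3 : eps * (e / (2 * eps)) = e / 2) by (field; lra).
  apply Rabs_def1; fold a b; nra. }
destruct (Req_dec (Cmod zm) r) as [Heq|Hne].
- specialize (Hmax z Hz); simpl in Hmax.
  generalize (Hbd zm Heq) (Cmod_ge_0 (q zm)); intros.
  assert (0 <= eps * Cmod z ^ 2) by (generalize (pow2_ge_0 (Cmod z)); nra).
  rewrite Heq in Hmax; nra.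
- destruct (no_local_max q zm eps (r - Cmod zm)) as [y [Hy Hlt]]; [apply Hq, Hzm | exact He | lra|].
  assert (Cmod y <= r) by (generalize (Cmod_sub_ge y zm); lra).
  specialize (Hmax y ltac:(assumption)); simpl in *; lra.
Qed.

(** The identity behind the pseudohyperbolic distance. It also bounds |1 - conj(w) z|^2 from below
    by (1 - |z|^2) (1 - |w|^2). *)
Lemma Cmod_one_sub_conj_mul (w z : C) :
  Cmod (1 - Cconj w * z)%C ^ 2
  = Cmod (z - w)%C ^ 2 + (1 - Cmod z ^ 2) * (1 - Cmod w ^ 2).
Proof. destruct w, z; Cunfold; ring. Qed.

Lemma Csub_neq0 (z w : C) : z <> w -> (z - w)%C <> 0%C.
Proof.
intros Hne E; apply Hne; replace z with (z - w + w)%C by ring; rewrite E; ring.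
Qed.

(* The maximum principle is applied to the quotient of the Cayley transform of G
   (vanishing at w) by the Blaschke factor of w, on circles |z| = r -> 1. *)
Lemma pick_pos (G : C -> C) (z w : C) :
  (forall y, Cmod y < 1 -> holo y G) -> (forall y, Cmod y < 1 -> 0 < Re (G y)) ->
  Cmod z < 1 -> Cmod w < 1 ->
  Cmod (G z - G w)%C ^ 2 * ((1 - Cmod z ^ 2) * (1 - Cmod w ^ 2))
  <= 4 * Re (G z) * Re (G w) * Cmod (z - w)%C ^ 2.
Proof.
intros HG Hpos Hz Hw.
destruct (excluded_middle_informative (z = w)) as [->|Hzw].
{ rewrite !Cmod_self; right; ring. }
(* Order 4, so that the divided difference [g] retains the order 3 that the maximum principle asks
   for. *)
destruct (HG w Hw 4%nat) as [d [g [Hd [Hg HGw]]]].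
set (k := fun y => ((1 - Cconj w * y) * / (G y + Cconj (G w)))%C).
set (q := fun y => if excluded_middle_informative (y = w) then (g y * k y)%C
                   else ((G y - G w) * / (y - w) * k y)%C).
assert (Hden : forall y, Cmod y < 1 -> (G y + Cconj (G w))%C <> 0%C).
{ intros y Hy E; generalize (Hpos y Hy) (Hpos w Hw).
  apply (f_equal Re) in E; rewrite re_plus, re_conj, re_RtoC in E; lra. }
assert (Hk : forall y, Cmod y < 1 -> holo y k).
{ intros y Hy; apply holo_mul.
  - apply holo_sub; [apply holo_const|].
    apply (holo_mul y (fun _ => Cconj w)); [apply holo_const | apply holo_id].
  - apply (holo_inv y (fun x => G x + Cconj (G w))%C); [apply Hden, Hy|].
    apply holo_add; [apply HG, Hy | apply holo_const]. }
assert (Hq : forall y, Cmod y < 1 -> taylor 3 y q).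
{ intros y Hy; destruct (excluded_middle_informative (y = w)) as [->|Hyw].
  - apply (taylor_ext 3 w (fun x => g x * k x)%C q d Hd).
    + intros x Hx; unfold q; destruct excluded_middle_informative as [->|Hxw]; auto.
      rewrite (HGw x Hx); field; apply Csub_neq0, Hxw.
    + apply taylor_mul; [exact Hg | apply Hk, Hw].
  - apply (taylor_ext 3 y (fun x => (G x - G w) * / (x - w) * k x)%C q (Cmod (y - w)%C)).
    + apply Cmod_gt_0, Csub_neq0, Hyw.
    + intros x Hx; unfold q; destruct excluded_middle_informative as [->|Hxw]; auto.
      rewrite Cmod_sub_sym in Hx; lra.
    + assert (Hh : holo y (fun x => (G x - G w) * / (x - w) * k x)%C); [|apply Hh].
      apply holo_mul; [apply holo_mul|apply Hk, Hy].
      * apply holo_sub; [apply HG, Hy | apply holo_const].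
      * apply (holo_inv y (fun x => x - w)%C); [apply Csub_neq0, Hyw|].
        apply holo_sub; [apply holo_id | apply holo_const]. }
(* The squared denominator of the Cayley transform is |G(y) + conj(G(w))|^2 = |G(y) - G(w)|^2 + 4 Re
   G(y) Re G(w). *)
assert (Eq : forall y, Cmod y < 1 -> y <> w ->
  Cmod (q y) ^ 2 * (Cmod (y - w)%C ^ 2 * (Cmod (G y - G w)%C ^ 2 + 4 * Re (G y) * Re (G w)))
  = Cmod (G y - G w)%C ^ 2
    * (Cmod (y - w)%C ^ 2 + (1 - Cmod y ^ 2) * (1 - Cmod w ^ 2))).
{ intros y Hy Hyw.
  assert (Hq' : (q y * ((y - w) * (G y + Cconj (G w))) = (G y - G w) * (1 - Cconj w * y))%C).
  { unfold q, k; destruct excluded_middle_informative; [tauto|].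
    field; split; [apply Hden, Hy | apply Csub_neq0, Hyw]. }
  apply (f_equal (fun v => Cmod v ^ 2)) in Hq'.
  rewrite !Cmod_mult, !Rpow_mult_distr, Cmod_one_sub_conj_mul in Hq'.
  rewrite <- Hq'; do 2 f_equal.
  destruct (G y), (G w); Cunfold; ring. }
assert (Hq1 : Cmod (q z) ^ 2 <= 1).
{ apply le_epsilon; intros eps He.
  set (m := Rmax (Cmod z) (Cmod w)).
  assert (Hm : m < 1) by (apply Rmax_lub_lt; assumption).
  assert (Hmz : Cmod z <= m) by apply Rmax_l; assert (Hmw : Cmod w <= m) by apply Rmax_r.
  assert (Hm0 : 0 <= m) by (generalize (Cmod_ge_0 z); lra).
  (* The first bound keeps the circle |y| = 1 - tau at distance at least (1 - m) / 2 from w and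
     around z; the second makes (1 - |y|^2) (1 - |w|^2) <= 2 tau <= eps |y - w|^2 on it. *)
  set (tau := Rmin ((1 - m) / 2) (eps * ((1 - m) / 2) ^ 2 / 2)).
  assert (Hm2 : 0 < ((1 - m) / 2) ^ 2) by (apply pow_lt; lra).
  assert (Htau : 0 < tau) by (apply Rmin_glb_lt; nra).
  assert (Ht1 : tau <= (1 - m) / 2) by apply Rmin_l.
  assert (Ht2 : tau <= eps * ((1 - m) / 2) ^ 2 / 2) by apply Rmin_r.
  assert (Hb : Cmod (q z) <= sqrt (1 + eps)).
  { apply (maximum_principle q (1 - tau)); try lra.
    - apply sqrt_pos.
    - intros y Hy; apply Hq; lra.
    - intros y Hy; apply pow2_le_reg; [apply sqrt_pos|].
      rewrite pow2_sqrt by lra.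
      assert (Hyw : y <> w) by (intros ->; lra).
      assert (Hy1 : Cmod y < 1) by lra.
      generalize (Eq y Hy1 Hyw) (Hpos y Hy1) (Hpos w Hw); intros E Hp1 Hp2.
      generalize (Cmod_sub_ge y w); intros Hge.
      assert (Hyw2 : ((1 - m) / 2) ^ 2 <= Cmod (y - w)%C ^ 2) by (apply pow_incr; lra).
      assert (Hyt : (1 - Cmod y ^ 2) * (1 - Cmod w ^ 2) <= 2 * tau).
      { rewrite Hy; generalize (Cmod_ge_0 w); intros.
        assert (0 <= 1 - (1 - tau) ^ 2 <= 2 * tau) by nra.
        assert (0 <= 1 - Cmod w ^ 2 <= 1) by nra.
        nra. }
      assert (HA : 0 <= Cmod (G y - G w)%C ^ 2) by apply pow2_ge_0.
      assert (H4 : 0 < 4 * Re (G y) * Re (G w)) by nra.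
      set (A := Cmod (G y - G w)%C ^ 2) in *.
      set (D := Cmod (y - w)%C ^ 2) in *.
      assert (HD : 0 < D) by lra.
      apply Rmult_le_reg_r with (D * (A + 4 * Re (G y) * Re (G w))).
      { apply Rmult_lt_0_compat; lra. }
      rewrite E.
      assert (D + (1 - Cmod y ^ 2) * (1 - Cmod w ^ 2) <= (1 + eps) * D).
      { assert (eps * ((1 - m) / 2) ^ 2 <= eps * D)
          by (apply Rmult_le_compat_l; lra). lra. }
      apply Rle_trans with (A * ((1 + eps) * D)); [apply Rmult_le_compat_l; lra|].
      assert (0 <= (1 + eps) * D * (4 * Re (G y) * Re (G w)))
        by (repeat apply Rmult_le_pos; lra).
      lra. }
  assert (Hs : Cmod (q z) ^ 2 <= sqrt (1 + eps) ^ 2)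
    by (apply pow_incr; split; [apply Cmod_ge_0 | exact Hb]).
  rewrite pow2_sqrt in Hs; lra. }
generalize (Eq z Hz Hzw) (Hpos z Hz) (Hpos w Hw); intros E Hp1 Hp2.
assert (HD : 0 <= Cmod (z - w)%C ^ 2) by apply pow2_ge_0.
assert (HA : 0 <= Cmod (G z - G w)%C ^ 2) by apply pow2_ge_0.
assert (H4 : 0 < 4 * Re (G z) * Re (G w)) by nra.
assert (Hm : Cmod (q z) ^ 2 * (Cmod (z - w)%C ^ 2 * (Cmod (G z - G w)%C ^ 2 + 4 * Re (G z) * Re (G w)))
  <= 1 * (Cmod (z - w)%C ^ 2 * (Cmod (G z - G w)%C ^ 2 + 4 * Re (G z) * Re (G w)))).
{ apply Rmult_le_compat_r; [apply Rmult_le_pos; lra | exact Hq1]. }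
rewrite E in Hm; lra.
Qed.

Lemma pick (G : C -> C) (z w : C) :
  (forall y, Cmod y < 1 -> holo y G) -> (forall y, Cmod y < 1 -> 0 <= Re (G y)) ->
  Cmod z < 1 -> Cmod w < 1 ->
  Cmod (G z - G w)%C ^ 2 * ((1 - Cmod z ^ 2) * (1 - Cmod w ^ 2))
  <= 4 * Re (G z) * Re (G w) * Cmod (z - w)%C ^ 2.
Proof.
intros HG Hpos Hz Hw; apply le_epsilon; intros eps He.
generalize (Hpos z Hz) (Hpos w Hw); intros Pz Pw.
set (D := Cmod (z - w)%C ^ 2).
assert (HD : 0 <= D) by apply pow2_ge_0.
(* For e <= 1, (x + e) (y + e) - x y <= e (x + y + 1). *)
set (K := 4 * D * (Re (G z) + Re (G w) + 1)).
assert (HK : 0 <= K) by (unfold K; nra).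
set (e := Rmin 1 (eps / (K + 1))).
assert (H0 : 0 < eps / (K + 1)) by (apply Rdiv_lt_0_compat; lra).
assert (He0 : 0 < e) by (apply Rmin_glb_lt; lra).
assert (He1 : e <= 1) by apply Rmin_l.
assert (He2 : e * K <= eps).
{ apply Rle_trans with (eps / (K + 1) * (K + 1)); [|right; field; lra].
  apply Rmult_le_compat; try lra; apply Rmin_r. }
assert (Hre : forall y, Re (G y + RtoC e)%C = Re (G y) + e)
  by (intros y; rewrite re_plus, re_RtoC; reflexivity).
generalize (pick_pos (fun y => G y + RtoC e)%C z w); cbv beta; rewrite !Hre.
replace (G z + RtoC e - (G w + RtoC e))%C with (G z - G w)%C by ring.
intros Hp; eapply Rle_trans; [apply Hp; auto|].
- intros y Hy; apply holo_add; [apply HG, Hy | apply holo_const].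
- intros y Hy; rewrite Hre; generalize (Hpos y Hy); lra.
- fold D; unfold K in He2.
  assert (4 * D * (e * e) <= 4 * D * e) by (apply Rmult_le_compat_l; nra).
  nra.
Qed.

(** * The Julia-Caratheodory theorem *)

Lemma Re_div_mul (a b : C) :
  b <> 0%C -> Re (a * / b)%C * Cmod b ^ 2 = Re (a * Cconj b)%C.
Proof.
intros Hb; replace (a * Cconj b)%C with ((a * / b) * (b * Cconj b))%C by (field; exact Hb).
now rewrite <- Cmod2_conj, re_scal_r.
Qed.

(** The real part of the Cayley transform is the Poisson kernel at eta, here with its denominator
    cleared. *)
Lemma Re_cayley (eta v : C) :
  Cmod eta = 1 -> (eta - v)%C <> 0%C ->
  Re ((eta + v) * / (eta - v))%C * Cmod (eta - v)%C ^ 2 = 1 - Cmod v ^ 2.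
Proof.
intros He Hv; rewrite Re_div_mul by exact Hv.
replace 1 with (Cmod eta ^ 2) by (rewrite He; ring).
destruct eta, v; Cunfold; ring.
Qed.

Lemma unit_sub_neq0 (eta v : C) : Cmod eta = 1 -> Cmod v < 1 -> (eta - v)%C <> 0%C.
Proof.
intros He Hv; apply Cmod_gt_0; generalize (Cmod_sub_ge eta v); lra.
Qed.

Lemma holo_cayley (eta z : C) (f : C -> C) :
  (eta - f z)%C <> 0%C -> holo z f ->
  holo z (fun y => (eta + f y) * / (eta - f y))%C.
Proof.
intros Hne Hf; apply holo_mul.
- apply holo_add; [apply holo_const | exact Hf].
- apply (holo_inv z (fun y => eta - f y)%C Hne).
  apply holo_sub; [apply holo_const | exact Hf].
Qed.

(** Pick's inequality for (1 + f) / (1 - f), multiplied by |1 - f(z)|^2 |1 - f(w)|^2. In the product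
    form the limit of w at the boundary can be taken after cancelling 1 - |w|^2. *)
Lemma schwarz_pick (f : C -> C) (z w : C) :
  (forall y, Cmod y < 1 -> holo y f) -> (forall y, Cmod y < 1 -> Cmod (f y) < 1) ->
  Cmod z < 1 -> Cmod w < 1 ->
  Cmod (1 - Cconj (f w) * f z)%C ^ 2 * ((1 - Cmod z ^ 2) * (1 - Cmod w ^ 2))
  <= (1 - Cmod (f z) ^ 2) * (1 - Cmod (f w) ^ 2) * Cmod (1 - Cconj w * z)%C ^ 2.
Proof.
intros Hf Hlt Hz Hw.
assert (Hne : forall y, Cmod y < 1 -> (1 - f y)%C <> 0%C)
  by (intros y Hy; apply (unit_sub_neq0 1); [apply Cmod_1 | apply Hlt, Hy]).
set (G := fun y => ((1 + f y) * / (1 - f y))%C).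
assert (HRe : forall y, Cmod y < 1 ->
  Re (G y) * Cmod (1 - f y)%C ^ 2 = 1 - Cmod (f y) ^ 2).
{ intros y Hy; apply (Re_cayley 1); [apply Cmod_1 | apply Hne, Hy]. }
assert (Hsq : forall y, Cmod y < 1 -> 0 < Cmod (1 - f y)%C ^ 2).
{ intros y Hy; apply pow_lt, Cmod_gt_0, Hne, Hy. }
assert (Hp := pick G z w).
assert (HG : Cmod (G z - G w)%C ^ 2 * (Cmod (1 - f z)%C ^ 2 * Cmod (1 - f w)%C ^ 2)
  = 4 * Cmod (f z - f w)%C ^ 2).
{ replace 4 with (Cmod (RtoC 2) ^ 2)
    by (rewrite Cmod_R, Rabs_pos_eq by lra; ring).
  rewrite <- !Rpow_mult_distr, <- !Cmod_mult; do 2 f_equal.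
  unfold G; field; split; apply Hne; assumption. }
rewrite !Cmod_one_sub_conj_mul.
generalize (HRe z Hz) (HRe w Hw) (Hsq z Hz) (Hsq w Hw); intros Rz Rw Sz Sw.
assert (Hp' : Cmod (G z - G w)%C ^ 2 * ((1 - Cmod z ^ 2) * (1 - Cmod w ^ 2))
  <= 4 * Re (G z) * Re (G w) * Cmod (z - w)%C ^ 2).
{ apply Hp; try assumption.
  - intros y Hy; apply (holo_cayley 1); [apply Hne, Hy | apply Hf, Hy].
  - intros y Hy; apply Rmult_le_reg_r with (1 := Hsq y Hy).
    rewrite HRe, Rmult_0_l by exact Hy.
    generalize (Hlt y Hy) (Cmod_ge_0 (f y)); nra. }
apply Rmult_le_compat_r with (r := Cmod (1 - f z)%C ^ 2 * Cmod (1 - f w)%C ^ 2) in Hp';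
  [|nra].
replace (4 * Re (G z) * Re (G w) * Cmod (z - w)%C ^ 2 *
     (Cmod (1 - f z)%C ^ 2 * Cmod (1 - f w)%C ^ 2))
  with (4 * (Re (G z) * Cmod (1 - f z)%C ^ 2) * (Re (G w) * Cmod (1 - f w)%C ^ 2) *
    Cmod (z - w)%C ^ 2) in Hp' by ring.
rewrite Rz, Rw in Hp'.
replace (Cmod (G z - G w)%C ^ 2 * ((1 - Cmod z ^ 2) * (1 - Cmod w ^ 2)) *
      (Cmod (1 - f z)%C ^ 2 * Cmod (1 - f w)%C ^ 2))
  with (Cmod (G z - G w)%C ^ 2 * (Cmod (1 - f z)%C ^ 2 * Cmod (1 - f w)%C ^ 2)
    * ((1 - Cmod z ^ 2) * (1 - Cmod w ^ 2))) in Hp' by ring.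
rewrite HG in Hp'; nra.
Qed.

Lemma Cmod_one_sub_conj_unit (eta v : C) :
  Cmod eta = 1 -> Cmod (1 - Cconj eta * v)%C = Cmod (eta - v)%C.
Proof.
intros He.
rewrite <- (Rmult_1_l (Cmod (1 - _)%C)), <- He at 1; rewrite <- Cmod_mult; f_equal.
assert (E : (eta * Cconj eta = 1)%C).
{ rewrite <- Cmod2_conj, He; f_equal; ring. }
transitivity (eta - (eta * Cconj eta) * v)%C; [ring|]; rewrite E; ring.
Qed.

Lemma one_sub_Cmod_le (zeta w : C) :
  Cmod zeta = 1 -> 1 - Cmod w <= Cmod (w - zeta)%C.
Proof. intros Hz; rewrite Cmod_sub_sym, <- Hz; apply Cmod_sub_ge. Qed.

(** Divide [schwarz_pick] by 1 - |w|^2, bound (1 - |f(w)|^2) / (1 - |w|^2) by K, and let w approach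
    zeta and f(w) approach eta; then |1 - conj(eta) f(z)| = |eta - f(z)|. *)
Lemma julia (f : C -> C) (zeta eta z : C) (K : R) :
  (forall y, Cmod y < 1 -> holo y f) -> (forall y, Cmod y < 1 -> Cmod (f y) < 1) ->
  Cmod zeta = 1 -> Cmod eta = 1 -> 0 <= K ->
  (forall eps, 0 < eps -> exists w, Cmod w < 1 /\ Cmod (w - zeta)%C < eps /\
     Cmod (f w - eta)%C < eps /\ 1 - Cmod (f w) ^ 2 <= K * (1 - Cmod w ^ 2)) ->
  Cmod z < 1 ->
  Cmod (eta - f z)%C ^ 2 * (1 - Cmod z ^ 2)
  <= K * Cmod (zeta - z)%C ^ 2 * (1 - Cmod (f z) ^ 2).
Proof.
intros Hf Hlt Hzeta Heta HK Hseq Hz.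
set (a := Cmod (eta - f z)%C); set (b := Cmod (zeta - z)%C).
assert (Ha : 0 <= a) by apply Cmod_ge_0; assert (Hb : 0 <= b) by apply Cmod_ge_0.
assert (Hx : 0 < 1 - Cmod z ^ 2) by (generalize (Cmod_ge_0 z); nra).
assert (Hy : 0 < 1 - Cmod (f z) ^ 2) by (generalize (Cmod_ge_0 (f z)) (Hlt z Hz); nra).
set (x := 1 - Cmod z ^ 2) in *; set (y := K * (1 - Cmod (f z) ^ 2)).
assert (Hy0 : 0 <= y) by (apply Rmult_le_pos; lra).
replace (K * b ^ 2 * (1 - Cmod (f z) ^ 2)) with (y * b ^ 2) by (unfold y; ring).
apply le_epsilon; intros eps He.
(* Moving w to zeta and f(w) to eta changes a and b by at most e <= 1; [L] collects the resulting
   errors of both sides per unit of e. *)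
set (L := 2 * a * x + y * (2 * b + 1)).
assert (HL : 0 <= L).
{ unfold L; assert (0 <= a * x) by (apply Rmult_le_pos; lra).
  assert (0 <= y * (2 * b + 1)) by (apply Rmult_le_pos; lra); lra. }
assert (H0 : 0 < eps / (L + 1)) by (apply Rdiv_lt_0_compat; lra).
set (e := Rmin 1 (eps / (L + 1))).
assert (He0 : 0 < e) by (apply Rmin_glb_lt; lra).
assert (He1 : e <= 1) by apply Rmin_l.
assert (He2 : e * L <= eps).
{ apply Rle_trans with (eps / (L + 1) * (L + 1)); [|right; field; lra].
  apply Rmult_le_compat; try lra; apply Rmin_r. }
destruct (Hseq e He0) as [w [Hw [Hwz [Hfw Hr]]]].
assert (Hxw : 0 < 1 - Cmod w ^ 2) by (generalize (Cmod_ge_0 w); nra).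
generalize (schwarz_pick f z w Hf Hlt Hz Hw); intros SP.
set (a' := Cmod (1 - Cconj (f w) * f z)%C) in *.
set (b' := Cmod (1 - Cconj w * z)%C) in *.
assert (SP' : a' ^ 2 * x <= y * b' ^ 2).
{ apply Rmult_le_reg_r with (1 := Hxw); fold x in SP.
  apply Rle_trans with ((1 - Cmod (f z) ^ 2) * (1 - Cmod (f w) ^ 2) * b' ^ 2); [lra|].
  apply Rle_trans with ((1 - Cmod (f z) ^ 2) * (K * (1 - Cmod w ^ 2)) * b' ^ 2);
    [|right; unfold y; ring].
  apply Rmult_le_compat_r; [apply pow2_ge_0|].
  apply Rmult_le_compat_l; lra. }
assert (Ha' : a - e <= a').
{ unfold a, a'; rewrite <- (Cmod_one_sub_conj_unit eta) by exact Heta.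
  generalize (Cmod_sub_ge (1 - Cconj eta * f z)%C ((Cconj (f w) - Cconj eta) * f z)%C).
  replace (1 - Cconj eta * f z - (Cconj (f w) - Cconj eta) * f z)%C
    with (1 - Cconj (f w) * f z)%C by ring.
  rewrite Cmod_mult, <- Cminus_conj, Cmod_conj.
  generalize (Hlt z Hz) (Cmod_ge_0 (f z)) (Cmod_ge_0 (f w - eta)%C); nra. }
assert (Hb' : b' <= b + e).
{ unfold b, b'; rewrite <- (Cmod_one_sub_conj_unit zeta) by exact Hzeta.
  generalize (Cmod_triangle_sub (1 - Cconj zeta * z)%C ((Cconj w - Cconj zeta) * z)%C).
  replace (1 - Cconj zeta * z - (Cconj w - Cconj zeta) * z)%C
    with (1 - Cconj w * z)%C by ring.
  rewrite Cmod_mult, <- Cminus_conj, Cmod_conj.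
  generalize (Cmod_ge_0 z) (Cmod_ge_0 (w - zeta)%C); nra. }
assert (Ha'0 : 0 <= a') by apply Cmod_ge_0; assert (Hb'0 : 0 <= b') by apply Cmod_ge_0.
assert (A1 : a ^ 2 - 2 * a * e <= a' ^ 2).
{ destruct (Rle_dec a e); nra. }
assert (B1 : b' ^ 2 <= b ^ 2 + (2 * b + 1) * e) by nra.
assert (A2 : (a ^ 2 - 2 * a * e) * x <= a' ^ 2 * x) by (apply Rmult_le_compat_r; lra).
assert (B2 : y * b' ^ 2 <= y * (b ^ 2 + (2 * b + 1) * e))
  by (apply Rmult_le_compat_l; lra).
unfold L in He2; lra.
Qed.

(* With c = inf Re p / P over the disk, p the Cayley transform of f and P the Poisson
   kernel at zeta, G = p - c (zeta + z) / (zeta - z) has nonnegative real part, and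
   Pick's inequality between z and a point z0 where Re G(z0) is at most eps P(z0)
   shows that (zeta - z) G(z) is nontangentially small. *)
Lemma cayley_residue (f : C -> C) (zeta eta : C) (K : R) :
  (forall y, Cmod y < 1 -> holo y f) -> (forall y, Cmod y < 1 -> Cmod (f y) < 1) ->
  Cmod zeta = 1 -> Cmod eta = 1 -> 0 < K ->
  (forall z, Cmod z < 1 -> Cmod (eta - f z)%C ^ 2 * (1 - Cmod z ^ 2)
     <= K * Cmod (zeta - z)%C ^ 2 * (1 - Cmod (f z) ^ 2)) ->
  exists c, 0 < c /\ forall M eps, 0 < M -> 0 < eps -> exists delta, 0 < delta /\
    forall z, Cmod z < 1 -> Cmod (z - zeta)%C < M * (1 - Cmod z) ->
      Cmod (z - zeta)%C < delta ->
      Cmod ((zeta - z) * ((eta + f z) * / (eta - f z)) - RtoC c * (zeta + z))%C < eps.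
Proof.
intros Hf Hlt Hzeta Heta HK Hj.
set (p := fun z => ((eta + f z) * / (eta - f z))%C).
set (P := fun z => (1 - Cmod z ^ 2) / Cmod (zeta - z)%C ^ 2).
assert (Hz2 : forall z, Cmod z < 1 -> 0 < Cmod (zeta - z)%C ^ 2)
  by (intros z Hz; apply pow_lt, Cmod_gt_0, unit_sub_neq0; assumption).
assert (He2 : forall z, Cmod z < 1 -> 0 < Cmod (eta - f z)%C ^ 2)
  by (intros z Hz; apply pow_lt, Cmod_gt_0, unit_sub_neq0; [assumption | apply Hlt, Hz]).
assert (HP : forall z, Cmod z < 1 -> 0 < P z).
{ intros z Hz; apply Rdiv_lt_0_compat; [|apply Hz2, Hz].
  generalize (Cmod_ge_0 z); nra. }
assert (HPre : forall z, Cmod z < 1 -> Re ((zeta + z) * / (zeta - z))%C = P z).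
{ intros z Hz; specialize (Hz2 z Hz).
  apply Rmult_eq_reg_r with (Cmod (zeta - z)%C ^ 2); [|lra].
  rewrite Re_cayley; [|exact Hzeta | apply unit_sub_neq0; assumption].
  unfold P; field; intros E; rewrite E in Hz2; lra. }
assert (Hpre : forall z, Cmod z < 1 -> Re (p z) * Cmod (eta - f z)%C ^ 2 = 1 - Cmod (f z) ^ 2).
{ intros z Hz; apply Re_cayley; [exact Heta | apply unit_sub_neq0; auto]. }
(* Julia's inequality, rewritten; it is what makes the infimum c positive. *)
assert (HpK : forall z, Cmod z < 1 -> / K <= Re (p z) / P z).
{ intros z Hz; generalize (HP z Hz) (Hz2 z Hz) (He2 z Hz) (Hj z Hz) (Hpre z Hz).
  intros P0 Z0 E0 J0 R0.
  apply Rmult_le_reg_r with (P z * K); [nra|].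
  replace (/ K * (P z * K)) with (P z) by (field; lra).
  replace (Re (p z) / P z * (P z * K)) with (K * Re (p z)) by (field; lra).
  apply Rmult_le_reg_r with (Cmod (zeta - z)%C ^ 2 * Cmod (eta - f z)%C ^ 2);
    [apply Rmult_lt_0_compat; assumption|].
  replace (P z * (Cmod (zeta - z)%C ^ 2 * Cmod (eta - f z)%C ^ 2))
    with (Cmod (eta - f z)%C ^ 2 * (1 - Cmod z ^ 2)).
  - rewrite <- R0 in J0; nra.
  - unfold P; field; intros E; rewrite E in Z0; lra. }
(* The infimum is obtained as minus the supremum of the opposites. *)
destruct (completeness (fun v => exists z, Cmod z < 1 /\ v = - (Re (p z) / P z)))
  as [m [Hub Hlub]].
{ exists (- / K); intros v [z [Hz ->]]; generalize (HpK z Hz); lra. }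
{ exists (- (Re (p 0) / P 0%C)), 0%C; split; [rewrite Cmod_0; lra | reflexivity]. }
assert (HKi : 0 < / K) by (apply Rinv_0_lt_compat, HK).
assert (Hc0 : m <= - / K).
{ apply Hlub; intros v [z [Hz ->]]; generalize (HpK z Hz); lra. }
set (c := - m); assert (Hc : 0 < c) by (unfold c; lra).
exists c; split; [exact Hc|].
set (G := fun z => (p z - RtoC c * ((zeta + z) * / (zeta - z)))%C).
assert (HGre : forall z, Cmod z < 1 -> Re (G z) = Re (p z) - c * P z).
{ intros z Hz; unfold G, Cminus.
  rewrite re_plus, re_opp, re_scal_l, HPre by exact Hz; ring. }
assert (HG0 : forall z, Cmod z < 1 -> 0 <= Re (G z)).
{ intros z Hz; rewrite HGre by exact Hz.
  assert (- (Re (p z) / P z) <= m) by (apply Hub; exists z; auto).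
  generalize (HP z Hz); intros P0.
  assert (c * P z <= Re (p z) / P z * P z)
    by (apply Rmult_le_compat_r; unfold c; lra).
  replace (Re (p z) / P z * P z) with (Re (p z)) in * by (field; lra); lra. }
assert (HGh : forall z, Cmod z < 1 -> holo z G).
{ intros z Hz; apply holo_sub.
  - apply holo_cayley; [apply unit_sub_neq0; auto | apply Hf, Hz].
  - apply (holo_mul z (fun _ => RtoC c)); [apply holo_const|].
    apply (holo_cayley zeta z (fun y => y)); [apply unit_sub_neq0; auto | apply holo_id]. }
intros M eps HM Heps.
(* The final error is at most 2 kap + kap < eps, and e0 turns the factor 16 e0 M of the Pick
   estimate into kap. *)
set (kap := eps / 4); set (e0 := kap / (16 * M)).
assert (Hkap : 0 < kap) by (unfold kap; lra).
assert (He0 : 0 < e0) by (apply Rdiv_lt_0_compat; lra).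
assert (Hz0 : exists z0, Cmod z0 < 1 /\ Re (G z0) <= e0 * P z0).
{ apply NNPP; intros Hn.
  assert (m <= m - e0); [|lra].
  apply Hlub; intros v [z [Hz ->]]; apply Rnot_lt_le; intros Hlt'; apply Hn.
  exists z; split; [exact Hz|]; rewrite HGre by exact Hz.
  generalize (HP z Hz); intros P0.
  assert (Re (p z) / P z * P z <= (c + e0) * P z)
    by (apply Rmult_le_compat_r; unfold c; lra).
  replace (Re (p z) / P z * P z) with (Re (p z)) in * by (field; lra); lra. }
destruct Hz0 as [z0 [Hz0 HGz0]].
set (g0 := Cmod (G z0)); assert (Hg0 : 0 <= g0) by apply Cmod_ge_0.
assert (HR0 : Re (G z0) <= g0) by apply Re_le_Cmod.
assert (HR00 := HG0 z0 Hz0).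
assert (Hgz : 0 < Cmod (zeta - z0)%C) by (apply Cmod_gt_0, unit_sub_neq0; assumption).
exists (Rmin (Cmod (zeta - z0)%C) (kap / (g0 + 1))); split.
{ apply Rmin_glb_lt; [exact Hgz | apply Rdiv_lt_0_compat; lra]. }
intros z Hz Hst Hnear.
generalize (Rmin_l (Cmod (zeta - z0)%C) (kap / (g0 + 1)))
  (Rmin_r (Cmod (zeta - z0)%C) (kap / (g0 + 1))); intros Hm1 Hm2.
set (tau := Cmod (z - zeta)%C) in *.
assert (Htau : 0 < tau)
  by (unfold tau; rewrite Cmod_sub_sym; apply Cmod_gt_0, unit_sub_neq0; assumption).
assert (Hg0t : g0 * tau <= kap).
{ apply Rle_trans with ((g0 + 1) * (kap / (g0 + 1))); [|right; field; lra].
  apply Rmult_le_compat; lra. }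
set (u := Cmod (G z - G z0)%C); assert (Hu : 0 <= u) by apply Cmod_ge_0.
assert (HGz : Re (G z) <= u + Re (G z0)).
{ replace (G z) with ((G z - G z0) + G z0)%C by ring; rewrite re_plus.
  unfold u; generalize (Re_le_Cmod (G z - G z0)%C); lra. }
assert (HGz' := HG0 z Hz).
assert (HPk := pick G z z0 HGh HG0 Hz Hz0); fold u in HPk.
assert (H1z0 : 0 < 1 - Cmod z0 ^ 2) by (generalize (Cmod_ge_0 z0); nra).
assert (H1z : tau / M <= 1 - Cmod z ^ 2).
{ assert (tau / M < 1 - Cmod z).
  { apply Rmult_lt_reg_r with M; [exact HM|].
    replace (tau / M * M) with tau by (field; lra); lra. }
  generalize (Cmod_ge_0 z); nra. }
assert (Hdist : Cmod (z - z0)%C ^ 2 <= 4 * Cmod (zeta - z0)%C ^ 2).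
{ replace (4 * Cmod (zeta - z0)%C ^ 2) with ((2 * Cmod (zeta - z0)%C) ^ 2) by ring.
  apply pow_incr; split; [apply Cmod_ge_0|].
  replace (z - z0)%C with ((z - zeta) + (zeta - z0))%C by ring.
  eapply Rle_trans; [apply Cmod_triangle|]; fold tau; lra. }
(* The definition of P(z0) cancels both 1 - |z0|^2 and |zeta - z0|^2, so the constant does not
   depend on z0, and hence not on how e0 was chosen. *)
assert (Hu2 : u ^ 2 * (1 - Cmod z ^ 2) <= 16 * e0 * (u + Re (G z0))).
{ apply Rmult_le_reg_r with (1 := H1z0).
  apply Rle_trans with (4 * Re (G z) * Re (G z0) * Cmod (z - z0)%C ^ 2); [lra|].
  apply Rle_trans with (4 * (u + Re (G z0)) * (e0 * P z0) * (4 * Cmod (zeta - z0)%C ^ 2)).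
  - apply Rmult_le_compat; try exact Hdist; try apply pow2_ge_0.
    + repeat apply Rmult_le_pos; lra.
    + apply Rmult_le_compat; lra.
  - right; unfold P; field; lra. }
(* Only the product with |z - zeta| is controlled, as G may be unbounded. Multiplying by M tau gives
   X^2 <= kap (X + kap), which forces X <= 2 kap. *)
set (X := u * tau).
assert (HX0 : 0 <= X) by (apply Rmult_le_pos; lra).
assert (HX : X ^ 2 <= kap * (X + Re (G z0) * tau)).
{ assert (u ^ 2 * (tau / M) <= 16 * e0 * (u + Re (G z0))).
  { eapply Rle_trans; [|exact Hu2]; apply Rmult_le_compat_l; [apply pow2_ge_0 | exact H1z]. }
  assert (HT : u ^ 2 * (tau / M) * (M * tau) <= 16 * e0 * (u + Re (G z0)) * (M * tau)).
  { apply Rmult_le_compat_r; [nra | assumption]. }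
  replace (u ^ 2 * (tau / M) * (M * tau)) with (X ^ 2) in HT by (unfold X; field; lra).
  replace (16 * e0 * (u + Re (G z0)) * (M * tau)) with (kap * (X + Re (G z0) * tau)) in HT
    by (unfold X, e0; field; lra).
  exact HT. }
assert (HX2 : X <= 2 * kap).
{ assert (Re (G z0) * tau <= kap) by nra.
  apply Rnot_lt_le; intros Hx; nra. }
replace ((zeta - z) * ((eta + f z) * / (eta - f z)) - RtoC c * (zeta + z))%C
  with ((zeta - z) * (G z - G z0) + (zeta - z) * G z0)%C.
- eapply Rle_lt_trans; [apply Cmod_triangle|].
  rewrite !Cmod_mult, (Cmod_sub_sym zeta z); fold tau u g0.
  unfold X, kap in *; lra.
- transitivity ((zeta - z) * G z)%C; [ring|].
  unfold G, p; field; split; apply unit_sub_neq0; auto.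
Qed.

Lemma disk_ext_lt1 (phi : Disk -> Disk) (y : C) :
  Cmod y < 1 -> Cmod (disk_ext (fun z => disk_val (phi z)) y) < 1.
Proof.
intros Hy; unfold disk_ext; destruct Rlt_dec; [|tauto].
apply (proj2_sig (phi _)).
Qed.

Lemma disk_lt1 (z : Disk) : Cmod z < 1.
Proof. exact (proj2_sig z). Qed.

Lemma disk_sq_pos (z : Disk) : 0 < 1 - Cmod z ^ 2.
Proof. generalize (disk_lt1 z) (Cmod_ge_0 z); nra. Qed.

(** The candidate boundary value is a cluster point of the values phi(w); it is unimodular because 1
    - |phi(w)|^2 <= K (1 - |w|^2) tends to 0. *)
Lemma cluster_value (phi : Disk -> Disk) (zeta : C) (K : R) :
  Cmod zeta = 1 -> 0 < K ->
  (forall eps, 0 < eps -> exists w : Disk, Cmod (w - zeta)%C < eps /\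
     1 - Cmod (phi w) ^ 2 <= K * (1 - Cmod w ^ 2)) ->
  exists eta, Cmod eta = 1 /\
    forall eps, 0 < eps -> exists w : Disk, Cmod (w - zeta)%C < eps /\
      Cmod (phi w - eta)%C < eps /\ 1 - Cmod (phi w) ^ 2 <= K * (1 - Cmod w ^ 2).
Proof.
intros Hzeta HK Hseq.
destruct (choice (fun (n : nat) (w : Disk) => Cmod (w - zeta)%C < / (INR n + 1) /\
     1 - Cmod (phi w) ^ 2 <= K * (1 - Cmod w ^ 2))) as [w Hw].
{ intros n; apply Hseq, Rinv_0_lt_compat; generalize (pos_INR n); lra. }
destruct (complex_cluster_point (fun n => disk_val (phi (w n))) 1) as [eta Heta].
{ intros n; apply Rlt_le, disk_lt1. }
assert (Hcl : forall eps, 0 < eps -> exists w : Disk, Cmod (w - zeta)%C < eps /\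
      Cmod (phi w - eta)%C < eps /\ 1 - Cmod (phi w) ^ 2 <= K * (1 - Cmod w ^ 2)).
{ intros eps He; destruct (archimed_cor1 eps He) as [N [HN HN0]].
  destruct (Heta eps N He) as [p [Hp Hp']]; exists (w p); repeat split; try apply Hw; auto.
  apply Rlt_trans with (2 := HN), Rlt_le_trans with (1 := proj1 (Hw p)).
  apply Rinv_le_contravar; [apply lt_0_INR, HN0|].
  assert (INR N <= INR p) by (apply le_INR; lia); lra. }
exists eta; split; [|exact Hcl].
apply Rle_antisym; apply le_epsilon; intros eps He.
- destruct (Hcl eps He) as [v [_ [Hv _]]].
  generalize (disk_lt1 (phi v)) (Cmod_sub_ge eta (phi v)); rewrite Cmod_sub_sym; lra.
(* 2 K parts bound 1 - |phi(v)| and one part bounds |phi(v) - eta|. *)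
- assert (He' : 0 < eps / (2 * K + 1)) by (apply Rdiv_lt_0_compat; lra).
  destruct (Hcl _ He') as [v [Hv1 [Hv2 Hv3]]].
  generalize (disk_lt1 (phi v)) (Cmod_ge_0 (phi v)) (Cmod_sub_ge (phi v) eta)
    (one_sub_Cmod_le zeta v Hzeta) (disk_lt1 v) (Cmod_ge_0 v); intros.
  assert (1 - Cmod v ^ 2 <= 2 * (eps / (2 * K + 1))) by nra.
  assert (1 - Cmod (phi v) <= 1 - Cmod (phi v) ^ 2) by nra.
  assert (K * (1 - Cmod v ^ 2) <= K * (2 * (eps / (2 * K + 1))))
    by (apply Rmult_le_compat_l; lra).
  assert (K * (2 * (eps / (2 * K + 1))) + eps / (2 * K + 1) = eps) by (field; lra).
  lra.
Qed.

(** With Q = (zeta - z) (eta + phi) / (eta - phi), the difference quotient equals (eta + phi) / Q.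
    Since Q tends to 2 c zeta, it tends to eta / (c zeta): the constant c of [cayley_residue] is the
    reciprocal of the modulus of the angular derivative. *)
Lemma julia_caratheodory (phi : Disk -> Disk) (zeta : C) (K : R) :
  analytic (fun z => disk_val (phi z)) -> Cmod zeta = 1 -> 0 < K ->
  (forall eps, 0 < eps -> exists w : Disk, Cmod (w - zeta)%C < eps /\
     1 - Cmod (phi w) ^ 2 <= K * (1 - Cmod w ^ 2)) ->
  in_F phi zeta.
Proof.
intros Han Hzeta HK Hseq.
destruct (cluster_value phi zeta K Hzeta HK Hseq) as [eta [Heta Hcl]].
set (f := disk_ext (fun z => disk_val (phi z))).
assert (Hfv : forall z : Disk, f z = phi z) by (intros z; exact (disk_ext_val (fun y => disk_val (phi y)) z)).
assert (Hf : forall y, Cmod y < 1 -> holo y f) by (intros y Hy; apply analytic_holo; assumption).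
assert (Hlt : forall y, Cmod y < 1 -> Cmod (f y) < 1) by (intros y; apply disk_ext_lt1).
destruct (cayley_residue f zeta eta K Hf Hlt Hzeta Heta HK) as [c [Hc Hres]].
{ intros z Hz; apply julia; try assumption; [lra|].
  intros eps He; destruct (Hcl eps He) as [w [H1 [H2 H3]]].
  exists w; rewrite Hfv; repeat split; try assumption; apply disk_lt1. }
assert (Hzeta0 : zeta <> 0%C) by (apply Cmod_gt_0; lra).
assert (Hc0 : RtoC c <> 0%C) by (apply Cmod_gt_0; rewrite Cmod_R, Rabs_pos_eq; lra).
assert (Hmain : forall M eps, 0 < eps -> exists delta, 0 < delta /\
  forall z : Disk, Cmod (z - zeta)%C < M * (1 - Cmod z) -> Cmod (z - zeta)%C < delta ->
    Cmod (phi z - eta)%C < eps /\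
    Cmod ((phi z - eta) / (z - zeta) - eta / (RtoC c * zeta))%C < eps).
{ intros M eps He.
  set (e1 := Rmin (c / 2) (eps * c ^ 2 / 2)).
  assert (Hc2 : 0 < c ^ 2) by (apply pow_lt, Hc).
  assert (He1 : 0 < e1) by (apply Rmin_glb_lt; nra).
  (* The aperture [M] is an arbitrary real; enlarging it to at least 1 makes it positive. *)
  destruct (Hres (Rmax M 1) e1) as [d [Hd Hd']]; [|exact He1|].
  { apply Rlt_le_trans with (2 := Rmax_r M 1); lra. }
  (* As |Q - 2 c zeta| < e1 + c |z - zeta|, the bounds e1 <= c/2 and e2 <= 1/2 keep |Q| > c. The
     bound eps c / 2 serves the value, through c |phi - eta| <= 2 |z - zeta|; the last bounds on e1
     and e2 each take half of the error eps c^2 allowed for the quotient. *)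
  set (e2 := Rmin (Rmin (1 / 2) (eps * c / 2)) (eps * c ^ 2 / (2 * (2 + c)))).
  assert (He2 : 0 < e2).
  { repeat apply Rmin_glb_lt; try nra; apply Rdiv_lt_0_compat; nra. }
  exists (Rmin d e2); split; [apply Rmin_glb_lt; assumption|].
  intros z Hst Hnear; generalize (Rmin_l d e2) (Rmin_r d e2); intros.
  assert (Hz := disk_lt1 z).
  specialize (Hd' z Hz).
  assert (Hst' : Cmod (z - zeta)%C < Rmax M 1 * (1 - Cmod z)).
  { apply Rlt_le_trans with (1 := Hst); apply Rmult_le_compat_r; [lra | apply Rmax_l]. }
  specialize (Hd' Hst' ltac:(lra)); rewrite Hfv in Hd'.
  set (v := disk_val (phi z)) in *.
  set (tau := Cmod (z - zeta)%C) in *.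
  assert (Ht0 : 0 <= tau) by apply Cmod_ge_0.
  assert (Hne1 : (zeta - z)%C <> 0%C) by (apply unit_sub_neq0; assumption).
  assert (Hne2 : (eta - v)%C <> 0%C) by (apply unit_sub_neq0; [assumption | apply disk_lt1]).
  set (Q := ((zeta - z) * ((eta + v) * / (eta - v)))%C) in *.
  assert (HQ : Cmod (Q - RtoC (2 * c) * zeta)%C < e1 + c * tau).
  { replace (Q - RtoC (2 * c) * zeta)%C
      with ((Q - RtoC c * (zeta + z)) + RtoC c * (z - zeta))%C by (rewrite RtoC_mult; ring).
    eapply Rle_lt_trans; [apply Cmod_triangle|].
    rewrite Cmod_mult, Cmod_R, Rabs_pos_eq by lra; fold tau; lra. }
  assert (T1 : e1 <= c / 2) by apply Rmin_l.
  assert (T2 : e1 <= eps * c ^ 2 / 2) by apply Rmin_r.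
  assert (T3 : e2 <= 1 / 2)
    by (eapply Rle_trans; [apply Rmin_l | apply Rmin_l]).
  assert (T4 : e2 <= eps * c / 2)
    by (eapply Rle_trans; [apply Rmin_l | apply Rmin_r]).
  assert (T5 : e2 <= eps * c ^ 2 / (2 * (2 + c))) by apply Rmin_r.
  assert (HQc : c < Cmod Q).
  { generalize (Cmod_sub_ge (RtoC (2 * c) * zeta)%C (RtoC (2 * c) * zeta - Q)%C).
    rewrite (Cmod_sub_sym _ Q), Cmod_mult, Cmod_R, Hzeta, Rabs_pos_eq by lra.
    replace (RtoC (2 * c) * zeta - (RtoC (2 * c) * zeta - Q))%C with Q by ring.
    nra. }
  assert (HQ0 : Q <> 0%C) by (apply Cmod_gt_0; lra).
  assert (Hv : Cmod v < 1) by apply disk_lt1.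
  assert (Hev : Cmod (eta + v)%C <= 2)
    by (eapply Rle_trans; [apply Cmod_triangle|]; lra).
  assert (EQ : ((v - eta) * Q = (z - zeta) * (eta + v))%C) by (unfold Q; field; exact Hne2).
  assert (Hve : Cmod (v - eta)%C * c <= 2 * tau).
  { apply (f_equal Cmod) in EQ; rewrite !Cmod_mult in EQ; fold tau in EQ.
    apply Rle_trans with (Cmod (v - eta)%C * Cmod Q).
    - apply Rmult_le_compat_l; [apply Cmod_ge_0 | lra].
    - rewrite EQ, Rmult_comm; apply Rmult_le_compat_r; lra. }
  split.
  - apply Rmult_lt_reg_r with c; [exact Hc|]; lra.
  - assert (Hne3 : (z - zeta)%C <> 0%C)
      by (replace (z - zeta)%C with (- (zeta - z))%C by ring;
          apply Cmod_gt_0; rewrite Cmod_opp; apply Cmod_gt_0, Hne1).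
    replace ((v - eta) / (z - zeta) - eta / (RtoC c * zeta))%C
      with ((RtoC c * zeta * (v - eta) - eta * (Q - RtoC (2 * c) * zeta)) / (RtoC c * zeta * Q))%C.
    + assert (Hden : (RtoC c * zeta * Q)%C <> 0%C)
        by (apply Cmult_neq_0; [apply Cmult_neq_0|]; assumption).
      rewrite Cmod_div by exact Hden.
      rewrite !Cmod_mult, Cmod_R, Hzeta, Rabs_pos_eq by lra.
      apply Rmult_lt_reg_r with (c * 1 * Cmod Q); [nra|].
      unfold Rdiv; rewrite Rmult_assoc, Rinv_l, Rmult_1_r by nra.
      eapply Rle_lt_trans; [apply Cmod_triangle_sub|].
      rewrite !Cmod_mult, Cmod_R, Hzeta, Heta, Rabs_pos_eq by lra.
      apply Rlt_le_trans with (eps * c ^ 2); [|nra].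
      assert ((2 + c) * tau <= eps * c ^ 2 / 2).
      { apply Rle_trans with ((2 + c) * (eps * c ^ 2 / (2 * (2 + c)))); [|right; field; lra].
        apply Rmult_le_compat_l; lra. }
      lra.
    + replace ((v - eta) / (z - zeta))%C with ((eta + v) / Q)%C.
      * rewrite RtoC_mult; field; repeat split; assumption.
      * apply (f_equal (fun x => x / ((z - zeta) * Q))%C) in EQ.
        transitivity ((z - zeta) * (eta + v) / ((z - zeta) * Q))%C; [field; split; assumption|].
        rewrite <- EQ; field; split; assumption. }
exists (eta, (eta / (RtoC c * zeta))%C); split; [exact Hzeta|]; simpl.
split; [|split; [exact Heta|]]; intros M eps He;
  destruct (Hmain M eps He) as [d [Hd Hd']]; exists d; split; auto;
  intros z H1 H2; apply (Hd' z H1 H2).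
Qed.

(** Contrapositive of [julia_caratheodory]: outside F the ratio tends to infinity under unrestricted
    approach. *)
Lemma not_in_F_ratio (phi : Disk -> Disk) (zeta : C) (K : R) :
  analytic (fun z => disk_val (phi z)) -> Cmod zeta = 1 -> 0 < K -> ~ in_F phi zeta ->
  exists delta, 0 < delta /\ forall w : Disk, Cmod (w - zeta)%C < delta ->
    K * (1 - Cmod w ^ 2) < 1 - Cmod (phi w) ^ 2.
Proof.
intros Han Hzeta HK Hn; apply NNPP; intros Hne; apply Hn.
apply (julia_caratheodory phi zeta K Han Hzeta HK).
intros eps He; apply NNPP; intros Hx; apply Hne; exists eps; split; [exact He|].
intros w Hw; apply Rnot_le_lt; intros Hle; apply Hx; exists w; auto.
Qed.

(** Schwarz-Pick between w and 0, with c = (1 - |phi(0)|)^2. It keeps angular derivatives away from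
    0 and keeps one factor from compensating the blow-up of another. *)
Lemma schwarz_pick_origin (phi : Disk -> Disk) :
  analytic (fun z => disk_val (phi z)) ->
  exists c, 0 < c /\ forall w : Disk, c * (1 - Cmod w ^ 2) <= 1 - Cmod (phi w) ^ 2.
Proof.
intros Han; set (f := disk_ext (fun z => disk_val (phi z))).
assert (Hfv : forall z : Disk, f z = phi z) by (intros z; exact (disk_ext_val (fun y => disk_val (phi y)) z)).
assert (H0 : Cmod 0 < 1) by (rewrite Cmod_0; lra).
assert (Hf0 : Cmod (f 0%C) < 1) by (apply disk_ext_lt1, H0).
exists ((1 - Cmod (f 0%C)) ^ 2); split; [apply pow_lt; lra|].
intros w; generalize (schwarz_pick f w 0%C); rewrite Hfv; intros SP.
specialize (SP ltac:(intros y Hy; apply analytic_holo; assumption)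
  (disk_ext_lt1 phi) (disk_lt1 w) H0).
replace (1 - Cconj 0 * w)%C with (RtoC 1) in SP
  by (apply injective_projections; simpl; ring).
rewrite Cmod_0, Cmod_1 in SP.
generalize (disk_sq_pos w) (disk_sq_pos (phi w)); intros Hw Hp.
generalize (Cmod_sub_ge 1 (Cconj (f 0%C) * phi w)%C).
rewrite Cmod_1, Cmod_mult, Cmod_conj; intros Hge.
generalize (disk_lt1 (phi w)) (Cmod_ge_0 (phi w)) (Cmod_ge_0 (f 0%C)); intros.
assert (Hm : (1 - Cmod (f 0%C)) ^ 2 <= Cmod (1 - Cconj (f 0%C) * phi w)%C ^ 2)
  by (apply pow_incr; nra).
assert (Hm' : (1 - Cmod (f 0%C)) ^ 2 * (1 - Cmod w ^ 2)
   <= Cmod (1 - Cconj (f 0%C) * phi w)%C ^ 2 * (1 - Cmod w ^ 2))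
  by (apply Rmult_le_compat_r; lra).
assert (0 <= Cmod (f 0%C) ^ 2) by apply pow2_ge_0.
nra.
Qed.

(** * Approach along segments *)

Definition slope (s : R) : C := (1, s).

(** For fixed s the segment makes the angle arctan s with the radius at zeta, so it ends in a Stolz
    region whose aperture grows with s. *)
Definition segment (zeta : C) (s t : R) : C := (zeta * (1 - RtoC t * slope s))%C.

Lemma slope_sq (s : R) : Cmod (slope s) ^ 2 = 1 + s ^ 2.
Proof. rewrite Cmod2_alt; unfold slope, Re, Im; simpl; ring. Qed.

Lemma segment_sq (zeta : C) (s t : R) :
  Cmod zeta = 1 -> 1 - Cmod (segment zeta s t) ^ 2 = t * (2 - t * Cmod (slope s) ^ 2).
Proof.
intros Hz; unfold segment; rewrite Cmod_mult, Hz, Rmult_1_l, slope_sq.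
unfold slope; Cunfold; ring.
Qed.

Lemma segment_sub (zeta : C) (s t : R) :
  (segment zeta s t - zeta = - (RtoC t * slope s * zeta))%C.
Proof. unfold segment; ring. Qed.

Lemma segment_dist (zeta : C) (s t : R) :
  Cmod zeta = 1 -> 0 <= t -> Cmod (segment zeta s t - zeta)%C = t * Cmod (slope s).
Proof.
intros Hz Ht; rewrite segment_sub, Cmod_opp, !Cmod_mult, Cmod_R, Hz, Rabs_pos_eq by exact Ht.
ring.
Qed.

(** The bound on t gives 1 - |w|^2 >= t, hence 1 - |w| >= t / 2 and the aperture 2 |slope|; the
    extra 1 makes the inequality strict. *)
Lemma segment_stolz (zeta : C) (s t : R) :
  Cmod zeta = 1 -> 0 < t -> t * Cmod (slope s) ^ 2 <= 1 ->
  t <= 1 - Cmod (segment zeta s t) ^ 2 /\ Cmod (segment zeta s t) < 1 /\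
  Cmod (segment zeta s t - zeta)%C
    < (2 * Cmod (slope s) + 1) * (1 - Cmod (segment zeta s t)).
Proof.
intros Hz Ht Hts.
assert (H1 : t <= 1 - Cmod (segment zeta s t) ^ 2)
  by (rewrite segment_sq by exact Hz; nra).
generalize (Cmod_ge_0 (segment zeta s t)) (Cmod_ge_0 (slope s)); intros H0 Hs.
assert (H2 : Cmod (segment zeta s t) < 1) by nra.
repeat split; try assumption.
rewrite segment_dist by lra.
assert (t / 2 <= 1 - Cmod (segment zeta s t)) by nra.
nra.
Qed.

Lemma segment_bound_pos (s : R) : 0 < / Cmod (slope s) ^ 2.
Proof. apply Rinv_0_lt_compat; rewrite slope_sq; generalize (pow2_ge_0 s); lra. Qed.

Lemma segment_bound (s t : R) :
  t < / Cmod (slope s) ^ 2 -> t * Cmod (slope s) ^ 2 <= 1.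
Proof.
intros Ht.
assert (0 < Cmod (slope s) ^ 2) by (rewrite slope_sq; generalize (pow2_ge_0 s); lra).
apply Rle_trans with (/ Cmod (slope s) ^ 2 * Cmod (slope s) ^ 2).
- apply Rmult_le_compat_r; lra.
- rewrite Rinv_l; lra.
Qed.

(** The bound [t0 <= / Cmod (slope s) ^ 2] is returned so that points of the segment with t < t0 are
    known to lie in the disk. *)
Lemma segment_lim (g : Disk -> C) (zeta l : C) (s eps : R) :
  Cmod zeta = 1 -> nontangential_lim g zeta l -> 0 < eps ->
  exists t0, 0 < t0 /\ t0 <= / Cmod (slope s) ^ 2 /\
    forall t (w : Disk), 0 < t < t0 -> disk_val w = segment zeta s t ->
      Cmod (g w - l)%C < eps.
Proof.
intros Hz Hg He.
destruct (Hg (2 * Cmod (slope s) + 1) eps He) as [d [Hd Hd']].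
assert (Hs : 0 <= Cmod (slope s)) by apply Cmod_ge_0.
assert (H0 : 0 < d / (Cmod (slope s) + 1)) by (apply Rdiv_lt_0_compat; lra).
exists (Rmin (/ Cmod (slope s) ^ 2) (d / (Cmod (slope s) + 1))); split; [|split].
- apply Rmin_glb_lt; [apply segment_bound_pos | exact H0].
- apply Rmin_l.
- intros t w Ht Hw.
  generalize (Rmin_l (/ Cmod (slope s) ^ 2) (d / (Cmod (slope s) + 1)))
    (Rmin_r (/ Cmod (slope s) ^ 2) (d / (Cmod (slope s) + 1))); intros.
  destruct (segment_stolz zeta s t Hz (proj1 Ht)) as [_ [_ H3]];
    [apply segment_bound; lra|].
  apply Hd'; rewrite Hw; [exact H3|].
  rewrite segment_dist by lra.
  apply Rle_lt_trans with (t * (Cmod (slope s) + 1)); [nra|].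
  apply Rlt_le_trans with (d / (Cmod (slope s) + 1) * (Cmod (slope s) + 1));
    [|right; field; lra].
  apply Rmult_lt_compat_r; lra.
Qed.

Lemma segment_in_disk (zeta : C) (s t : R) :
  Cmod zeta = 1 -> 0 < t < / Cmod (slope s) ^ 2 ->
  exists w : Disk, disk_val w = segment zeta s t.
Proof.
intros Hz [Ht1 Ht2].
destruct (segment_stolz zeta s t Hz Ht1 (segment_bound s t Ht2)) as [_ [H2 _]].
exists (exist (fun z => Cmod z < 1) _ H2); reflexivity.
Qed.

(** The radius, s = 0, supplies a disk point at which both limits can be tested. *)
Lemma nontangential_lim_unique (g : Disk -> C) (zeta l l' : C) :
  Cmod zeta = 1 -> nontangential_lim g zeta l -> nontangential_lim g zeta l' -> l = l'.
Proof.
intros Hz H1 H2; apply NNPP; intros Hne.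
assert (He : 0 < Cmod (l - l')%C) by (apply Cmod_gt_0, Csub_neq0, Hne).
destruct (segment_lim g zeta l 0 (Cmod (l - l')%C / 2) Hz H1) as [t1 [T1 [T1' L1]]]; [lra|].
destruct (segment_lim g zeta l' 0 (Cmod (l - l')%C / 2) Hz H2) as [t2 [T2 [T2' L2]]]; [lra|].
assert (H0 : 0 < Rmin t1 t2) by (apply Rmin_glb_lt; assumption).
generalize (Rmin_l t1 t2) (Rmin_r t1 t2); intros.
destruct (segment_in_disk zeta 0 (Rmin t1 t2 / 2) Hz) as [w Hw]; [lra|].
specialize (L1 (Rmin t1 t2 / 2) w ltac:(lra) Hw).
specialize (L2 (Rmin t1 t2 / 2) w ltac:(lra) Hw).
generalize (Cmod_triangle_sub (g w - l')%C (g w - l)%C).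
replace (g w - l' - (g w - l))%C with (l - l')%C by ring; lra.
Qed.

Lemma has_D1_unique (phi : Disk -> Disk) (zeta : C) (d d' : C * C) :
  has_D1 phi zeta d -> has_D1 phi zeta d' -> d = d'.
Proof.
destruct d as [d0 d1], d' as [d0' d1'].
intros [Hz [H0 [_ H1]]] [_ [H0' [_ H1']]]; simpl in *.
assert (E := nontangential_lim_unique _ _ _ _ Hz H0 H0'); subst d0'.
now rewrite (nontangential_lim_unique _ _ _ _ Hz H1 H1').
Qed.

(** * First-order expansion at the boundary and positivity of the angular derivative *)

Lemma unit_mul_conj (z : C) : Cmod z = 1 -> (Cconj z * z = 1)%C.
Proof.
intros Hz; rewrite Cmult_comm, <- Cmod2_conj, Hz; f_equal; ring.
Qed.

(** On the segment w - zeta = - t (1 + i s) zeta, so the difference quotient turns into a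
    first-order expansion of 1 - conj(d0) phi(w) in t. *)
Lemma segment_D1 (phi : Disk -> Disk) (zeta : C) (d : C * C) (s eps : R) :
  has_D1 phi zeta d -> 0 < eps ->
  exists t0, 0 < t0 /\ t0 <= / Cmod (slope s) ^ 2 /\
    forall t (w : Disk), 0 < t < t0 -> disk_val w = segment zeta s t ->
      Cmod ((1 - Cconj (fst d) * phi w) / RtoC t - Cconj (fst d) * zeta * snd d * slope s)%C
      < eps.
Proof.
destruct d as [d0 d1]; intros [Hz [_ [Hd0 H1]]] He; simpl in *.
assert (Hs : 0 <= Cmod (slope s)) by apply Cmod_ge_0.
destruct (segment_lim _ _ _ s (eps / (Cmod (slope s) + 1)) Hz H1) as [t0 [T1 [T2 HL]]].
{ apply Rdiv_lt_0_compat; lra. }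
exists t0; repeat split; try assumption.
intros t w Ht Hw; specialize (HL t w Ht Hw).
assert (Ht0 : RtoC t <> 0%C) by (apply Cmod_gt_0; rewrite Cmod_R, Rabs_pos_eq; lra).
assert (Hne : (w - zeta)%C <> 0%C).
{ rewrite Hw, segment_sub; apply Cmod_gt_0; rewrite Cmod_opp, !Cmod_mult, Cmod_R, Hz.
  rewrite Rabs_pos_eq by lra.
  assert (0 < Cmod (slope s)); [|nra].
  apply Cmod_gt_0; unfold slope; intros E; injection E; intros; lra. }
replace ((1 - Cconj d0 * phi w) / RtoC t - Cconj d0 * zeta * d1 * slope s)%C
  with (Cconj d0 * zeta * slope s * ((phi w - d0) / (w - zeta) - d1))%C.
- rewrite !Cmod_mult, Cmod_conj, Hd0, Hz.
  apply Rle_lt_trans with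
    (Cmod ((phi w - d0) / (w - zeta) - d1)%C * (Cmod (slope s) + 1)).
  { generalize (Cmod_ge_0 ((phi w - d0) / (w - zeta) - d1)%C); nra. }
  apply Rlt_le_trans with (eps / (Cmod (slope s) + 1) * (Cmod (slope s) + 1));
    [|right; field; lra].
  apply Rmult_lt_compat_r; lra.
- assert (E : (slope s * zeta = - (w - zeta) / RtoC t)%C)
    by (rewrite Hw, segment_sub; field; exact Ht0).
  transitivity (Cconj d0 * (slope s * zeta) * ((phi w - d0) / (w - zeta))
     - Cconj d0 * zeta * d1 * slope s)%C; [ring|].
  rewrite E; f_equal.
  rewrite <- (unit_mul_conj d0 Hd0); field; split; assumption.
Qed.

(* |phi| < 1 forces Re (A (1 + i s)) >= 0 for every s, where A = conj(d0) zeta d1. *)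
Lemma D1_pos (phi : Disk -> Disk) (zeta : C) (d : C * C) :
  analytic (fun z => disk_val (phi z)) -> has_D1 phi zeta d ->
  (Cconj (fst d) * zeta * snd d)%C = RtoC (Cmod (snd d)) /\ 0 < Cmod (snd d).
Proof.
intros Han Hd; set (A := (Cconj (fst d) * zeta * snd d)%C).
assert (Hz : Cmod zeta = 1) by apply Hd.
assert (Hd0 : Cmod (fst d) = 1) by apply Hd.
assert (HA : Cmod A = Cmod (snd d)).
{ unfold A; rewrite !Cmod_mult, Cmod_conj, Hz, Hd0; ring. }
assert (Hre : forall s, 0 <= Re (A * slope s)%C).
{ intros s; apply Rnot_lt_le; intros Hn.
  destruct (segment_D1 phi zeta d s (- Re (A * slope s)%C) Hd) as [t0 [T1 [T2 HL]]]; [lra|].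
  destruct (segment_in_disk zeta s (t0 / 2) Hz) as [w Hw]; [lra|].
  specialize (HL (t0 / 2) w ltac:(lra) Hw); fold A in HL.
  set (y := ((1 - Cconj (fst d) * phi w) / RtoC (t0 / 2))%C) in *.
  assert (Hy : 0 < Re y).
  { unfold y, Cdiv; rewrite <- RtoC_inv by lra; rewrite re_scal_r.
    apply Rmult_lt_0_compat; [|apply Rinv_0_lt_compat; lra].
    unfold Cminus; rewrite re_plus, re_opp, re_RtoC.
    generalize (Re_le_Cmod (Cconj (fst d) * phi w)%C).
    rewrite Cmod_mult, Cmod_conj, Hd0; generalize (disk_lt1 (phi w)); lra. }
  generalize (Re_le_Cmod (y - A * slope s)%C); unfold Cminus at 1.
  rewrite re_plus, re_opp; lra. }
assert (Hre' : forall s, 0 <= Re A - s * Im A).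
{ intros s; generalize (Hre s); rewrite re_mult; unfold slope; simpl; lra. }
(* At s = (Re A + 1) / Im A the nonnegative quantity would equal -1. *)
assert (HIm : Im A = 0).
{ apply NNPP; intros Hn; generalize (Hre' ((Re A + 1) / Im A)).
  replace ((Re A + 1) / Im A * Im A) with (Re A + 1) by (field; exact Hn); lra. }
assert (HRe : 0 <= Re A) by (generalize (Hre' 0); lra).
assert (EA : A = RtoC (Re A)) by (apply injective_projections; [reflexivity | exact HIm]).
assert (HRA : Re A = Cmod (snd d)).
{ rewrite <- HA; rewrite EA at 2; rewrite Cmod_R, Rabs_pos_eq; auto. }
split; [rewrite EA at 1; now rewrite HRA|].
(* If A were 0, then 1 - |phi| would be o(t) on the radius, against the lower bound c (1 - |w|^2) >=
   c t. *)
destruct (schwarz_pick_origin phi Han) as [c [Hc Hsp]].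
apply Rnot_le_lt; intros Hn.
assert (HA0 : A = RtoC 0) by (rewrite EA; f_equal; lra).
destruct (segment_D1 phi zeta d 0 (c / 2) Hd) as [t0 [T1 [T2 HL]]]; [lra|].
destruct (segment_in_disk zeta 0 (t0 / 2) Hz) as [w Hw]; [lra|].
specialize (HL (t0 / 2) w ltac:(lra) Hw); fold A in HL.
destruct (segment_stolz zeta 0 (t0 / 2) Hz) as [H1 _];
  [lra | apply segment_bound; lra |].
rewrite <- Hw in H1; specialize (Hsp w).
rewrite HA0 in HL.
replace ((1 - Cconj (fst d) * phi w) / RtoC (t0 / 2) - RtoC 0 * slope 0)%C
  with ((1 - Cconj (fst d) * phi w) / RtoC (t0 / 2))%C in HL by ring.
assert (Ht : RtoC (t0 / 2) <> 0%C)
  by (apply Cmod_gt_0; rewrite Cmod_R, Rabs_pos_eq; lra).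
rewrite Cmod_div, Cmod_R, Rabs_pos_eq in HL by (assumption || lra).
apply Rmult_lt_compat_r with (r := t0 / 2) in HL; [|lra].
replace (Cmod (1 - Cconj (fst d) * phi w)%C / (t0 / 2) * (t0 / 2))
  with (Cmod (1 - Cconj (fst d) * phi w)%C) in HL by (field; lra).
generalize (Cmod_sub_ge 1 (Cconj (fst d) * phi w)%C).
rewrite Cmod_1, Cmod_mult, Cmod_conj, Hd0; intros Hge.
generalize (disk_lt1 (phi w)) (Cmod_ge_0 (phi w)); intros.
assert (1 - Cmod (phi w) ^ 2 <= 2 * (1 - Cmod (phi w))) by nra.
nra.
Qed.

(** Consequently, distinct data with the same d_0 have derivatives of distinct moduli. *)
Lemma D1_snd (phi : Disk -> Disk) (zeta : C) (d : C * C) :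
  analytic (fun z => disk_val (phi z)) -> has_D1 phi zeta d ->
  snd d = (RtoC (Cmod (snd d)) * fst d * Cconj zeta)%C.
Proof.
intros Han Hd; rewrite <- (proj1 (D1_pos phi zeta d Han Hd)).
transitivity ((Cconj (fst d) * fst d) * (Cconj zeta * zeta) * snd d)%C; [|ring].
rewrite !unit_mul_conj by apply Hd; ring.
Qed.

(** Here y stands for (1 - conj(d0) phi(w)) / t, with limit l. For |d0| = 1 one has 1 - conj(phi_i)
    phi_j = t (conj(yi) + yj - t conj(yi) yj), while 1 - |w|^2 = t (2 - t L), so t cancels. *)
Lemma kernel_quotient_estimate (yi yj li lj : C) (t L e : R) :
  0 < t -> 0 <= L -> t * L <= 1 -> e <= 1 ->
  Cmod (yi - li)%C < e -> Cmod (yj - lj)%C < e ->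
  Cmod ((Cconj yi + yj - RtoC t * (Cconj yi * yj)) / RtoC (2 - t * L)
        - (Cconj li + lj) / RtoC 2)%C
  <= 2 * e + t * ((Cmod li + 1) * (Cmod lj + 1) + L * (Cmod li + Cmod lj)).
Proof.
intros Ht HL HtL He Hi Hj.
assert (H2 : RtoC 2 <> 0%C) by (apply Cmod_gt_0; rewrite Cmod_R, Rabs_pos_eq; lra).
assert (Hx : 1 <= 2 - t * L) by lra.
assert (Hx0 : RtoC (2 - t * L) <> 0%C)
  by (apply Cmod_gt_0; rewrite Cmod_R, Rabs_pos_eq; lra).
assert (HtL0 : 0 <= t * L) by nra.
assert (Hdiv : forall (v : C) (B : R), Cmod v <= B * 2 ->
  Cmod (v / (RtoC 2 * RtoC (2 - t * L)))%C <= B).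
{ intros v B Hv; rewrite Cmod_div by (apply Cmult_neq_0; assumption).
  rewrite Cmod_mult, !Cmod_R, !Rabs_pos_eq by lra.
  apply Rmult_le_reg_r with (2 * (2 - t * L)); [lra|].
  unfold Rdiv; rewrite Rmult_assoc, Rinv_l, Rmult_1_r by lra.
  assert (0 <= B) by (generalize (Cmod_ge_0 v); lra); nra. }
replace ((Cconj yi + yj - RtoC t * (Cconj yi * yj)) / RtoC (2 - t * L)
        - (Cconj li + lj) / RtoC 2)%C
  with ((RtoC 2 * (Cconj (yi - li) + (yj - lj))
         + (RtoC (t * L) * (Cconj li + lj) - RtoC (2 * t) * (Cconj yi * yj)))
        / (RtoC 2 * RtoC (2 - t * L)))%C.
- apply Hdiv.
  eapply Rle_trans; [apply Cmod_triangle|].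
  generalize (Cmod_triangle_sub (RtoC (t * L) * (Cconj li + lj))%C
    (RtoC (2 * t) * (Cconj yi * yj))%C)
    (Cmod_triangle (Cconj (yi - li)) (yj - lj)%C) (Cmod_triangle (Cconj li) lj).
  rewrite !Cmod_mult, !Cmod_conj, !Cmod_R, !Rabs_pos_eq by lra.
  generalize (Cmod_sub_ge yi li) (Cmod_sub_ge yj lj) (Cmod_ge_0 yi) (Cmod_ge_0 yj)
    (Cmod_ge_0 li) (Cmod_ge_0 lj); intros.
  assert (Cmod yi * Cmod yj <= (Cmod li + 1) * (Cmod lj + 1))
    by (apply Rmult_le_compat; lra).
  assert (t * (Cmod yi * Cmod yj) <= t * ((Cmod li + 1) * (Cmod lj + 1)))
    by (apply Rmult_le_compat_l; lra).
  assert (t * L * Cmod (Cconj li + lj)%C <= t * L * (Cmod li + Cmod lj))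
    by (apply Rmult_le_compat_l; lra).
  assert (0 <= t * L * (Cmod li + Cmod lj)) by (apply Rmult_le_pos; lra).
  lra.
- rewrite Cminus_conj.
  replace (RtoC (t * L)) with (RtoC 2 - RtoC (2 - t * L))%C
    by (rewrite <- RtoC_minus; f_equal; ring).
  rewrite RtoC_mult; field; exact Hx0.
Qed.

(** With a and b the two moduli, the limit is ((a + b) + i s (b - a)) / 2. *)
Lemma segment_kernel_quotient (phi psi : Disk -> Disk) (zeta : C) (d d' : C * C) (s eps : R) :
  analytic (fun z => disk_val (phi z)) -> analytic (fun z => disk_val (psi z)) ->
  has_D1 phi zeta d -> has_D1 psi zeta d' -> fst d = fst d' -> 0 < eps ->
  exists t0, 0 < t0 /\
    forall t (w : Disk), 0 < t < t0 -> disk_val w = segment zeta s t ->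
      Cmod ((1 - Cconj (phi w) * psi w) / RtoC (1 - Cmod w ^ 2)
        - (Cconj (RtoC (Cmod (snd d)) * slope s) + RtoC (Cmod (snd d')) * slope s) / RtoC 2)%C
      < eps.
Proof.
intros Han Han' Hd Hd' Ed He.
assert (Hz : Cmod zeta = 1) by apply Hd.
assert (Hd0 : Cmod (fst d) = 1) by apply Hd.
set (e := Rmin 1 (eps / 4)).
assert (He0 : 0 < e) by (apply Rmin_glb_lt; lra).
assert (He1 : e <= 1) by apply Rmin_l.
assert (He4 : e <= eps / 4) by apply Rmin_r.
destruct (segment_D1 phi zeta d s e Hd He0) as [t1 [T1 [T1' L1]]].
destruct (segment_D1 psi zeta d' s e Hd' He0) as [t2 [T2 [T2' L2]]].
rewrite (proj1 (D1_pos _ _ _ Han Hd)) in L1.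
rewrite (proj1 (D1_pos _ _ _ Han' Hd')) in L2; rewrite <- Ed in L2.
set (li := (RtoC (Cmod (snd d)) * slope s)%C) in *.
set (lj := (RtoC (Cmod (snd d')) * slope s)%C) in *.
set (L := Cmod (slope s) ^ 2); assert (HL : 0 <= L) by apply pow2_ge_0.
set (Q := (Cmod li + 1) * (Cmod lj + 1) + L * (Cmod li + Cmod lj)).
assert (HQ : 0 <= Q).
{ generalize (Cmod_ge_0 li) (Cmod_ge_0 lj); intros; unfold Q.
  apply Rplus_le_le_0_compat; apply Rmult_le_pos; lra. }
assert (H0 : 0 < eps / (4 * (Q + 1))) by (apply Rdiv_lt_0_compat; lra).
exists (Rmin (Rmin t1 t2) (eps / (4 * (Q + 1)))); split.
{ repeat apply Rmin_glb_lt; assumption. }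
intros t w Ht Hw.
generalize (Rmin_l (Rmin t1 t2) (eps / (4 * (Q + 1))))
  (Rmin_r (Rmin t1 t2) (eps / (4 * (Q + 1)))) (Rmin_l t1 t2) (Rmin_r t1 t2); intros.
specialize (L1 t w ltac:(lra) Hw); specialize (L2 t w ltac:(lra) Hw).
assert (HtL : t * L <= 1) by (apply segment_bound; lra).
set (yi := ((1 - Cconj (fst d) * phi w) / RtoC t)%C) in *.
set (yj := ((1 - Cconj (fst d) * psi w) / RtoC t)%C) in *.
assert (Hest := kernel_quotient_estimate yi yj li lj t L e
  (proj1 Ht) HL HtL He1 L1 L2).
assert (Ht0 : RtoC t <> 0%C) by (apply Cmod_gt_0; rewrite Cmod_R, Rabs_pos_eq; lra).
assert (Hx0 : RtoC (2 - t * L) <> 0%C)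
  by (apply Cmod_gt_0; rewrite Cmod_R, Rabs_pos_eq; lra).
replace ((1 - Cconj (phi w) * psi w) / RtoC (1 - Cmod w ^ 2))%C
  with ((Cconj yi + yj - RtoC t * (Cconj yi * yj)) / RtoC (2 - t * L))%C.
- apply Rle_lt_trans with (1 := Hest); fold Q.
  assert (t * Q <= eps / 4); [|lra].
  apply Rle_trans with (eps / (4 * (Q + 1)) * (Q + 1)); [|right; field; lra].
  apply Rmult_le_compat; lra.
- rewrite Hw, segment_sq, RtoC_mult by exact Hz; fold L.
  assert (Ei : Cconj yi = ((1 - fst d * Cconj (phi w)) / RtoC t)%C).
  { unfold yi; rewrite Cdiv_conj, Cminus_conj, Cmult_conj, Cconj_conj by exact Ht0.
    f_equal; [f_equal|]; apply injective_projections; simpl; ring. }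
  rewrite Ei; unfold yj.
  transitivity ((1 - (Cconj (fst d) * fst d) * (Cconj (phi w) * psi w))
     / (RtoC t * RtoC (2 - t * L)))%C; [field; split; assumption|].
  rewrite unit_mul_conj by exact Hd0; f_equal; ring.
Qed.

(* The iterated limit t -> 0, then s -> infinity. *)
Definition segment_eventually (zeta : C) (P : Disk -> Prop) : Prop :=
  exists s0, forall s, s0 <= s -> exists t0, 0 < t0 /\
    forall t (w : Disk), 0 < t < t0 -> disk_val w = segment zeta s t -> P w.

Lemma segment_eventually_imp (zeta : C) (P Q : Disk -> Prop) :
  (forall w, P w -> Q w) -> segment_eventually zeta P -> segment_eventually zeta Q.
Proof.
intros HPQ [s0 H]; exists s0; intros s Hs; destruct (H s Hs) as [t0 [Ht H']].
exists t0; split; [exact Ht|]; eauto.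
Qed.

Lemma segment_eventually_and (zeta : C) (P Q : Disk -> Prop) :
  segment_eventually zeta P -> segment_eventually zeta Q ->
  segment_eventually zeta (fun w => P w /\ Q w).
Proof.
intros [s1 H1] [s2 H2]; exists (Rmax s1 s2); intros s Hs.
generalize (Rmax_l s1 s2) (Rmax_r s1 s2); intros.
destruct (H1 s ltac:(lra)) as [t1 [T1 H1']], (H2 s ltac:(lra)) as [t2 [T2 H2']].
exists (Rmin t1 t2); split; [apply Rmin_glb_lt; assumption|].
intros t w Ht Hw; generalize (Rmin_l t1 t2) (Rmin_r t1 t2); intros.
split; [apply (H1' t) | apply (H2' t)]; auto; lra.
Qed.

Lemma segment_eventually_forall (zeta : C) (n : nat) (P : nat -> Disk -> Prop) :
  (forall i, (i < n)%nat -> segment_eventually zeta (P i)) ->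
  segment_eventually zeta (fun w => forall i, (i < n)%nat -> P i w).
Proof.
induction n as [|n IH]; intros H.
- exists 0; intros s _; exists 1; split; [lra|]; intros; lia.
- apply (segment_eventually_imp zeta
    (fun w => (forall i, (i < n)%nat -> P i w) /\ P n w)).
  + intros w [Hw Hn] i Hi; destruct (Nat.eq_dec i n) as [->|]; [exact Hn | apply Hw; lia].
  + apply segment_eventually_and; [apply IH; intros; apply H | apply H]; lia.
Qed.

Lemma segment_eventually_near (zeta : C) (delta : R) :
  Cmod zeta = 1 -> 0 < delta ->
  segment_eventually zeta (fun w => Cmod (w - zeta)%C < delta).
Proof.
intros Hz Hd; exists 0; intros s _.
assert (Hs : 0 <= Cmod (slope s)) by apply Cmod_ge_0.
exists (delta / (Cmod (slope s) + 1)); split; [apply Rdiv_lt_0_compat; lra|].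
intros t w Ht Hw; rewrite Hw, segment_dist by lra.
apply Rle_lt_trans with (t * (Cmod (slope s) + 1)); [nra|].
apply Rlt_le_trans with (delta / (Cmod (slope s) + 1) * (Cmod (slope s) + 1));
  [|right; field; lra].
apply Rmult_lt_compat_r; lra.
Qed.

Lemma segment_eventually_nontangential (zeta l : C) (g : Disk -> C) (eps : R) :
  Cmod zeta = 1 -> nontangential_lim g zeta l -> 0 < eps ->
  segment_eventually zeta (fun w => Cmod (g w - l)%C < eps).
Proof.
intros Hz Hg He; exists 0; intros s _.
destruct (segment_lim g zeta l s eps Hz Hg He) as [t0 [T0 [_ H]]]; exists t0; auto.
Qed.

(** Properness of this filter: the iterated limit can be replaced by one well-chosen point w. *)
Lemma segment_eventually_exists (zeta : C) (P : Disk -> Prop) :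
  Cmod zeta = 1 -> segment_eventually zeta P -> exists w, P w.
Proof.
intros Hz [s0 H]; destruct (H s0 (Rle_refl _)) as [t0 [T0 H']].
generalize (segment_bound_pos s0); intros Hb.
set (t := Rmin t0 (/ Cmod (slope s0) ^ 2) / 2).
assert (H0 : 0 < Rmin t0 (/ Cmod (slope s0) ^ 2)) by (apply Rmin_glb_lt; assumption).
generalize (Rmin_l t0 (/ Cmod (slope s0) ^ 2)) (Rmin_r t0 (/ Cmod (slope s0) ^ 2)); intros.
destruct (segment_in_disk zeta s0 t Hz) as [w Hw]; [unfold t; lra|].
exists w; apply (H' t); [unfold t; lra | exact Hw].
Qed.

(** * Limits and blow-up of the normalized kernel quotients *)

Definition kernel_ratio (a b w : Disk) : C :=
  ((1 - Cconj a * b) / RtoC (1 - Cmod w ^ 2))%C.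

Lemma kernel_ratio_ge (a b w : Disk) (B : R) :
  B * (1 - Cmod w ^ 2) <= Cmod (1 - Cconj a * b)%C -> B <= Cmod (kernel_ratio a b w).
Proof.
intros HB; generalize (disk_sq_pos w); intros Hx; unfold kernel_ratio.
assert (Hx0 : RtoC (1 - Cmod w ^ 2) <> 0%C)
  by (apply Cmod_gt_0; rewrite Cmod_R, Rabs_pos_eq; lra).
rewrite Cmod_div, Cmod_R, Rabs_pos_eq by (assumption || lra).
apply Rmult_le_reg_r with (1 := Hx).
unfold Rdiv; rewrite Rmult_assoc, Rinv_l, Rmult_1_r by lra; exact HB.
Qed.

Lemma kernel_ratio_same_D1 (phi psi : Disk -> Disk) (zeta : C) (d : C * C) (eps : R) :
  analytic (fun z => disk_val (phi z)) -> analytic (fun z => disk_val (psi z)) ->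
  has_D1 phi zeta d -> has_D1 psi zeta d -> 0 < eps ->
  segment_eventually zeta (fun w =>
    Cmod (kernel_ratio (phi w) (psi w) w - RtoC (Cmod (snd d)))%C < eps).
Proof.
intros Han Han' Hd Hd' He; exists 0; intros s _.
destruct (segment_kernel_quotient phi psi zeta d d s eps Han Han' Hd Hd' eq_refl He)
  as [t0 [T0 H]].
exists t0; split; [exact T0|]; intros t w Ht Hw; specialize (H t w Ht Hw).
unfold kernel_ratio; replace (RtoC (Cmod (snd d))) with
  ((Cconj (RtoC (Cmod (snd d)) * slope s) + RtoC (Cmod (snd d)) * slope s) / RtoC 2)%C;
  [exact H|].
(* For equal moduli the imaginary parts cancel, so the limit is the same on every segment. *)
unfold slope; apply injective_projections; simpl; field.
Qed.

(** Since |1 - conj(a) b|^2 >= (1 - |a|^2) (1 - |b|^2), the squared quotient dominates a product of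
    two ratios, one tending to infinity and the other at least c > 0. Hence the threshold B^2 /
    c. *)
Lemma kernel_ratio_not_in_F (phi psi : Disk -> Disk) (zeta : C) (B : R) :
  analytic (fun z => disk_val (phi z)) -> analytic (fun z => disk_val (psi z)) ->
  Cmod zeta = 1 -> 0 < B -> ~ in_F phi zeta \/ ~ in_F psi zeta ->
  segment_eventually zeta (fun w => B <= Cmod (kernel_ratio (phi w) (psi w) w)).
Proof.
intros Han Han' Hz HB Hor.
assert (Hprod : forall (a b w : Disk) (K c : R), 0 < c -> 0 < K -> K * c = B ^ 2 ->
  K * (1 - Cmod w ^ 2) * (c * (1 - Cmod w ^ 2)) <= (1 - Cmod a ^ 2) * (1 - Cmod b ^ 2) ->
  B <= Cmod (kernel_ratio a b w)).
{ intros a b w K c Hc HK HKc Hle; apply kernel_ratio_ge.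
  apply pow2_le_reg; [apply Cmod_ge_0|].
  rewrite Cmod_one_sub_conj_mul, Rpow_mult_distr, <- HKc.
  generalize (pow2_ge_0 (Cmod (b - a)%C)); lra. }
destruct Hor as [Hn|Hn].
- destruct (schwarz_pick_origin psi Han') as [c [Hc Hsp]].
  assert (HK : 0 < B ^ 2 / c) by (apply Rdiv_lt_0_compat; [apply pow_lt|]; lra).
  destruct (not_in_F_ratio phi zeta (B ^ 2 / c) Han Hz HK Hn) as [dl [Hdl Hr]].
  apply segment_eventually_imp with (2 := segment_eventually_near zeta dl Hz Hdl).
  intros w Hw; apply (Hprod _ _ _ (B ^ 2 / c) c); try assumption; [field; lra|].
  generalize (disk_sq_pos w); intros Hx.
  apply Rmult_le_compat; try (apply Rmult_le_pos; lra); [apply Rlt_le, Hr, Hw | apply Hsp].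
- destruct (schwarz_pick_origin phi Han) as [c [Hc Hsp]].
  assert (HK : 0 < B ^ 2 / c) by (apply Rdiv_lt_0_compat; [apply pow_lt|]; lra).
  destruct (not_in_F_ratio psi zeta (B ^ 2 / c) Han' Hz HK Hn) as [dl [Hdl Hr]].
  apply segment_eventually_imp with (2 := segment_eventually_near zeta dl Hz Hdl).
  intros w Hw; apply (Hprod _ _ _ c (B ^ 2 / c)); try assumption; [field; lra|].
  generalize (disk_sq_pos w); intros Hx.
  apply Rmult_le_compat; try (apply Rmult_le_pos; lra); [apply Hsp | apply Rlt_le, Hr, Hw].
Qed.

(** For a common boundary value the imaginary part s (b - a) / 2 of the limit grows with s. For
    different boundary values the numerator stays away from 0 while 1 - |w|^2 tends to 0. *)
Lemma kernel_ratio_diff_D1 (phi psi : Disk -> Disk) (zeta : C) (d d' : C * C) (B : R) :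
  analytic (fun z => disk_val (phi z)) -> analytic (fun z => disk_val (psi z)) ->
  has_D1 phi zeta d -> has_D1 psi zeta d' -> d <> d' -> 0 < B ->
  segment_eventually zeta (fun w => B <= Cmod (kernel_ratio (phi w) (psi w) w)).
Proof.
intros Han Han' Hd Hd' Hne HB.
assert (Hz : Cmod zeta = 1) by apply Hd.
assert (Hd0 : Cmod (fst d) = 1) by apply Hd.
destruct (excluded_middle_informative (fst d = fst d')) as [E|E].
- assert (Hab : Cmod (snd d) <> Cmod (snd d')).
  { intros Em; apply Hne; apply injective_projections; [exact E|].
    rewrite (D1_snd phi zeta d Han Hd), (D1_snd psi zeta d' Han' Hd'), E, Em.
    reflexivity. }
  set (k := Rabs (Cmod (snd d') - Cmod (snd d))).
  assert (Hk : 0 < k) by (apply Rabs_pos_lt; lra).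
  (* This makes the limit at least B + 1 in modulus; the extra 1 absorbs the error of the
     approximation. *)
  exists (2 * (B + 1) / k); intros s Hs.
  destruct (segment_kernel_quotient phi psi zeta d d' s 1 Han Han' Hd Hd' E)
    as [t0 [T0 H]]; [lra|].
  exists t0; split; [exact T0|]; intros t w Ht Hw; specialize (H t w Ht Hw).
  fold (kernel_ratio (phi w) (psi w) w) in H.
  set (l := ((Cconj (RtoC (Cmod (snd d)) * slope s) + RtoC (Cmod (snd d')) * slope s)
     / RtoC 2)%C) in *.
  assert (Hl : B + 1 <= Cmod l).
  { apply Rle_trans with (2 := Im_le_Cmod l).
    replace (Im l) with (s * (Cmod (snd d') - Cmod (snd d)) / 2)
      by (unfold l, slope, Im; simpl; field).
    assert (0 < 2 * (B + 1) / k) by (apply Rdiv_lt_0_compat; lra).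
    unfold Rdiv; rewrite !Rabs_mult; fold k; rewrite !Rabs_pos_eq by lra.
    apply Rle_trans with (2 * (B + 1) / k * k / 2); [right; field; lra|].
    unfold Rdiv; apply Rmult_le_compat_r; [lra|]; apply Rmult_le_compat_r; lra. }
  generalize (Cmod_sub_ge l (l - kernel_ratio (phi w) (psi w) w)%C).
  rewrite (Cmod_sub_sym l (kernel_ratio _ _ _)).
  replace (l - (l - kernel_ratio (phi w) (psi w) w))%C
    with (kernel_ratio (phi w) (psi w) w) by ring; lra.
- set (k := Cmod (fst d - fst d')%C).
  assert (Hk : 0 < k) by (apply Cmod_gt_0, Csub_neq0, E).
  (* The numerator is at least k - k/4 - k/4 = k/2, and B (1 - |w|^2) <= 2 B |w - zeta| <= k/2. *)
  assert (H0 : 0 < k / (4 * B)) by (apply Rdiv_lt_0_compat; lra).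
  apply segment_eventually_imp with
    (2 := segment_eventually_and _ _ _ (segment_eventually_near zeta _ Hz H0)
      (segment_eventually_and _ _ _
        (segment_eventually_nontangential zeta (fst d) (fun z => disk_val (phi z)) (k / 4) Hz
          (proj1 (proj2 Hd)) ltac:(lra))
        (segment_eventually_nontangential zeta (fst d') (fun z => disk_val (psi z)) (k / 4) Hz
          (proj1 (proj2 Hd')) ltac:(lra)))).
  intros w [Hw [H1 H2]]; apply kernel_ratio_ge.
  generalize (one_sub_Cmod_le zeta w Hz) (disk_lt1 w) (Cmod_ge_0 w); intros.
  assert (Hx : B * (1 - Cmod w ^ 2) <= k / 2).
  { apply Rle_trans with (B * (2 * (k / (4 * B)))); [|right; field; lra].
    apply Rmult_le_compat_l; nra. }
  apply Rle_trans with (1 := Hx).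
  generalize (Cmod_sub_ge (1 - Cconj (fst d) * fst d')%C
    (Cconj (phi w - fst d) * psi w + Cconj (fst d) * (psi w - fst d'))%C)
    (Cmod_triangle (Cconj (phi w - fst d) * psi w)%C (Cconj (fst d) * (psi w - fst d'))%C).
  replace (1 - Cconj (fst d) * fst d'
    - (Cconj (phi w - fst d) * psi w + Cconj (fst d) * (psi w - fst d')))%C
    with (1 - Cconj (phi w) * psi w)%C by (rewrite Cminus_conj; ring).
  rewrite Cmod_one_sub_conj_unit, !Cmod_mult, !Cmod_conj, Hd0 by exact Hd0; fold k.
  generalize (disk_lt1 (psi w)) (Cmod_ge_0 (psi w)) (Cmod_ge_0 (phi w - fst d)%C); nra.
Qed.

(** * Principal powers and the limit of the Gram matrix *)

Lemma Cmod_Cpower (v : C) (b : R) : Cmod (Cpower v b) = Rpower (Cmod v) b.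
Proof.
unfold Cpower; rewrite Cmod_mult, Cmod_R, Rabs_pos_eq by (apply Rlt_le, exp_pos).
rewrite <- (Rmult_1_r (Rpower (Cmod v) b)) at 2; f_equal.
unfold Cmod; simpl; rewrite !Rmult_1_r, Rplus_comm.
generalize (sin2_cos2 (b * atan (Im v / Re v))); unfold Rsqr; intros ->; apply sqrt_1.
Qed.

(** Division by a positive real preserves Im / Re, hence the argument, so this multiplicativity
    raises no question of branches. *)
Lemma Cpower_scale (u : C) (x b : R) :
  0 < x -> 0 < Re u ->
  (RtoC (Rpower x b) * Cpower u (- b) = Cpower (u / RtoC x) (- b))%C.
Proof.
intros Hx Hu.
assert (Hu0 : 0 < Cmod u) by (generalize (Re_le_Cmod u); lra).
assert (Hx0 : RtoC x <> 0%C) by (apply Cmod_gt_0; rewrite Cmod_R, Rabs_pos_eq; lra).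
assert (Em : Rpower (Cmod (u / RtoC x)%C) (- b) = Rpower x b * Rpower (Cmod u) (- b)).
{ rewrite Cmod_div, Cmod_R, Rabs_pos_eq by (assumption || lra); unfold Rdiv.
  rewrite <- Rpower_mult_distr by (assumption || apply Rinv_0_lt_compat, Hx).
  rewrite Rmult_comm; f_equal; unfold Rpower; f_equal; rewrite ln_Rinv by exact Hx; ring. }
assert (Ea : Im (u / RtoC x)%C / Re (u / RtoC x)%C = Im u / Re u).
{ unfold Cdiv; rewrite <- RtoC_inv, re_scal_r by lra.
  replace (Im (u * RtoC (/ x))%C) with (Im u * / x)
    by (rewrite im_mult, re_RtoC; simpl; ring).
  field; lra. }
unfold Cpower; rewrite Ea, Em, RtoC_mult; ring.
Qed.

Lemma continuity_pt_eps (f : R -> R) (x eps : R) :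
  continuity_pt f x -> 0 < eps -> exists delta, 0 < delta /\
    forall y, Rabs (y - x) < delta -> Rabs (f y - f x) < eps.
Proof.
intros Hf He; destruct (Hf eps He) as [d [Hd H]]; exists d; split; [exact Hd|].
intros y Hy; destruct (Req_dec y x) as [->|Hne].
- now rewrite Rminus_diag, Rabs_R0.
- apply H; split; [split; [exact I | auto] | exact Hy].
Qed.

Lemma Cpower_continuous_pos (a b eps : R) :
  0 < a -> 0 < eps -> exists delta, 0 < delta /\
    forall v, Cmod (v - RtoC a)%C < delta ->
      Cmod (Cpower v b - RtoC (Rpower a b))%C < eps.
Proof.
intros Ha He.
set (A := Rpower a b); assert (HA : 0 < A) by apply exp_pos.
assert (He3 : 0 < eps / (3 * A)) by (apply Rdiv_lt_0_compat; lra).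
destruct (continuity_pt_eps (fun x => Rpower x b) a (eps / 3)) as [d1 [Hd1 H1]]; [|lra|].
{ apply continuity_pt_filterlim, (ex_derive_continuous (fun x => Rpower x b)).
  unfold Rpower; auto_derive; exact Ha. }
destruct (continuity_pt_eps (fun r => cos (b * atan r)) 0 (eps / (3 * A))) as [d2 [Hd2 H2]];
  [|exact He3|].
{ apply continuity_pt_filterlim, (ex_derive_continuous (fun r => cos (b * atan r))).
  auto_derive; exact I. }
destruct (continuity_pt_eps (fun r => sin (b * atan r)) 0 (eps / (3 * A))) as [d3 [Hd3 H3]];
  [|exact He3|].
{ apply continuity_pt_filterlim, (ex_derive_continuous (fun r => sin (b * atan r))).
  auto_derive; exact I. }
rewrite atan_0, Rmult_0_r, cos_0 in H2; rewrite atan_0, Rmult_0_r, sin_0 in H3.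
set (m := Rmin d2 d3); assert (Hm : 0 < m) by (apply Rmin_glb_lt; assumption).
(* The bound a/2 keeps Re v > a/2, which turns |Im v| < m a/2 into |Im v / Re v| < m. The error eps
   is shared equally by modulus, cosine and sine. *)
exists (Rmin d1 (Rmin (a / 2) (m * (a / 2)))); split.
{ repeat apply Rmin_glb_lt; try lra; nra. }
intros v Hv.
generalize (Rmin_l d1 (Rmin (a / 2) (m * (a / 2)))) (Rmin_r d1 (Rmin (a / 2) (m * (a / 2))))
  (Rmin_l (a / 2) (m * (a / 2))) (Rmin_r (a / 2) (m * (a / 2)))
  (Rmin_l d2 d3 : m <= d2) (Rmin_r d2 d3 : m <= d3); intros.
assert (Hmod : Rabs (Cmod v - a) < d1).
{ assert (Ea : Cmod (RtoC a) = a) by (rewrite Cmod_R; apply Rabs_pos_eq; lra).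
  generalize (Cmod_sub_ge v (RtoC a)) (Cmod_sub_ge (RtoC a) v).
  rewrite (Cmod_sub_sym (RtoC a) v), Ea; intros; apply Rabs_def1; lra. }
assert (Hre : a / 2 < Re v).
{ generalize (Re_le_Cmod (RtoC a - v)%C); rewrite Cmod_sub_sym; unfold Cminus at 1.
  rewrite re_plus, re_opp, re_RtoC; lra. }
assert (Him : Rabs (Im v) < m * (a / 2)).
{ apply Rle_lt_trans with (Cmod (v - RtoC a)%C); [|lra].
  replace (Im v) with (Im (v - RtoC a)%C)
    by (destruct v; unfold Im; simpl; ring).
  apply Im_le_Cmod. }
set (r := Im v / Re v).
assert (Hr : Rabs r < m).
{ unfold r, Rdiv; rewrite Rabs_mult, Rabs_inv, (Rabs_pos_eq (Re v)) by lra.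
  apply Rmult_lt_reg_r with (Re v); [lra|].
  rewrite Rmult_assoc, Rinv_l, Rmult_1_r by lra; nra. }
specialize (H1 _ Hmod); specialize (H2 r); specialize (H3 r).
rewrite Rminus_0_r in H2, H3; specialize (H2 ltac:(lra)); specialize (H3 ltac:(lra)).
unfold Cpower; fold r.
set (ph := (cos (b * atan r), sin (b * atan r)) : C).
replace (RtoC (Rpower (Cmod v) b) * ph - RtoC A)%C
  with (RtoC (Rpower (Cmod v) b - A) * ph + RtoC A * (ph - 1))%C
  by (rewrite RtoC_minus; ring).
eapply Rle_lt_trans; [apply Cmod_triangle|]; rewrite !Cmod_mult, !Cmod_R.
assert (Hph : Cmod ph = 1).
{ unfold Cmod, ph; simpl; rewrite !Rmult_1_r, Rplus_comm.
  generalize (sin2_cos2 (b * atan r)); unfold Rsqr; intros ->; apply sqrt_1. }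
assert (Hph1 : Cmod (ph - 1)%C < 2 * (eps / (3 * A))).
{ apply Rle_lt_trans with (1 := Cmod_le_Re_Im _).
  replace (Re (ph - 1)%C) with (cos (b * atan r) - 1) by (unfold ph, Re; simpl; ring).
  replace (Im (ph - 1)%C) with (sin (b * atan r)) by (unfold ph, Im; simpl; ring).
  rewrite Rminus_0_r in H3; lra. }
rewrite Hph, (Rabs_pos_eq A) by lra; fold A in H1.
apply Rlt_le_trans with (eps / 3 * 1 + A * (2 * (eps / (3 * A)))).
- apply Rplus_lt_compat; [lra | apply Rmult_lt_compat_l; assumption].
- right; field; lra.
Qed.

Lemma Rpower_neg_le_inv (x b : R) : 1 <= x -> 1 <= b -> Rpower x (- b) <= / x.
Proof.
intros Hx Hb; rewrite <- (Rpower_1 x) at 2 by lra.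
rewrite <- Rpower_Ropp; apply Rle_Rpower; lra.
Qed.

Lemma Re_one_sub_conj_mul_pos (a b : Disk) : 0 < Re (1 - Cconj a * b)%C.
Proof.
unfold Cminus; rewrite re_plus, re_opp, re_RtoC.
generalize (Re_le_Cmod (Cconj a * b)%C); rewrite Cmod_mult, Cmod_conj.
generalize (disk_lt1 a) (disk_lt1 b) (Cmod_ge_0 a) (Cmod_ge_0 b); nra.
Qed.

(** The scaling factor is 1 / |k_w|^2, so these are the entries of the normalized quadratic form. *)
Lemma kernel_scaled (beta : R) (a b w : Disk) :
  (RtoC (Rpower (1 - Cmod w ^ 2) beta) * kernel beta a b)%C
  = Cpower (kernel_ratio a b w) (- beta).
Proof.
apply Cpower_scale; [apply disk_sq_pos | apply Re_one_sub_conj_mul_pos].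
Qed.

Lemma gram_limit (beta : R) (zeta : C) (n : nat) (phi : nat -> Disk -> Disk) (eps : R) :
  1 <= beta -> Cmod zeta = 1 ->
  (forall j, (j < n)%nat -> analytic (fun z => disk_val (phi j z))) -> 0 < eps ->
  segment_eventually zeta (fun w => forall i, (i < n)%nat -> forall j, (j < n)%nat ->
    let k := (RtoC (Rpower (1 - Cmod w ^ 2) beta) * kernel beta (phi i w) (phi j w))%C in
    (forall d, has_D1 (phi i) zeta d -> has_D1 (phi j) zeta d ->
       Cmod (k - RtoC (Rpower (Cmod (snd d)) (- beta)))%C < eps) /\
    ((forall d, ~ (has_D1 (phi i) zeta d /\ has_D1 (phi j) zeta d)) -> Cmod k < eps)).
Proof.
intros Hb Hz Han He.
apply (segment_eventually_forall zeta n (fun i w => forall j, (j < n)%nat ->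
    let k := (RtoC (Rpower (1 - Cmod w ^ 2) beta) * kernel beta (phi i w) (phi j w))%C in
    (forall d, has_D1 (phi i) zeta d -> has_D1 (phi j) zeta d ->
       Cmod (k - RtoC (Rpower (Cmod (snd d)) (- beta)))%C < eps) /\
    ((forall d, ~ (has_D1 (phi i) zeta d /\ has_D1 (phi j) zeta d)) -> Cmod k < eps))).
intros i Hi.
apply (segment_eventually_forall zeta n (fun j w =>
    let k := (RtoC (Rpower (1 - Cmod w ^ 2) beta) * kernel beta (phi i w) (phi j w))%C in
    (forall d, has_D1 (phi i) zeta d -> has_D1 (phi j) zeta d ->
       Cmod (k - RtoC (Rpower (Cmod (snd d)) (- beta)))%C < eps) /\
    ((forall d, ~ (has_D1 (phi i) zeta d /\ has_D1 (phi j) zeta d)) -> Cmod k < eps))).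
intros j Hj; cbv zeta.
destruct (classic (exists d, has_D1 (phi i) zeta d /\ has_D1 (phi j) zeta d))
  as [[d [Hdi Hdj]]|Hn].
- destruct (Cpower_continuous_pos (Cmod (snd d)) (- beta) eps
    (proj2 (D1_pos _ _ _ (Han i Hi) Hdi)) He) as [dl [Hdl HC]].
  apply segment_eventually_imp with
    (2 := kernel_ratio_same_D1 _ _ _ _ _ (Han i Hi) (Han j Hj) Hdi Hdj Hdl).
  intros w Hw; rewrite kernel_scaled; split.
  + intros d' Hd' _; rewrite (has_D1_unique _ _ _ _ Hd' Hdi); apply HC, Hw.
  + intros Hno; exfalso; apply (Hno d); auto.
(* A quotient of modulus at least 1 has its power -beta bounded by its inverse; 2 / eps then gives
   eps / 2. *)
- set (B := Rmax 1 (2 / eps)).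
  assert (HB1 : 1 <= B) by apply Rmax_l; assert (HB2 : 2 / eps <= B) by apply Rmax_r.
  assert (He2 : 0 < 2 / eps) by (apply Rdiv_lt_0_compat; lra).
  assert (Hlarge : segment_eventually zeta
    (fun w => B <= Cmod (kernel_ratio (phi i w) (phi j w) w))).
  { destruct (classic (in_F (phi i) zeta)) as [[d Hd]|Hni];
      [|apply kernel_ratio_not_in_F; auto; lra].
    destruct (classic (in_F (phi j) zeta)) as [[d' Hd']|Hnj];
      [|apply kernel_ratio_not_in_F; auto; lra].
    apply (kernel_ratio_diff_D1 _ _ _ d d'); auto; [|lra].
    intros ->; apply Hn; exists d'; auto. }
  apply segment_eventually_imp with (2 := Hlarge).
  intros w Hw; rewrite kernel_scaled; split.
  + intros d Hd Hd'; exfalso; apply Hn; exists d; auto.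
  + intros _; rewrite Cmod_Cpower.
    apply Rle_lt_trans with (/ Cmod (kernel_ratio (phi i w) (phi j w) w)).
    { apply Rpower_neg_le_inv; lra. }
    apply Rle_lt_trans with (/ (2 / eps)); [apply Rinv_le_contravar; lra|].
    replace (/ (2 / eps)) with (eps / 2) by (field; lra); lra.
Qed.

(** * Hilbert space geometry of the kernel functions *)

Lemma fsub_fadd (f g : Disk -> C) : fsub f g = fadd f (fscal (- (1))%C g).
Proof. apply functional_extensionality; intros z; unfold fsub, fadd, fscal; ring. Qed.

Lemma carrier_sub (beta : R) (H : Dspace beta) (f g : Disk -> C) :
  carrier H f -> carrier H g -> carrier H (fsub f g).
Proof.
intros Hf Hg; rewrite fsub_fadd; apply carrier_add; [|apply carrier_scal]; assumption.
Qed.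

Lemma inner_add_r (beta : R) (H : Dspace beta) (f g h : Disk -> C) :
  carrier H f -> carrier H g -> carrier H h ->
  inner H h (fadd f g) = (inner H h f + inner H h g)%C.
Proof.
intros Hf Hg Hh.
rewrite (inner_conj beta H (fadd f g) h), inner_add_l, Cplus_conj,
  <- !inner_conj by (try apply carrier_add; assumption).
reflexivity.
Qed.

Lemma inner_scal_r (beta : R) (H : Dspace beta) (a : C) (f h : Disk -> C) :
  carrier H f -> carrier H h -> inner H h (fscal a f) = (Cconj a * inner H h f)%C.
Proof.
intros Hf Hh.
rewrite (inner_conj beta H (fscal a f) h), inner_scal_l, Cmult_conj,
  <- !inner_conj by (try apply carrier_scal; assumption).
reflexivity.
Qed.

Lemma inner_zero_r (beta : R) (H : Dspace beta) (f : Disk -> C) :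
  carrier H f -> inner H f (fun _ => RtoC 0) = RtoC 0.
Proof.
intros Hf.
replace (fun _ : Disk => RtoC 0) with (fscal 0 (fun _ : Disk => RtoC 0)).
- rewrite inner_scal_r; [|apply carrier_zero | exact Hf].
  replace (Cconj 0) with (RtoC 0) by (apply injective_projections; simpl; ring); ring.
- apply functional_extensionality; intros z; unfold fscal; ring.
Qed.

Lemma hnorm_ge_0 (beta : R) (H : Dspace beta) (f : Disk -> C) : 0 <= hnorm H f.
Proof. apply sqrt_pos. Qed.

Lemma hnorm_sq (beta : R) (H : Dspace beta) (f : Disk -> C) :
  carrier H f -> hnorm H f ^ 2 = Re (inner H f f).
Proof. intros Hf; apply pow2_sqrt, inner_pos, Hf. Qed.

Lemma inner_self (beta : R) (H : Dspace beta) (f : Disk -> C) :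
  carrier H f -> inner H f f = RtoC (hnorm H f ^ 2).
Proof.
intros Hf; rewrite hnorm_sq by exact Hf.
assert (E := inner_conj beta H f f Hf Hf).
apply (f_equal Im) in E; rewrite im_conj in E.
apply injective_projections; [reflexivity|]; simpl; unfold Im in E; lra.
Qed.

Lemma hnorm_add_scal_sq (beta : R) (H : Dspace beta) (a : C) (f g : Disk -> C) :
  carrier H f -> carrier H g ->
  hnorm H (fadd f (fscal a g)) ^ 2
  = hnorm H f ^ 2 + 2 * Re (Cconj a * inner H f g)%C + Cmod a ^ 2 * hnorm H g ^ 2.
Proof.
intros Hf Hg; assert (Hag := carrier_scal beta H a g Hg).
rewrite hnorm_sq by (apply carrier_add; assumption).
rewrite inner_add_l, !inner_add_r, inner_scal_l, inner_scal_r, inner_scal_l, inner_scal_r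
  by (try apply carrier_add; assumption).
rewrite !inner_self, (inner_conj beta H f g) by assumption.
rewrite Cmod2_alt; destruct a, (inner H f g); unfold Re, Im; simpl; ring.
Qed.

Lemma hnorm_scal (beta : R) (H : Dspace beta) (a : C) (f : Disk -> C) :
  carrier H f -> hnorm H (fscal a f) = Cmod a * hnorm H f.
Proof.
intros Hf; unfold hnorm at 1.
rewrite inner_scal_l, inner_scal_r, inner_self by (try apply carrier_scal; assumption).
replace (Re (a * (Cconj a * RtoC (hnorm H f ^ 2)))%C) with ((Cmod a * hnorm H f) ^ 2).
- apply sqrt_pow2, Rmult_le_pos; [apply Cmod_ge_0 | apply hnorm_ge_0].
- rewrite Rpow_mult_distr, Cmod2_alt; destruct a; unfold Re, Im; simpl; ring.
Qed.

Lemma cauchy_schwarz (beta : R) (H : Dspace beta) (f g : Disk -> C) :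
  carrier H f -> carrier H g -> Cmod (inner H f g) <= hnorm H f * hnorm H g.
Proof.
intros Hf Hg; generalize (hnorm_ge_0 beta H f) (hnorm_ge_0 beta H g); intros Pf Pg.
destruct (Req_dec (hnorm H g) 0) as [Eg|Eg].
- assert (E0 : g = fun _ => RtoC 0).
  { apply functional_extensionality; apply (inner_def beta H); [exact Hg|].
    rewrite inner_self, Eg by exact Hg; f_equal; ring. }
  rewrite Eg, E0, inner_zero_r, Cmod_0 by exact Hf; lra.
- assert (Hg0 : 0 < hnorm H g ^ 2) by (apply pow_lt; lra).
  set (i := inner H f g).
  assert (E := hnorm_add_scal_sq beta H (- (i * RtoC (/ hnorm H g ^ 2)))%C f g Hf Hg).
  fold i in E.
  replace (Re (Cconj (- (i * RtoC (/ hnorm H g ^ 2))) * i)%C)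
    with (- (Cmod i ^ 2 / hnorm H g ^ 2)) in E
    by (rewrite Cmod2_alt; destruct i; unfold Re, Im; simpl; field; exact Eg).
  rewrite Cmod_opp, Cmod_mult, Cmod_R, Rabs_pos_eq in E
    by (apply Rlt_le, Rinv_0_lt_compat, Hg0).
  replace ((Cmod i * / hnorm H g ^ 2) ^ 2 * hnorm H g ^ 2)
    with (Cmod i ^ 2 / hnorm H g ^ 2) in E by (field; exact Eg).
  assert (H0 := pow2_ge_0 (hnorm H (fadd f (fscal (- (i * RtoC (/ hnorm H g ^ 2))) g)))).
  rewrite E in H0.
  apply pow2_le_reg; [apply Rmult_le_pos; assumption|].
  rewrite Rpow_mult_distr.
  assert (Hd : Cmod i ^ 2 / hnorm H g ^ 2 <= hnorm H f ^ 2) by lra.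
  apply Rmult_le_compat_r with (r := hnorm H g ^ 2) in Hd; [|lra].
  replace (Cmod i ^ 2 / hnorm H g ^ 2 * hnorm H g ^ 2) with (Cmod i ^ 2) in Hd
    by (field; exact Eg).
  exact Hd.
Qed.

Lemma kernel_self (beta : R) (w : Disk) :
  kernel beta w w = RtoC (Rpower (1 - Cmod w ^ 2) (- beta)).
Proof.
unfold kernel; replace (1 - Cconj w * w)%C with (RtoC (1 - Cmod w ^ 2))
  by (rewrite RtoC_minus, Cmod2_conj; ring).
unfold Cpower; rewrite Cmod_R, Rabs_pos_eq by (apply Rlt_le, disk_sq_pos).
simpl Im; unfold Rdiv; rewrite Rmult_0_l, atan_0, Rmult_0_r, cos_0, sin_0.
apply injective_projections; simpl; ring.
Qed.

Lemma hnorm_kernel_sq (beta : R) (H : Dspace beta) (w : Disk) :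
  hnorm H (kernel beta w) ^ 2 = Rpower (1 - Cmod w ^ 2) (- beta).
Proof.
rewrite hnorm_sq, reproducing, kernel_self by apply kernel_carrier; reflexivity.
Qed.

Lemma hnorm_kernel_pos (beta : R) (H : Dspace beta) (w : Disk) :
  0 < hnorm H (kernel beta w).
Proof.
generalize (hnorm_ge_0 beta H (kernel beta w)) (hnorm_kernel_sq beta H w); intros H0 E.
assert (0 < Rpower (1 - Cmod w ^ 2) (- beta)) by apply exp_pos.
destruct H0 as [H0|H0]; [exact H0|]; rewrite <- H0 in E; lra.
Qed.

Lemma eval_le (beta : R) (H : Dspace beta) (f : Disk -> C) (w : Disk) :
  carrier H f -> Cmod (f w) <= hnorm H f * hnorm H (kernel beta w).
Proof.
intros Hf; rewrite <- (reproducing beta H f w Hf) at 1.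
apply cauchy_schwarz; [exact Hf | apply kernel_carrier].
Qed.

(** * Weak decay of the normalized kernels *)

Lemma hnorm_kernel_large (beta : R) (H : Dspace beta) (zeta : C) (B : R) :
  1 <= beta -> Cmod zeta = 1 -> 0 < B ->
  exists delta, 0 < delta /\ forall w : Disk, Cmod (w - zeta)%C < delta ->
    B <= hnorm H (kernel beta w).
Proof.
intros Hb Hz HB; assert (HB2 : 0 < B ^ 2) by (apply pow_lt, HB).
exists (/ (2 * B ^ 2)); split; [apply Rinv_0_lt_compat; lra|].
intros w Hw; apply pow2_le_reg; [apply hnorm_ge_0|]; rewrite hnorm_kernel_sq.
generalize (disk_sq_pos w) (one_sub_Cmod_le zeta w Hz) (Cmod_ge_0 w) (disk_lt1 w); intros Hx.
set (x := 1 - Cmod w ^ 2) in *; intros.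
assert (Hx1 : x <= / B ^ 2).
{ replace (/ B ^ 2) with (2 * / (2 * B ^ 2)) by (field; lra); unfold x; nra. }
assert (Hx2 : x <= 1) by (unfold x; generalize (pow2_ge_0 (Cmod w)); lra).
apply Rle_trans with (/ x).
- rewrite <- (Rinv_inv (B ^ 2)); apply Rinv_le_contravar; assumption.
- replace (Rpower x (- beta)) with (Rpower (/ x) beta)
    by (unfold Rpower; f_equal; rewrite ln_Rinv by exact Hx; ring).
  rewrite <- (Rpower_1 (/ x)) at 1 by (apply Rinv_0_lt_compat, Hx).
  apply Rle_Rpower; [|exact Hb].
  rewrite <- Rinv_1; apply Rinv_le_contravar; assumption.
Qed.

(** For f in the space, f(w) / |k_w| is the inner product of f with the normalized kernel at w, so
    this is weak convergence to 0 tested on f. *)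
Definition kernel_negligible (beta : R) (H : Dspace beta) (zeta : C) (f : Disk -> C) : Prop :=
  forall eps, 0 < eps -> exists delta, 0 < delta /\ forall w : Disk,
    Cmod (w - zeta)%C < delta -> Cmod (f w) <= eps * hnorm H (kernel beta w).

Lemma bounded_negligible (beta : R) (H : Dspace beta) (zeta : C) (f : Disk -> C) (B : R) :
  1 <= beta -> Cmod zeta = 1 -> (forall w, Cmod (f w) <= B) ->
  kernel_negligible beta H zeta f.
Proof.
intros Hb Hz HB eps He.
destruct (hnorm_kernel_large beta H zeta ((Rabs B + 1) / eps) Hb Hz) as [d [Hd Hd']].
{ apply Rdiv_lt_0_compat; [generalize (Rabs_pos B); lra | exact He]. }
exists d; split; [exact Hd|]; intros w Hw; specialize (Hd' w Hw).
apply Rle_trans with (1 := HB w), Rle_trans with (Rabs B + 1).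
- generalize (Rle_abs B); lra.
- apply Rle_trans with (eps * ((Rabs B + 1) / eps)); [right; field; lra|].
  apply Rmult_le_compat_l; lra.
Qed.

Lemma kernel_bounded (beta : R) (v : Disk) :
  0 <= beta -> forall w, Cmod (kernel beta v w) <= Rpower (1 - Cmod v) (- beta).
Proof.
intros Hb w; unfold kernel; rewrite Cmod_Cpower, !Rpower_Ropp.
generalize (disk_lt1 v) (disk_lt1 w) (Cmod_ge_0 v) (Cmod_ge_0 w); intros.
apply Rinv_le_contravar; [apply exp_pos|].
apply Rle_Rpower_l; [exact Hb|]; split; [lra|].
generalize (Cmod_sub_ge 1 (Cconj v * w)%C); rewrite Cmod_1, Cmod_mult, Cmod_conj; nra.
Qed.

Lemma negligible_add_scal (beta : R) (H : Dspace beta) (zeta a : C) (f g : Disk -> C) :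
  kernel_negligible beta H zeta f -> kernel_negligible beta H zeta g ->
  kernel_negligible beta H zeta (fadd f (fscal a g)).
Proof.
intros Hf Hg eps He; assert (Ha := Cmod_ge_0 a).
destruct (Hf (eps / 2)) as [d1 [Hd1 H1]]; [lra|].
destruct (Hg (eps / (2 * (Cmod a + 1)))) as [d2 [Hd2 H2]]; [apply Rdiv_lt_0_compat; lra|].
exists (Rmin d1 d2); split; [apply Rmin_glb_lt; assumption|]; intros w Hw.
generalize (Rmin_l d1 d2) (Rmin_r d1 d2); intros.
specialize (H1 w ltac:(lra)); specialize (H2 w ltac:(lra)).
unfold fadd, fscal; eapply Rle_trans; [apply Cmod_triangle|]; rewrite Cmod_mult.
assert (P := hnorm_kernel_pos beta H w).
assert (Cmod a * Cmod (g w) <= eps / 2 * hnorm H (kernel beta w)); [|lra].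
apply Rle_trans with
  ((Cmod a + 1) * (eps / (2 * (Cmod a + 1)) * hnorm H (kernel beta w))).
- apply Rmult_le_compat; try apply Cmod_ge_0; lra.
- right; field; lra.
Qed.

(* If h(w) / |k_w| did not tend to 0, one could pick arbitrarily many almost
   orthogonal normalized kernels whose inner products with h are at least eps. *)
Lemma carrier_negligible (beta : R) (H : Dspace beta) (zeta : C) (h : Disk -> C) :
  1 <= beta -> Cmod zeta = 1 -> carrier H h -> kernel_negligible beta H zeta h.
Proof.
intros Hb Hz Hh eps He; apply NNPP; intros Hn.
assert (Hpick : forall delta, 0 < delta -> exists w : Disk, Cmod (w - zeta)%C < delta /\
  eps * hnorm H (kernel beta w) < Cmod (h w)).
{ intros delta Hd; apply NNPP; intros Hw; apply Hn; exists delta; split; [exact Hd|].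
  intros w Hwd; apply Rnot_lt_le; intros Hlt; apply Hw; exists w; auto. }
(* Each step adds a unit vector: 1 for its squared norm and at most 1 for the cross term, hence 2 N.
   Negligibility of f is carried along to make the next cross term small. *)
assert (Hclaim : forall N : nat, exists f, carrier H f /\ kernel_negligible beta H zeta f /\
  hnorm H f ^ 2 <= 2 * INR N /\ INR N * eps <= Re (inner H h f)).
{ induction N as [|N [f [Cf [Vf [Nf If]]]]].
  - exists (fun _ => RtoC 0); split; [apply carrier_zero|]; split; [|split].
    + apply (bounded_negligible beta H zeta _ 0 Hb Hz); intros w; rewrite Cmod_0; lra.
    + rewrite hnorm_sq, inner_zero_r by apply carrier_zero; simpl; lra.
    + rewrite inner_zero_r by exact Hh; simpl; lra.
  - destruct (Vf (1 / 2)) as [d [Hd Hd']]; [lra|].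
    destruct (Hpick d Hd) as [w [Hw Hhw]]; specialize (Hd' w Hw).
    assert (P := hnorm_kernel_pos beta H w).
    set (k := hnorm H (kernel beta w)) in *.
    assert (Hhw0 : 0 < Cmod (h w)) by nra.
    (* The phase of h(w) divided by |k_w|: the new vector is normalized, and its inner product with
       h is |h(w)| / |k_w| > eps. *)
    set (a := (h w * RtoC (/ (Cmod (h w) * k)))%C).
    assert (Hck : carrier H (kernel beta w)) by apply kernel_carrier.
    assert (Hai : 0 < / (Cmod (h w) * k)) by (apply Rinv_0_lt_compat; nra).
    assert (Ha : Cmod a = / k).
    { unfold a; rewrite Cmod_mult, Cmod_R, Rabs_pos_eq by lra; field; lra. }
    exists (fadd f (fscal a (kernel beta w))); split; [|split; [|split]].
    + apply carrier_add; [|apply carrier_scal]; assumption.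
    + apply negligible_add_scal; [exact Vf|].
      apply (bounded_negligible beta H zeta _ (Rpower (1 - Cmod w) (- beta)) Hb Hz).
      apply kernel_bounded; lra.
    + rewrite hnorm_add_scal_sq, reproducing, Ha by assumption; fold k.
      replace ((/ k) ^ 2 * k ^ 2) with 1 by (field; lra).
      assert (Re (Cconj a * f w)%C <= 1 / 2).
      { apply Rle_trans with (1 := Re_le_Cmod _).
        rewrite Cmod_mult, Cmod_conj, Ha.
        apply Rle_trans with (/ k * (1 / 2 * k)); [|right; field; lra].
        apply Rmult_le_compat_l; [apply Rlt_le, Rinv_0_lt_compat, P | exact Hd']. }
      rewrite S_INR; lra.
    + rewrite inner_add_r, inner_scal_r, reproducing by (try apply carrier_scal; assumption).
      rewrite re_plus, S_INR.
      replace (Re (Cconj a * h w)%C) with (Cmod (h w) / k).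
      * assert (eps <= Cmod (h w) / k); [|lra].
        apply Rmult_le_reg_r with (1 := P).
        replace (Cmod (h w) / k * k) with (Cmod (h w)) by (field; lra); lra.
      * unfold a; rewrite Cmult_conj.
        replace (Cconj (h w) * Cconj (RtoC (/ (Cmod (h w) * k))) * h w)%C
          with (RtoC (/ (Cmod (h w) * k)) * (h w * Cconj (h w)))%C
          by (replace (Cconj (RtoC (/ (Cmod (h w) * k)))) with (RtoC (/ (Cmod (h w) * k)))
                by (apply injective_projections; simpl; ring); ring).
        rewrite <- Cmod2_conj, re_scal_l, re_RtoC; field; lra. }
(* Cauchy-Schwarz gives (N eps)^2 <= 2 N |h|^2, which fails for this N. *)
destruct (INR_unbounded (2 * hnorm H h ^ 2 / eps ^ 2)) as [N HN].
assert (He2 : 0 < eps ^ 2) by (apply pow_lt, He).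
assert (HN0 : 0 < INR N).
{ apply Rle_lt_trans with (2 := HN); apply Rmult_le_pos;
    [generalize (pow2_ge_0 (hnorm H h)); lra | apply Rlt_le, Rinv_0_lt_compat, He2]. }
destruct (Hclaim N) as [f [Cf [_ [Nf If]]]].
assert (Hle : INR N * eps <= hnorm H h * hnorm H f).
{ apply Rle_trans with (1 := If), Rle_trans with (1 := Re_le_Cmod _).
  apply cauchy_schwarz; assumption. }
assert (Hsq : (INR N * eps) ^ 2 <= (hnorm H h * hnorm H f) ^ 2)
  by (apply pow_incr; split; [apply Rmult_le_pos; lra | exact Hle]).
rewrite !Rpow_mult_distr in Hsq.
assert (Hsq2 : hnorm H h ^ 2 * hnorm H f ^ 2 <= hnorm H h ^ 2 * (2 * INR N))
  by (apply Rmult_le_compat_l; [apply pow2_ge_0 | exact Nf]).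
assert (HN' : 2 * hnorm H h ^ 2 < INR N * eps ^ 2).
{ apply Rle_lt_trans with (2 * hnorm H h ^ 2 / eps ^ 2 * eps ^ 2);
    [right; field; lra | apply Rmult_lt_compat_r; assumption]. }
nra.
Qed.

(** * The adjoint of a combination of composition operators on kernels *)

(** Convertible with [list_sum] at C, but written with the operations that [ring] recognizes. *)
Definition Csum {A : Type} (l : list A) (f : A -> C) : C :=
  fold_right (fun x s => f x + s)%C (RtoC 0) l.

(* T* k_w for T = sum_j c_j C_(phi_j). *)
Definition adjoint_kernel (beta : R) (l : list nat) (c : nat -> C)
    (phi : nat -> Disk -> Disk) (w : Disk) : Disk -> C :=
  fun z => Csum l (fun i => Cconj (c i) * kernel beta (phi i w) z)%C.

(** By the reproducing property the right-hand side is (T f)(w), so T* k_w is available explicitly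
    and T* itself need not be constructed. *)
Lemma adjoint_kernel_spec (beta : R) (H : Dspace beta) (l : list nat) (c : nat -> C)
    (phi : nat -> Disk -> Disk) (w : Disk) :
  carrier H (adjoint_kernel beta l c phi w) /\
  forall f, carrier H f ->
    inner H f (adjoint_kernel beta l c phi w) = Csum l (fun j => c j * f (phi j w))%C.
Proof.
induction l as [|j l [IHc IHi]].
- split; [apply carrier_zero | intros f Hf; apply inner_zero_r, Hf].
- assert (E : adjoint_kernel beta (j :: l) c phi w
    = fadd (fscal (Cconj (c j)) (kernel beta (phi j w))) (adjoint_kernel beta l c phi w))
    by reflexivity.
  assert (Hk := carrier_scal beta H (Cconj (c j)) _ (kernel_carrier beta H (phi j w))).
  rewrite E; split; [apply carrier_add; assumption|].
  intros f Hf; rewrite inner_add_r, inner_scal_r, reproducing, IHi, Cconj_conj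
    by (assumption || apply kernel_carrier); reflexivity.
Qed.

Lemma adjoint_kernel_bound (beta : R) (H : Dspace beta) (n : nat) (c : nat -> C)
    (phi : nat -> Disk -> Disk) (zeta : C) (K : operator) (M eps : R) :
  1 <= beta -> Cmod zeta = 1 -> compact_operator H K -> 0 <= M ->
  (forall f, carrier H f ->
     carrier H (fsub (lin_comb n c (fun j => comp_op (phi j)) f) (K f)) /\
     hnorm H (fsub (lin_comb n c (fun j => comp_op (phi j)) f) (K f)) <= M * hnorm H f) ->
  0 < eps ->
  exists delta, 0 < delta /\ forall w : Disk, Cmod (w - zeta)%C < delta ->
    hnorm H (adjoint_kernel beta (seq 0 n) c phi w)
    <= (M + eps) * hnorm H (kernel beta w).
Proof.
intros Hb Hz [HKc [_ [_ HKs]]] HM HS He; apply NNPP; intros Hn.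
set (g := adjoint_kernel beta (seq 0 n) c phi).
assert (Cg : forall w, carrier H (g w)) by (intros w; apply adjoint_kernel_spec).
set (T := lin_comb n c (fun j => comp_op (phi j))) in *.
assert (HT : forall f w, carrier H f -> inner H f (g w) = T f w).
{ intros f w Hf; exact (proj2 (adjoint_kernel_spec beta H (seq 0 n) c phi w) f Hf). }
destruct (choice (fun (m : nat) (w : Disk) => Cmod (w - zeta)%C < / (INR m + 1) /\
    (M + eps) * hnorm H (kernel beta w) < hnorm H (g w))) as [w Hw].
{ intros m; apply NNPP; intros Hm; apply Hn; exists (/ (INR m + 1)); split.
  - apply Rinv_0_lt_compat; generalize (pos_INR m); lra.
  - intros w Hw; apply Rnot_lt_le; intros Hlt; apply Hm; exists w; auto. }
assert (Pg : forall m, 0 < hnorm H (g (w m))).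
{ intros m; apply Rlt_trans with (2 := proj2 (Hw m)).
  apply Rmult_lt_0_compat; [lra | apply hnorm_kernel_pos]. }
set (u := fun m => fscal (RtoC (/ hnorm H (g (w m)))) (g (w m))).
assert (Cu : forall m, carrier H (u m)) by (intros m; apply carrier_scal, Cg).
assert (Nu : forall m, hnorm H (u m) = 1).
{ intros m; unfold u; rewrite hnorm_scal, Cmod_R, Rabs_pos_eq by
    (apply Cg || apply Rlt_le, Rinv_0_lt_compat, Pg).
  apply Rinv_l, Rgt_not_eq, Pg. }
destruct (HKs u 1) as [s [h [Hs [Ch Hlim]]]].
{ intros m; split; [apply Cu | rewrite Nu; lra]. }
destruct (carrier_negligible beta H zeta h Hb Hz Ch (eps / 2)) as [d [Hd Hd']]; [lra|].
apply is_lim_seq_spec in Hlim.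
destruct (Hlim (mkposreal (eps / 2) ltac:(lra))) as [N1 HN1]; simpl in HN1.
destruct (archimed_cor1 d Hd) as [N2 [HN2 HN20]].
set (m := Nat.max N1 N2).
assert (Hsm : forall p, (p <= s p)%nat).
{ induction p as [|p IH]; [lia | specialize (Hs p); lia]. }
set (v := w (s m)); set (k := hnorm H (kernel beta v)).
assert (Pk : 0 < k) by apply hnorm_kernel_pos.
assert (Hv : Cmod (v - zeta)%C < d).
{ apply Rlt_trans with (1 := proj1 (Hw (s m))), Rle_lt_trans with (2 := HN2).
  apply Rinv_le_contravar; [apply lt_0_INR, HN20|].
  assert (INR N2 <= INR (s m)) by (apply le_INR; specialize (Hsm m); lia); lra. }
specialize (Hd' v Hv); fold k in Hd'.
specialize (HN1 m ltac:(lia)); rewrite Rminus_0_r, Rabs_pos_eq in HN1 by apply hnorm_ge_0.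
set (f := u (s m)) in *.
assert (Cf : carrier H f) by apply Cu.
assert (Nf : hnorm H f = 1) by apply Nu.
destruct (HS f Cf) as [CS NS]; rewrite Nf, Rmult_1_r in NS.
assert (CK := carrier_sub beta H _ _ (HKc f Cf) Ch).
(* f is g_v / |g_v|, and evaluating T f at v is pairing f with g_v. *)
assert (E : T f v = RtoC (hnorm H (g v))).
{ rewrite <- HT by exact Cf; unfold f, u; fold v.
  rewrite inner_scal_l, inner_self, <- RtoC_mult by apply Cg; f_equal.
  field; apply Rgt_not_eq, Pg. }
assert (E1 := eval_le beta H _ v CS); assert (E2 := eval_le beta H _ v CK); fold k in E1, E2.
(* T f = (T f - K f) + (K f - h) + h at v: the norm bound M, the convergence of K f to h, and the
   weak decay of the kernels against h. *)
assert (Hsum : hnorm H (g v) <= M * k + (eps / 2) * k + (eps / 2) * k).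
{ rewrite <- (Rabs_pos_eq (hnorm H (g v))) by apply hnorm_ge_0.
  rewrite <- Cmod_R, <- E.
  replace (T f v) with (fsub (T f) (K f) v + (fsub (K f) h v + h v))%C
    by (unfold fsub; ring).
  eapply Rle_trans; [apply Cmod_triangle|].
  generalize (Cmod_triangle (fsub (K f) h v) (h v)); intros Ht.
  assert (hnorm H (fsub (T f) (K f)) * k <= M * k) by (apply Rmult_le_compat_r; lra).
  assert (hnorm H (fsub (K f) h) * k <= eps / 2 * k) by (apply Rmult_le_compat_r; lra).
  lra. }
generalize (proj2 (Hw (s m))); fold v k; lra.
Qed.

(** * The quadratic form of the lower bound *)

Lemma Csum_ext {A : Type} (l : list A) (f g : A -> C) :
  (forall x, In x l -> f x = g x) -> Csum l f = Csum l g.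
Proof.
induction l as [|a l IH]; intros Hfg; simpl; [reflexivity|].
rewrite Hfg by (left; reflexivity); f_equal; apply IH; intros; apply Hfg; now right.
Qed.

Lemma Csum_mult_l {A : Type} (l : list A) (a : C) (f : A -> C) :
  (a * Csum l f = Csum l (fun x => a * f x))%C.
Proof. induction l as [|b l IH]; simpl; [ring | rewrite <- IH; ring]. Qed.

Lemma Csum_mult_r {A : Type} (l : list A) (a : C) (f : A -> C) :
  (Csum l f * a = Csum l (fun x => f x * a))%C.
Proof. induction l as [|b l IH]; simpl; [ring | rewrite <- IH; ring]. Qed.

Lemma Csum_conj {A : Type} (l : list A) (f : A -> C) :
  Cconj (Csum l f) = Csum l (fun x => Cconj (f x)).
Proof.
induction l as [|b l IH]; simpl.
- apply injective_projections; simpl; ring.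
- now rewrite Cplus_conj, IH.
Qed.

Lemma Csum_add {A : Type} (l : list A) (f g : A -> C) :
  (Csum l f + Csum l g = Csum l (fun x => f x + g x))%C.
Proof. induction l as [|b l IH]; simpl; [ring | rewrite <- IH; ring]. Qed.

Lemma Csum_zero {A : Type} (l : list A) : Csum l (fun _ => RtoC 0) = RtoC 0.
Proof. induction l as [|b l IH]; simpl; [reflexivity | rewrite IH; ring]. Qed.

Lemma Csum_swap {A B : Type} (l : list A) (m : list B) (f : A -> B -> C) :
  Csum l (fun x => Csum m (f x)) = Csum m (fun y => Csum l (fun x => f x y)).
Proof.
induction l as [|a l IH]; simpl.
- now rewrite Csum_zero.
- rewrite IH; apply Csum_add.
Qed.

Lemma Csum_single {A : Type} (l : list A) (f : A -> C) (a : A) :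
  NoDup l -> In a l -> (forall x, In x l -> x <> a -> f x = RtoC 0) -> Csum l f = f a.
Proof.
intros Hnd Ha Hf; induction Hnd as [|b l Hb Hnd IH]; [contradiction|]; simpl.
destruct Ha as [->|Ha].
- rewrite (Csum_ext l f (fun _ => RtoC 0)), Csum_zero by
    (intros x Hx; apply Hf; [now right | intros ->; contradiction]); ring.
- rewrite IH, (Hf b) by (auto with datatypes || (intros; apply Hf; auto with datatypes)
    || (intros ->; contradiction)); ring.
Qed.

Lemma Csum_dist_le {A : Type} (l : list A) (f g : A -> C) (e : R) (b : A -> R) :
  (forall x, In x l -> Cmod (f x - g x)%C <= e * b x) ->
  Cmod (Csum l f - Csum l g)%C <= e * @list_sum A R_AbelianMonoid l b.
Proof.
induction l as [|a l IH]; intros Hfg; simpl.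
- rewrite Cmod_self; right; symmetry; apply Rmult_0_r.
- change (Cmod (f a + Csum l f - (g a + Csum l g))%C
    <= e * (b a + @list_sum A R_AbelianMonoid l b)).
  replace (f a + Csum l f - (g a + Csum l g))%C
    with ((f a - g a) + (Csum l f - Csum l g))%C by ring.
  eapply Rle_trans; [apply Cmod_triangle|]; rewrite Rmult_plus_distr_l.
  apply Rplus_le_compat; [apply Hfg; now left|].
  apply IH; intros; apply Hfg; now right.
Qed.

Lemma RtoC_list_sum {A : Type} (l : list A) (f : A -> R) :
  RtoC (@list_sum A R_AbelianMonoid l f) = Csum l (fun x => RtoC (f x)).
Proof.
induction l as [|a l IH]; simpl; [reflexivity|]; rewrite <- IH.
apply (RtoC_plus (f a)).
Qed.

Definition indicator (P : Prop) : C :=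
  if excluded_middle_informative P then RtoC 1 else RtoC 0.

Lemma indicator_true (P : Prop) : P -> indicator P = RtoC 1.
Proof. intros HP; unfold indicator; destruct excluded_middle_informative; tauto. Qed.

Lemma indicator_false (P : Prop) : ~ P -> indicator P = RtoC 0.
Proof. intros HP; unfold indicator; destruct excluded_middle_informative; tauto. Qed.

Lemma indicator_conj (P : Prop) : Cconj (indicator P) = indicator P.
Proof.
unfold indicator; destruct excluded_middle_informative;
  apply injective_projections; simpl; ring.
Qed.

(** Puts the inner sums for all data over the common index range, so that the sums can be
    interchanged. *)
Lemma set_sum_indicator (n : nat) (P : nat -> Prop) (c : nat -> C) :
  set_sum (fun j => (j < n)%nat /\ P j) c = Csum (seq 0 n) (fun j => indicator (P j) * c j)%C.
Proof.
set (p := fun j => if excluded_middle_informative (P j) then true else false).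
rewrite (set_sum_enumerates _ (filter p (seq 0 n))).
- induction (seq 0 n) as [|j l IH]; simpl; [reflexivity|].
  rewrite <- IH; unfold p at 1, indicator; destruct excluded_middle_informative.
  + now rewrite Cmult_1_l.
  + now rewrite Cmult_0_l, Cplus_0_l.
- split; [apply NoDup_filter, seq_NoDup|].
  intros j; rewrite filter_In, in_seq; unfold p.
  destruct excluded_middle_informative; intuition (try lia; try discriminate).
Qed.

(** Each map contributes at most one datum. Finiteness is what gives the outer [set_sum] its
    intended value. *)
Lemma D1_set_enumerates (n : nat) (phi : nat -> Disk -> Disk) (zeta : C) :
  exists l, enumerates (D1_set n phi zeta) l.
Proof.
induction n as [|n [l [Hnd Hl]]].
- exists nil; split; [constructor|]; intros d; split; [intros []|].
  intros [j [Hj _]]; lia.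
- destruct (classic (exists d, has_D1 (phi n) zeta d /\ ~ In d l)) as [[d [Hd Hdl]]|Hn].
  + exists (d :: l); split; [constructor; assumption|].
    intros d'; split.
    * intros [<-|Hd']; [exists n; auto with arith|].
      apply Hl in Hd'; destruct Hd' as [j [Hj Hd']]; exists j; auto with arith.
    * intros [j [Hj Hd']]; destruct (Nat.eq_dec j n) as [->|].
      -- left; apply (has_D1_unique _ _ _ _ Hd Hd').
      -- right; apply Hl; exists j; split; [lia | exact Hd'].
  + exists l; split; [exact Hnd|]; intros d'; rewrite Hl; split.
    * intros [j [Hj Hd']]; exists j; auto with arith.
    * intros [j [Hj Hd']]; destruct (Nat.eq_dec j n) as [->|].
      -- apply Hl, NNPP; intros Hd; apply Hn; exists d'; auto.
      -- exists j; split; [lia | exact Hd'].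
Qed.

(** Written as a sum of rank-one matrices, one per datum, so that its quadratic form in c is the
    lower bound after interchanging sums. *)
Definition limit_gram (beta : R) (L : list (C * C)) (phi : nat -> Disk -> Disk) (zeta : C)
    (i j : nat) : C :=
  Csum L (fun d => indicator (has_D1 (phi i) zeta d) * indicator (has_D1 (phi j) zeta d)
                   * RtoC (Rpower (Cmod (snd d)) (- beta)))%C.

Lemma limit_gram_same (beta : R) (L : list (C * C)) (phi : nat -> Disk -> Disk) (zeta : C)
    (i j : nat) (d : C * C) :
  NoDup L -> In d L -> has_D1 (phi i) zeta d -> has_D1 (phi j) zeta d ->
  limit_gram beta L phi zeta i j = RtoC (Rpower (Cmod (snd d)) (- beta)).
Proof.
intros HL Hd Hi Hj; unfold limit_gram; rewrite (Csum_single L _ d HL Hd).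
- rewrite !indicator_true by assumption; ring.
- intros d' _ Hne; rewrite (indicator_false (has_D1 (phi i) zeta d')); [ring|].
  intros Hd'; apply Hne, (has_D1_unique _ _ _ _ Hd' Hi).
Qed.

Lemma limit_gram_diff (beta : R) (L : list (C * C)) (phi : nat -> Disk -> Disk) (zeta : C)
    (i j : nat) :
  (forall d, ~ (has_D1 (phi i) zeta d /\ has_D1 (phi j) zeta d)) ->
  limit_gram beta L phi zeta i j = RtoC 0.
Proof.
intros Hn; unfold limit_gram; rewrite <- (Csum_zero L); apply Csum_ext; intros d _.
destruct (classic (has_D1 (phi i) zeta d)) as [Hi|Hi].
- rewrite (indicator_false (has_D1 (phi j) zeta d)); [ring|].
  intros Hj; apply (Hn d); auto.
- rewrite (indicator_false (has_D1 (phi i) zeta d)) by exact Hi; ring.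
Qed.

Lemma lower_bound_quadratic_form (beta : R) (L : list (C * C)) (n : nat)
    (phi : nat -> Disk -> Disk) (c : nat -> C) (zeta : C) :
  RtoC (@list_sum _ R_AbelianMonoid L (fun d =>
    Cmod (set_sum (fun j => (j < n)%nat /\ has_D1 (phi j) zeta d) c) ^ 2
      * (1 / Rpower (Cmod (snd d)) beta)))
  = Csum (seq 0 n) (fun j => Csum (seq 0 n) (fun i =>
      c j * Cconj (c i) * limit_gram beta L phi zeta i j))%C.
Proof.
transitivity (Csum L (fun d => Csum (seq 0 n) (fun j => Csum (seq 0 n) (fun i =>
  c j * Cconj (c i) * (indicator (has_D1 (phi i) zeta d) * indicator (has_D1 (phi j) zeta d)
                   * RtoC (Rpower (Cmod (snd d)) (- beta)))))))%C.
- rewrite RtoC_list_sum; apply Csum_ext; intros d _.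
  rewrite set_sum_indicator, RtoC_mult, Cmod2_conj, Csum_conj.
  rewrite !Csum_mult_r; apply Csum_ext; intros j _.
  rewrite Csum_mult_l, Csum_mult_r; apply Csum_ext; intros i _.
  rewrite Cmult_conj, indicator_conj, Rpower_Ropp.
  unfold Rdiv; rewrite Rmult_1_l; ring.
- rewrite Csum_swap; apply Csum_ext; intros j _.
  rewrite Csum_swap; apply Csum_ext; intros i _.
  unfold limit_gram; rewrite Csum_mult_l; reflexivity.
Qed.

(** |g_w|^2 is the pairing of g_w with itself, that is (T g_w)(w), which expands into kernel
    values. *)
Lemma adjoint_kernel_norm (beta : R) (H : Dspace beta) (n : nat) (c : nat -> C)
    (phi : nat -> Disk -> Disk) (w : Disk) :
  RtoC (Rpower (1 - Cmod w ^ 2) beta * hnorm H (adjoint_kernel beta (seq 0 n) c phi w) ^ 2)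
  = Csum (seq 0 n) (fun j => Csum (seq 0 n) (fun i => c j * Cconj (c i) *
      (RtoC (Rpower (1 - Cmod w ^ 2) beta) * kernel beta (phi i w) (phi j w))))%C.
Proof.
destruct (adjoint_kernel_spec beta H (seq 0 n) c phi w) as [Cg Hg].
rewrite RtoC_mult, <- inner_self, Hg by exact Cg.
rewrite Csum_mult_l; apply Csum_ext; intros j _.
unfold adjoint_kernel; rewrite !Csum_mult_l; apply Csum_ext; intros i _; ring.
Qed.

(** * From the quadratic form to the essential norm *)

Lemma quadratic_form_le (beta : R) (H : Dspace beta) (n : nat) (phi : nat -> Disk -> Disk)
    (c : nat -> C) (zeta : C) (L : list (C * C)) (K : operator) (M : R) :
  1 <= beta -> (forall j, (j < n)%nat -> analytic (fun z => disk_val (phi j z))) ->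
  Cmod zeta = 1 -> enumerates (D1_set n phi zeta) L -> compact_operator H K -> 0 <= M ->
  (forall f, carrier H f ->
     carrier H (fsub (lin_comb n c (fun j => comp_op (phi j)) f) (K f)) /\
     hnorm H (fsub (lin_comb n c (fun j => comp_op (phi j)) f) (K f)) <= M * hnorm H f) ->
  @list_sum _ R_AbelianMonoid L (fun d =>
    Cmod (set_sum (fun j => (j < n)%nat /\ has_D1 (phi j) zeta d) c) ^ 2
      * (1 / Rpower (Cmod (snd d)) beta)) <= M ^ 2.
Proof.
intros Hb Han Hz [HLnd HL] HK HM HS.
set (S := @list_sum _ R_AbelianMonoid L _).
(* An error of e in every matrix entry changes the form by at most e times this sum. *)
set (Q := @list_sum nat R_AbelianMonoid (seq 0 n) (fun j =>
  @list_sum nat R_AbelianMonoid (seq 0 n) (fun i => Cmod (c j) * Cmod (c i)))).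
assert (HQ : 0 <= Q).
{ assert (Hpos : forall (l : list nat) (b : nat -> R), (forall x, 0 <= b x) ->
    0 <= @list_sum nat R_AbelianMonoid l b).
  { intros l b Hb0; induction l as [|x l IH]; [apply Rle_refl|].
    apply Rplus_le_le_0_compat; [apply Hb0 | exact IH]. }
  apply Hpos; intros j; apply Hpos; intros i; apply Rmult_le_pos; apply Cmod_ge_0. }
assert (Hmain : forall e, 0 < e -> S <= (M + e) ^ 2 + e * Q).
{ intros e He.
  destruct (adjoint_kernel_bound beta H n c phi zeta K M e Hb Hz HK HM HS He)
    as [dl [Hdl Hg]].
  (* One point w serves both estimates: the norm bound holds on a full neighbourhood of zeta, the
     Gram limit only along the segments. *)
  destruct (segment_eventually_exists zeta _ Hz
    (segment_eventually_and zeta _ _ (segment_eventually_near zeta dl Hz Hdl)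
      (gram_limit beta zeta n phi e Hb Hz Han He))) as [w [Hw Hgram]].
  specialize (Hg w Hw).
  set (x := Rpower (1 - Cmod w ^ 2) beta) in *.
  assert (Hx : 0 < x) by apply exp_pos.
  set (N := hnorm H (adjoint_kernel beta (seq 0 n) c phi w)) in *.
  assert (HN : x * N ^ 2 <= (M + e) ^ 2).
  { apply Rle_trans with (x * ((M + e) * hnorm H (kernel beta w)) ^ 2).
    - apply Rmult_le_compat_l; [lra|]; apply pow_incr; split; [apply hnorm_ge_0 | exact Hg].
    - rewrite Rpow_mult_distr, hnorm_kernel_sq; unfold x.
      right; rewrite Rpower_Ropp; field; apply Rgt_not_eq, exp_pos. }
  assert (Hd : Cmod (RtoC (x * N ^ 2) - RtoC S)%C <= e * Q).
  { unfold S, N, x; rewrite lower_bound_quadratic_form, adjoint_kernel_norm; fold x.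
    apply Csum_dist_le; intros j Hj; apply Csum_dist_le; intros i Hi.
    apply in_seq in Hi; apply in_seq in Hj.
    destruct (Hgram i ltac:(lia) j ltac:(lia)) as [Hsame Hdiff].
    set (k := (RtoC x * kernel beta (phi i w) (phi j w))%C) in *.
    replace (c j * Cconj (c i) * k - c j * Cconj (c i) * limit_gram beta L phi zeta i j)%C
      with (c j * Cconj (c i) * (k - limit_gram beta L phi zeta i j))%C by ring.
    rewrite !Cmod_mult, Cmod_conj, Rmult_comm.
    apply Rmult_le_compat_r; [apply Rmult_le_pos; apply Cmod_ge_0|].
    apply Rlt_le.
    destruct (classic (exists d, has_D1 (phi i) zeta d /\ has_D1 (phi j) zeta d))
      as [[d [Hdi Hdj]]|Hn].
    - rewrite (limit_gram_same beta L phi zeta i j d); auto.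
      apply HL; exists i; split; [lia | exact Hdi].
    - assert (Hn' : forall d, ~ (has_D1 (phi i) zeta d /\ has_D1 (phi j) zeta d))
        by (intros d Hd; apply Hn; exists d; exact Hd).
      rewrite limit_gram_diff by exact Hn'.
      replace (k - RtoC 0)%C with k by ring; auto. }
  rewrite <- RtoC_minus, Cmod_R in Hd; apply Rabs_le_between in Hd; lra. }
apply le_epsilon; intros eps He.
(* For e <= 1, (M + e)^2 + e Q <= M^2 + e D. *)
set (D := 2 * M + 1 + Q).
assert (H0 : 0 < eps / (D + 1)) by (apply Rdiv_lt_0_compat; unfold D; lra).
set (e := Rmin 1 (eps / (D + 1))).
assert (He0 : 0 < e) by (apply Rmin_glb_lt; lra).
assert (He1 : e <= 1) by apply Rmin_l.
assert (He2 : e * D <= eps).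
{ apply Rle_trans with (eps / (D + 1) * (D + 1)); [|right; field; unfold D; lra].
  apply Rmult_le_compat; try (unfold D; lra); apply Rmin_r. }
specialize (Hmain e He0); unfold D in He2; nra.
Qed.

Theorem theorem5p2 (beta : R) (Hbeta : 1 <= beta) (H : Dspace beta)
    (n : nat) (phi : nat -> Disk -> Disk)
    (Hphi : forall j, (j < n)%nat -> analytic (fun z => disk_val (phi j z)))
    (c : nat -> C) (zeta : C)
    (Hzeta : exists j, (j < n)%nat /\ in_F (phi j) zeta) :
  let E := ess_norm H (lin_comb n c (fun j => comp_op (phi j))) in
  Rbar_le
    (Finite
      (set_sum (D1_set n phi zeta)
        (fun d : C * C =>
          Cmod (set_sum (fun j => (j < n)%nat /\ has_D1 (phi j) zeta d) c) ^ 2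
          * (1 / Rpower (Cmod (snd d)) beta))))
    (Rbar_mult E E).
Proof.
intros E.
assert (Hz : Cmod zeta = 1) by (destruct Hzeta as [j [_ [d Hd]]]; apply Hd).
destruct (D1_set_enumerates n phi zeta) as [L HL].
rewrite (set_sum_enumerates _ L) by exact HL.
set (S := list_sum L _).
(* The greatest lower bounds concern E rather than its square, so square roots are compared
   first. *)
assert (HE : Rbar_le (Finite (sqrt S)) E).
{ apply (proj2 (proj2_sig (Rbar_ex_glb _))).
  intros x [K [HK ->]].
  apply (proj2 (Glb_Rbar_correct _)); intros M [HM HS]; simpl.
  rewrite <- (sqrt_pow2 M HM); apply sqrt_le_1_alt.
  apply (quadratic_form_le beta H n phi c zeta L K M); assumption. }
(* An infinite essential norm has infinite square, and [HE] excludes minus infinity. *)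
destruct E as [r| |]; [|exact I|contradiction].
simpl in HE |- *.
assert (Hr : 0 <= r) by (generalize (sqrt_pos S); lra).
destruct (Rle_dec 0 S) as [HS|HS]; [|nra].
rewrite <- (sqrt_sqrt S HS); apply Rmult_le_compat; try apply sqrt_pos; exact HE.
Qed.
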